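(* Let $K$ be a field with $\mathrm{char}\,K\ne2$. Let $\mathbb{G}$ be an even-diagonalizable algebraic supergroup over $K$, let $G=\mathbb{G}_{ev}$ (a diagonalizable algebraic group), $X=X(G)$ its character group, $V=\mathrm{Lie}(\mathbb{G})_1$, and $V=\bigoplus_{g\in X}V(g)$ the weight decomposition of $V$. Let $[\ ,\ ]:V\times V\to\mathrm{Lie}(G)$ be the restriction of the Lie superbracket of $\mathrm{Lie}(\mathbb{G})$. Then the following are equivalent: (1) $\mathbb{G}$ is super-diagonalizable; (2) the bracket $[\ , \ ] : V \times V \to \mathrm{Lie}(G)$ is non-degenerate; (3) for every $g\in X$ such that $V(g) \ne 0$, the restriction $[\ , \ ]|_{V(g) \times V(g^{-1})}$ is non-degenerate.
   Context: ''Super'' means $\mathbb{Z}_2$-graded. An algebraic supergroup $\mathbb{G}$ over $K$ is a group-valued functor on super-commutative superalgebras represented by a finitely generated super-commutative Hopf superalgebra $K[\mathbb{G}]$. $\mathbb{G}_{ev}$ is the algebraic group (scheme) represented by $K[\mathbb{G}]/(K[\mathbb{G}]_1)$. $\mathrm{Lie}(\mathbb{G})$ is the Lie superalgebra of $\mathbb{G}$, with even component $\mathrm{Lie}(\mathbb{G}_{ev})$. An algebraic group $G$ is diagonalizable if $K[G]$ is spanned by grouplikes; then $K[G]$ is the group algebra of the character group $X(G)$. $\mathbb{G}$ is even-diagonalizable if $\mathbb{G}_{ev}$ is diagonalizable. A supergroup is unipotent if its only simple supermodules are the trivial one-dimensional ones (in either parity); the unipotent radical $\mathbb{G}_u$ is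 the largest unipotent normal closed super-subgroup. An even-diagonalizable $\mathbb{G}$ is super-diagonalizable if $\mathbb{G}_u=1$. $V=\mathrm{Lie}(\mathbb{G})_1$ is a right $G$-module via $\langle v^{\gamma}, a \rangle = \gamma^{-1}(\overline{a}_{(1)}) \langle v, a_{(2)}\rangle \gamma(\overline{a}_{(3)})$ ($v\in V$, $\gamma\in G(R)$, $a\in K[\mathbb{G}]$, with $a\mapsto \overline a$ the quotient map $K[\mathbb{G}]\to K[G]$ and $\langle\ ,\ \rangle:\mathrm{Lie}(\mathbb{G})\times K[\mathbb{G}]\to K$ the canonical pairing). Let $\lambda:V\to K[G]\otimes V$ be the corresponding left $K[G]$-comodule structure; $V(g)=\{v\in V\mid\lambda(v)=g\otimes v\}$. A bilinear map $\beta:V_1\times V_2\to L$ is non-degenerate if $\beta(v,V_2)=0$ implies $v=0$ and $\beta(V_1,w)=0$ implies $w=0$. *)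

(* Defs.v *)
From HB Require Import structures.
From mathcomp Require Import all_boot all_order all_algebra.
From mathcomp Require Import boolp functions.
From mathcomp Require Import ring.
Set Implicit Arguments. Unset Strict Implicit. Unset Printing Implicit Defensive.
Import GRing.Theory.
Local Open Scope ring_scope.
Local Open Scope quotient_scope.

Section LinearPred.
Variables (K : fieldType) (U V : lmodType K) (f : U -> V) (lf : linear f).
Let g : {linear U -> V} :=
  HB.pack_for {linear U -> V} f (GRing.isLinear.Build _ _ _ _ f lf).
Lemma lin0 : f 0 = 0. Proof. exact: (linear0 g). Qed.
Lemma linD x y : f (x + y) = f x + f y. Proof. exact: (linearD g). Qed.
Lemma linB x y : f (x - y) = f x - f y. Proof. exact: (linearB g). Qed.
Lemma linZ c x : f (c *: x) = c *: f x. Proof. exact: (linearZZ g). Qed.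
Lemma lin_sum I r (P : pred I) F :
  f (\sum_(i <- r | P i) F i) = \sum_(i <- r | P i) f (F i).
Proof. exact: (linear_sum g). Qed.
End LinearPred.

Definition bilin (K : fieldType) (U V W : lmodType K) (f : U -> V -> W) : Prop :=
  (forall u, linear (f u)) /\ (forall v, linear (f^~ v)).

Section Tensor.
Variables (K : fieldType) (U V : lmodType K).

Definition formal_sum (W : zmodType) (f : U -> V -> W) (s : seq (U * V)) : W :=
  \sum_(p <- s) f p.1 p.2.

(* Elements of the tensor product are formal sums [:: (u1, v1); (u2, v2)], read as
   u1 (x) v1 + u2 (x) v2, two of them being identified when every bilinear map,
   into any K-module, takes the same value on both (the universal property). *)
Definition tensor_eq (s t : seq (U * V)) : bool :=
  `[< forall (W : lmodType K) (f : U -> V -> W),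
        bilin f -> formal_sum f s = formal_sum f t >].

Lemma tensor_eq_refl : reflexive tensor_eq.
Proof. by move=> s; apply/asboolP. Qed.

Lemma tensor_eq_sym : symmetric tensor_eq.
Proof.
by move=> s t; apply/asboolP/asboolP => h W f bf; rewrite h.
Qed.

Lemma tensor_eq_trans : transitive tensor_eq.
Proof.
move=> t s u /asboolP h1 /asboolP h2; apply/asboolP => W f bf.
by rewrite h1 // h2.
Qed.

Canonical tensor_equiv :=
  EquivRel tensor_eq tensor_eq_refl tensor_eq_sym tensor_eq_trans.

Definition tensor := {eq_quot tensor_equiv}.
HB.instance Definition _ := Choice.on tensor.
HB.instance Definition _ := EqQuotient.on tensor.

Definition tens (u : U) (v : V) : tensor := \pi_tensor [:: (u, v)].

(* The map on tensors induced by f. The value is independent of the chosen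
   representative when f is bilinear (tlift_pi), as it is in every use below, so
   tlift (fun x y => e) (comul a) reads as the Sweedler sum of e. *)
Definition tlift (W : zmodType) (f : U -> V -> W) (t : tensor) : W :=
  formal_sum f (repr t).

Lemma tlift_pi (W : lmodType K) (f : U -> V -> W) s :
  bilin f -> tlift f (\pi_tensor s) = formal_sum f s.
Proof.
move=> bf; rewrite /tlift; case: piP => t /eqmodP /asboolP h.
by rewrite h.
Qed.

Lemma tensorP (x y : tensor) :
  (forall (W : lmodType K) (f : U -> V -> W), bilin f -> tlift f x = tlift f y) ->
  x = y.
Proof.
move=> h; rewrite -[x]reprK -[y]reprK; apply/eqmodP/asboolP => W f bf.
exact: h.
Qed.

Definition tadd (x y : tensor) : tensor := \pi_tensor (repr x ++ repr y).
Definition tscale (c : K) (x : tensor) : tensor :=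
  \pi_tensor [seq (c *: p.1, p.2) | p <- repr x].
Definition topp (x : tensor) : tensor := tscale (-1) x.
Definition tzero : tensor := \pi_tensor [::].

Lemma tlift_tadd (W : lmodType K) (f : U -> V -> W) x y :
  bilin f -> tlift f (tadd x y) = tlift f x + tlift f y.
Proof. by move=> bf; rewrite tlift_pi // /formal_sum big_cat. Qed.

Lemma tlift_tscale (W : lmodType K) (f : U -> V -> W) c x :
  bilin f -> tlift f (tscale c x) = c *: tlift f x.
Proof.
move=> bf; rewrite tlift_pi // /formal_sum big_map scaler_sumr.
by apply: eq_bigr => p _ /=; rewrite (linZ (bf.2 _)).
Qed.

Lemma tlift_tzero (W : lmodType K) (f : U -> V -> W) :
  bilin f -> tlift f tzero = 0.
Proof. by move=> bf; rewrite tlift_pi // /formal_sum big_nil. Qed.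

Fact taddA : associative tadd.
Proof. by move=> x y z; apply: tensorP => W f bf; rewrite !tlift_tadd // addrA. Qed.
Fact taddC : commutative tadd.
Proof. by move=> x y; apply: tensorP => W f bf; rewrite !tlift_tadd // addrC. Qed.
Fact tadd0 : left_id tzero tadd.
Proof. by move=> x; apply: tensorP => W f bf; rewrite tlift_tadd // tlift_tzero // add0r. Qed.
Fact taddN : left_inverse tzero topp tadd.
Proof.
move=> x; apply: tensorP => W f bf.
by rewrite tlift_tadd // tlift_tscale // tlift_tzero // scaleN1r addNr.
Qed.
HB.instance Definition _ := GRing.isZmodule.Build tensor taddA taddC tadd0 taddN.

Fact tscaleA a b x : tscale a (tscale b x) = tscale (a * b) x.
Proof. by apply: tensorP => W f bf; rewrite !tlift_tscale // scalerA. Qed.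
Fact tscale1 : left_id 1 tscale.
Proof. by move=> x; apply: tensorP => W f bf; rewrite tlift_tscale // scale1r. Qed.
Fact tscaleDr : right_distributive tscale +%R.
Proof.
move=> a x y; apply: tensorP => W f bf.
by rewrite tlift_tscale // !tlift_tadd // !tlift_tscale // scalerDr.
Qed.
Fact tscaleDl x : {morph tscale^~ x : a b / a + b >-> a + b}.
Proof.
move=> a b; apply: tensorP => W f bf.
by rewrite tlift_tscale // tlift_tadd // !tlift_tscale // scalerDl.
Qed.
HB.instance Definition _ :=
  GRing.Zmodule_isLmodule.Build K tensor tscaleA tscale1 tscaleDr tscaleDl.

Lemma tlift_linear (W : lmodType K) (f : U -> V -> W) :
  bilin f -> linear (tlift f).
Proof. by move=> bf c x y; rewrite tlift_tadd // tlift_tscale. Qed.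

Lemma tlift_tens (W : lmodType K) (f : U -> V -> W) u v :
  bilin f -> tlift f (tens u v) = f u v.
Proof. by move=> bf; rewrite tlift_pi // /formal_sum big_seq1. Qed.

Lemma bilin_tens : bilin tens.
Proof.
split=> [u | v] c x y; apply: tensorP => W f bf;
  rewrite tlift_linear // !tlift_tens //; case: bf => b1 b2; [exact: b1 | exact: b2].
Qed.

Lemma tensorE (x : tensor) : x = \sum_(p <- repr x) tens p.1 p.2.
Proof.
apply: tensorP => W f bf.
rewrite (lin_sum (tlift_linear bf)).
by apply: eq_bigr => p _; rewrite tlift_tens.
Qed.
End Tensor.

Section TensorTheory.
Variable K : fieldType.

Lemma tensor_elim (U V : lmodType K) (P : tensor U V -> Prop) :
  (forall u v, P (tens u v)) -> P 0 -> (forall x y, P x -> P y -> P (x + y)) ->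
  forall t, P t.
Proof.
move=> h1 h0 hD t; rewrite [t]tensorE.
by elim/big_ind: _ => // p _; exact: h1.
Qed.

Lemma tensor_ext (U V W : lmodType K) (F G : tensor U V -> W) :
  linear F -> linear G -> (forall u v, F (tens u v) = G (tens u v)) -> F =1 G.
Proof.
move=> lF lG h; apply: tensor_elim => // [|x y hx hy]; first by rewrite !lin0.
by rewrite !linD // hx hy.
Qed.

Lemma tlift_param (X U V W : lmodType K) (f : X -> U -> V -> W) t :
  (forall u v, linear (fun x => f x u v)) -> linear (fun x => tlift (f x) t).
Proof.
move=> lf c x y; rewrite /tlift /formal_sum scaler_sumr -big_split /=.
by apply: eq_bigr => p _; rewrite lf.
Qed.

Lemma eq_tlift (U V W : lmodType K) (f g : U -> V -> W) t :
  (forall u v, f u v = g u v) -> tlift f t = tlift g t.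
Proof. by move=> h; apply: eq_bigr => p _; rewrite h. Qed.

Lemma lin_tlift (U V W W' : lmodType K) (h : W -> W') (f : U -> V -> W) t :
  linear h -> h (tlift f t) = tlift (fun u v => h (f u v)) t.
Proof. by move=> lh; rewrite /tlift /formal_sum lin_sum. Qed.

Lemma linear_id' (U : lmodType K) : linear (@id U). Proof. by []. Qed.

Lemma linear_comp (U V W : lmodType K) (f : U -> V) (g : V -> W) :
  linear f -> linear g -> linear (fun x => g (f x)).
Proof. by move=> lf lg c x y; rewrite lf lg. Qed.

Lemma bilin_comp (U V U' V' W : lmodType K) (f : U -> U') (g : V -> V')
    (b : U' -> V' -> W) :
  linear f -> linear g -> bilin b -> bilin (fun u v => b (f u) (g v)).
Proof.
move=> lf lg [b1 b2]; split=> [u | v].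
  exact: (linear_comp lg (b1 _)).
exact: (linear_comp lf (b2 _)).
Qed.
End TensorTheory.

Definition tmap (K : fieldType) (U V U' V' : lmodType K)
    (f : U -> U') (g : V -> V') : tensor U V -> tensor U' V' :=
  tlift (fun u v => tens (f u) (g v)).

Definition tassoc (K : fieldType) (U V W : lmodType K) :
    tensor (tensor U V) W -> tensor U (tensor V W) :=
  tlift (fun t w => tlift (fun u v => tens u (tens v w)) t).

Section TmapTheory.
Variables (K : fieldType).

Lemma bilin_tmap (U V U' V' : lmodType K) (f : U -> U') (g : V -> V') :
  linear f -> linear g -> bilin (fun u v => tens (f u) (g v)).
Proof. by move=> lf lg; apply: bilin_comp => //; exact: bilin_tens. Qed.

Lemma tmap_linear (U V U' V' : lmodType K) (f : U -> U') (g : V -> V') :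
  linear f -> linear g -> linear (tmap f g).
Proof. by move=> lf lg; apply: tlift_linear; exact: bilin_tmap. Qed.

Lemma tmap_tens (U V U' V' : lmodType K) (f : U -> U') (g : V -> V') u v :
  linear f -> linear g -> tmap f g (tens u v) = tens (f u) (g v).
Proof. by move=> lf lg; rewrite /tmap tlift_tens //; exact: bilin_tmap. Qed.

Lemma tlift_tmap (U V U' V' W : lmodType K) (f : U -> U') (g : V -> V')
    (b : U' -> V' -> W) t :
  linear f -> linear g -> bilin b ->
  tlift b (tmap f g t) = tlift (fun u v => b (f u) (g v)) t.
Proof.
move=> lf lg bb; move: t; apply: tensor_ext.
- apply: linear_comp; [exact: tmap_linear | exact: tlift_linear].
- by apply: tlift_linear; exact: bilin_comp.
by move=> u v; rewrite tmap_tens // !tlift_tens //; exact: bilin_comp.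
Qed.

Lemma tmap_comp (U V U' V' U'' V'' : lmodType K) (f : U -> U') (g : V -> V')
    (f' : U' -> U'') (g' : V' -> V'') t :
  linear f -> linear g -> linear f' -> linear g' ->
  tmap f' g' (tmap f g t) = tmap (fun u => f' (f u)) (fun v => g' (g v)) t.
Proof. by move=> *; rewrite {1}/tmap tlift_tmap //; exact: bilin_tmap. Qed.

Lemma bilin_tassoc (U V W : lmodType K) :
  bilin (fun (t : tensor U V) (w : W) => tlift (fun u v => tens u (tens v w)) t).
Proof.
have [b1 b2] := @bilin_tens K U (tensor V W).
have [c1 c2] := @bilin_tens K V W.
split=> [t | w].
  by apply: tlift_param => u v; exact: (linear_comp (c1 v) (b1 u)).
apply: tlift_linear; split=> [u | v]; last exact: b2.
exact: (linear_comp (c2 w) (b1 _)).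
Qed.

Lemma tassoc_linear (U V W : lmodType K) : linear (@tassoc K U V W).
Proof. by apply: tlift_linear; exact: bilin_tassoc. Qed.

Lemma tassoc_tens (U V W : lmodType K) (u : U) (v : V) (w : W) :
  tassoc (tens (tens u v) w) = tens u (tens v w).
Proof.
rewrite /tassoc tlift_tens; last exact: bilin_tassoc.
rewrite tlift_tens //.
have [b1 b2] := @bilin_tens K U (tensor V W).
have [c1 c2] := @bilin_tens K V W.
split=> [u' | v']; last exact: b2.
exact: (linear_comp (c2 w) (b1 _)).
Qed.

Lemma tmap_tassoc (U V W U' V' W' : lmodType K)
    (f : U -> U') (g : V -> V') (h : W -> W') t :
  linear f -> linear g -> linear h ->
  tmap f (tmap g h) (tassoc t) = tassoc (tmap (tmap f g) h t).
Proof.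
move=> lf lg lh.
have lgh := tmap_linear lg lh; have lfg := tmap_linear lf lg.
move: t; apply: tensor_ext.
- apply: linear_comp; [exact: tassoc_linear | exact: tmap_linear].
- apply: linear_comp; [exact: tmap_linear | exact: tassoc_linear].
move=> t w; rewrite (tmap_tens _ _ lfg lh); move: t; apply: tensor_ext.
- exact: (linear_comp ((bilin_tens (tensor U V) W).2 w)
           (linear_comp (@tassoc_linear _ _ _) (tmap_linear lf lgh))).
- exact: (linear_comp lfg (linear_comp ((bilin_tens (tensor U' V') W').2 (h w))
           (@tassoc_linear _ _ _))).
by move=> u v; rewrite tassoc_tens !tmap_tens // tassoc_tens.
Qed.
End TmapTheory.

(* The Z/2-grading is given by its two projections: spart false and spart true
   are the projections onto the even and the odd component, and x is
   homogeneous of parity i iff spart i x = x. *)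
HB.mixin Record isSuperModule (K : fieldType) V of GRing.Lmodule K V := {
  spart : bool -> V -> V;
  spart_linear : forall i, linear (spart i);
  spartD : forall v, spart false v + spart true v = v;
  spartK : forall i j v, spart i (spart j v) = if i == j then spart j v else 0
}.
#[short(type="superModType")]
HB.structure Definition SuperModule (K : fieldType) :=
  {V of isSuperModule K V & GRing.Lmodule K V}.

HB.mixin Record isSuperAlgebra (K : fieldType) A
    of GRing.Algebra K A & SuperModule K A := {
  spartM : forall i j (x y : A), spart i x = x -> spart j y = y ->
    spart (i (+) j) (x * y) = x * y
}.
#[short(type="superAlgType")]
HB.structure Definition SuperAlgebra (K : fieldType) :=
  {A of isSuperAlgebra K A & GRing.Algebra K A & SuperModule K A}.

(* When 2 is invertible this forces odd elements to have square zero. *)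
HB.mixin Record isSuperCommutative (K : fieldType) A of SuperAlgebra K A := {
  superC : forall i j (x y : A), spart i x = x -> spart j y = y ->
    x * y = (-1) ^+ (i && j) *: (y * x)
}.
#[short(type="scomAlgType")]
HB.structure Definition SuperComAlgebra (K : fieldType) :=
  {A of isSuperCommutative K A & SuperAlgebra K A}.

Definition tpart (K : fieldType) (U V : superModType K) (k : bool)
    (t : tensor U V) : tensor U V :=
  \sum_(i : bool) tmap (spart i) (spart (i (+) k)) t.

(* Koszul rule: (a (x) b)(c (x) d) = (-1)^(|b||c|) ac (x) bd for homogeneous b, c. *)
Definition tmul (K : fieldType) (A B : superAlgType K) (s t : tensor A B) :
    tensor A B :=
  tlift (fun a b => tlift (fun c d => \sum_(i : bool) \sum_(j : bool)
    (-1) ^+ (i && j) *: tens (a * spart j c) (spart i b * d)) t) s.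

(* That the antipode is a morphism of superalgebras is automatic for a
   supercommutative Hopf superalgebra: it says that inversion is a morphism of
   functors. *)
HB.mixin Record isHopfSuperAlgebra (K : fieldType) A of SuperComAlgebra K A := {
  comul : A -> tensor A A;
  counit : A -> K^o;
  antipode : A -> A;
  comul_linear : linear comul;
  comul1 : comul 1 = tens 1 1;
  comulM : forall a b : A, comul (a * b) = tmul (comul a) (comul b);
  comul_part : forall k a, comul (spart k a) = tpart k (comul a);
  counit_linear : linear counit;
  counit1 : counit 1 = 1;
  counitM : forall a b : A, counit (a * b) = counit a * counit b;
  counit_odd : forall a, counit (spart true a) = 0;
  antipode_linear : linear antipode;
  antipode1 : antipode 1 = 1;
  antipodeM : forall a b : A, antipode (a * b) = antipode a * antipode b;
  antipode_part : forall k a, antipode (spart k a) = spart k (antipode a);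
  comulA : forall a, tassoc (tmap comul id (comul a)) = tmap id comul (comul a);
  comul_counitl : forall a, tlift (fun x y : A => counit x *: y) (comul a) = a;
  comul_counitr : forall a, tlift (fun x y : A => counit y *: x) (comul a) = a;
  antipodel : forall a,
    tlift (fun x y : A => antipode x * y) (comul a) = counit a *: 1;
  antipoder : forall a,
    tlift (fun x y : A => x * antipode y) (comul a) = counit a *: 1
}.
#[short(type="hopfSuperAlgType")]
HB.structure Definition HopfSuperAlgebra (K : fieldType) :=
  {A of isHopfSuperAlgebra K A & SuperComAlgebra K A}.

Definition tens_span (K : fieldType) (U V : lmodType K) (P : U -> V -> Prop)
    (t : tensor U V) : Prop :=
  exists2 s : seq (U * V),
    (forall p, p \in s -> P p.1 p.2) & t = \sum_(p <- s) tens p.1 p.2.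

(* Hopf superideals I; they correspond to the closed super-subgroups. The field
   hopfIdeal_comul says comul I <= I (x) A + A (x) I. The ideal is proper because
   counit vanishes on it. *)
Record hopfIdeal (K : fieldType) (A : hopfSuperAlgType K) := HopfIdeal {
  hopfIdeal_mem :> A -> Prop;
  hopfIdeal0 : hopfIdeal_mem 0;
  hopfIdealP : forall c x y,
    hopfIdeal_mem x -> hopfIdeal_mem y -> hopfIdeal_mem (c *: x + y);
  hopfIdealMl : forall a x, hopfIdeal_mem x -> hopfIdeal_mem (a * x);
  hopfIdealMr : forall a x, hopfIdeal_mem x -> hopfIdeal_mem (x * a);
  hopfIdeal_part : forall i x, hopfIdeal_mem x -> hopfIdeal_mem (spart i x);
  hopfIdeal_comul : forall x, hopfIdeal_mem x ->
    tens_span (fun a b => hopfIdeal_mem a \/ hopfIdeal_mem b) (comul x);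
  hopfIdeal_counit : forall x, hopfIdeal_mem x -> counit x = 0;
  hopfIdeal_antipode : forall x, hopfIdeal_mem x -> hopfIdeal_mem (antipode x)
}.

Section TmulTheory.
Variables (K : fieldType).

Lemma mull_linear (A : algType K) (x : A) : linear (fun y => y * x).
Proof. by move=> c y z; rewrite mulrDl scalerAl. Qed.
Lemma mulr_linear (A : algType K) (x : A) : linear (fun y => x * y).
Proof. by move=> c y z; rewrite mulrDr scalerAr. Qed.

Lemma sumz_linear (U V : lmodType K) (I : finType) (s : I -> K) (F : I -> U -> V) :
  (forall i, linear (F i)) -> linear (fun x => \sum_i s i *: F i x).
Proof.
move=> lF c x y; rewrite scaler_sumr -big_split /=; apply: eq_bigr => i _.
by rewrite lF scalerDr !scalerA mulrC.
Qed.

Definition tmul4 (A B : superAlgType K) (a : A) (b : B) (c : A) (d : B) : tensor A B :=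
  \sum_(i : bool) \sum_(j : bool)
    (-1) ^+ (i && j) *: tens (a * spart j c) (spart i b * d).

Let scomb (U V : lmodType K) (F : bool -> bool -> U -> V) :
  (forall i j, linear (F i j)) ->
  linear (fun x => \sum_(i : bool) \sum_(j : bool) (-1 : K) ^+ (i && j) *: F i j x).
Proof.
move=> lF c x y; rewrite scaler_sumr -big_split /=; apply: eq_bigr => i _.
exact: sumz_linear.
Qed.

Lemma tmul4_lin (A B : superAlgType K) :
  [/\ forall (b : B) c d, linear (fun a : A => tmul4 a b c d),
      forall (a : A) c d, linear (fun b : B => tmul4 a b c d),
      forall a (b : B) d, linear (fun c : A => tmul4 a b c d) &
      forall (a : A) b c, linear (fun d : B => tmul4 a b c d)].
Proof.
have [t1 t2] := @bilin_tens K A B.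
split=> [b c d|a c d|a b d|a b c]; apply: scomb => i j.
- exact: (linear_comp (@mull_linear _ _) (t2 _)).
- exact: (linear_comp (linear_comp (@spart_linear _ _ i) (@mull_linear _ _)) (t1 _)).
- exact: (linear_comp (linear_comp (@spart_linear _ _ j) (@mulr_linear _ _)) (t2 _)).
- exact: (linear_comp (@mulr_linear _ _) (t1 _)).
Qed.

Lemma bilin_tmul4 (A B : superAlgType K) (a : A) (b : B) : bilin (tmul4 a b).
Proof. by have [t1 t2 t3 t4] := tmul4_lin A B; split => ? *; auto. Qed.

Lemma bilin_tmul_in (A B : superAlgType K) (t : tensor A B) :
  bilin (fun a b => tlift (tmul4 a b) t).
Proof.
have [t1 t2 t3 t4] := tmul4_lin A B.
by split=> [a|b]; apply: tlift_param => c d; auto.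
Qed.

Lemma bilin_tmul (A B : superAlgType K) : bilin (@tmul K A B).
Proof.
split=> [s | t]; last exact: tlift_linear (bilin_tmul_in t).
by apply: tlift_param => a b; exact: tlift_linear (bilin_tmul4 a b).
Qed.

Lemma tmul_tens (A B : superAlgType K) (a c : A) (b d : B) :
  tmul (tens a b) (tens c d) = tmul4 a b c d.
Proof.
rewrite /tmul (tlift_tens _ _ (bilin_tmul_in (tens c d))).
by rewrite tlift_tens //; exact: bilin_tmul4.
Qed.

Lemma tmap_tmul (A B A' B' : superAlgType K) (f : A -> A') (g : B -> B') s t :
  linear f -> linear g -> {morph f : x y / x * y} -> {morph g : x y / x * y} ->
  (forall i a, f (spart i a) = spart i (f a)) ->
  (forall i b, g (spart i b) = spart i (g b)) ->
  tmap f g (tmul s t) = tmul (tmap f g s) (tmap f g t).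
Proof.
move=> lf lg fM gM fp gp; have lfg := tmap_linear lf lg.
have [m1 m2] := bilin_tmul A B; have [n1 n2] := bilin_tmul A' B'.
move: s; apply: tensor_ext.
- exact: (linear_comp (m2 t) lfg).
- exact: (linear_comp lfg (n2 _)).
move=> a b; move: t; apply: tensor_ext.
- exact: (linear_comp (m1 (tens a b)) lfg).
- exact: (linear_comp lfg (n1 _)).
move=> c d; rewrite !tmap_tens // !tmul_tens /tmul4 (lin_sum lfg).
apply: eq_bigr => i _; rewrite (lin_sum lfg); apply: eq_bigr => j _.
by rewrite (linZ lfg) tmap_tens // fM gM fp gp.
Qed.

Lemma tmap_tpart (U V U' V' : superModType K) (f : U -> U') (g : V -> V') k t :
  linear f -> linear g ->
  (forall i a, f (spart i a) = spart i (f a)) ->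
  (forall i b, g (spart i b) = spart i (g b)) ->
  tmap f g (tpart k t) = tpart k (tmap f g t).
Proof.
move=> lf lg fp gp; rewrite /tpart (lin_sum (tmap_linear lf lg)).
apply: eq_bigr => i _; rewrite !tmap_comp //; try exact: spart_linear.
by apply: eq_tlift => u v; rewrite fp gp.
Qed.
End TmulTheory.

Section HopfQuotient.
Variables (K : fieldType) (A : hopfSuperAlgType K) (I : hopfIdeal A).

Definition hopfIdeal_rel (x y : A) : bool := `[< I (x - y) >].

Let I0 : I 0. Proof. exact: hopfIdeal0. Qed.
Let ID x y : I x -> I y -> I (x + y).
Proof. by move=> hx hy; have := hopfIdealP 1 hx hy; rewrite scale1r. Qed.
Let IZ c x : I x -> I (c *: x).
Proof. by move=> hx; have := hopfIdealP c hx I0; rewrite addr0. Qed.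
Let IN x : I x -> I (- x).
Proof. by rewrite -scaleN1r; exact: IZ. Qed.

Fact hopfIdeal_rel_refl : reflexive hopfIdeal_rel.
Proof. by move=> x; apply/asboolP; rewrite subrr. Qed.
Fact hopfIdeal_rel_sym : symmetric hopfIdeal_rel.
Proof.
by move=> x y; apply/asboolP/asboolP => /IN; rewrite opprB.
Qed.
Fact hopfIdeal_rel_trans : transitive hopfIdeal_rel.
Proof.
move=> y x z /asboolP h1 /asboolP h2; apply/asboolP.
by have := ID h1 h2; rewrite addrA subrK.
Qed.
Canonical hopfIdeal_equiv := EquivRel hopfIdeal_rel
  hopfIdeal_rel_refl hopfIdeal_rel_sym hopfIdeal_rel_trans.

Definition hopfQuot := {eq_quot hopfIdeal_equiv}.
HB.instance Definition _ := Choice.on hopfQuot.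
HB.instance Definition _ := EqQuotient.on hopfQuot.

Definition hpi (a : A) : hopfQuot := \pi a.

Lemma hpiP a b : hpi a = hpi b <-> I (a - b).
Proof.
split=> [/eqmodP /asboolP //|h]; by apply/eqmodP/asboolP.
Qed.
Lemma hpi_repr (x : hopfQuot) : hpi (repr x) = x.
Proof. exact: reprK. Qed.
Lemma repr_hpi a : I (repr (hpi a) - a).
Proof. by apply/hpiP; rewrite hpi_repr. Qed.
Lemma hopfQuot_ind (P : hopfQuot -> Prop) : (forall a, P (hpi a)) -> forall x, P x.
Proof. by move=> h x; rewrite -[x]hpi_repr. Qed.

Let qadd (x y : hopfQuot) := hpi (repr x + repr y).
Let qopp (x : hopfQuot) := hpi (- repr x).
Let qscale (c : K) (x : hopfQuot) := hpi (c *: repr x).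
Let qmul (x y : hopfQuot) := hpi (repr x * repr y).

Let qaddE a b : qadd (hpi a) (hpi b) = hpi (a + b).
Proof. by apply/hpiP; rewrite opprD addrACA; apply: ID; exact: repr_hpi. Qed.
Let qoppE a : qopp (hpi a) = hpi (- a).
Proof. by apply/hpiP; rewrite -opprD; apply: IN; exact: repr_hpi. Qed.
Let qscaleE c a : qscale c (hpi a) = hpi (c *: a).
Proof. by apply/hpiP; rewrite -scalerBr; apply: IZ; exact: repr_hpi. Qed.
Let qmulE a b : qmul (hpi a) (hpi b) = hpi (a * b).
Proof.
apply/hpiP.
have -> : forall x y : A, x * y - a * b = (x - a) * y + a * (y - b).
  by move=> x y; rewrite mulrBl mulrBr addrA subrK.
by apply: ID; [apply: hopfIdealMr | apply: hopfIdealMl]; exact: repr_hpi.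
Qed.

Fact qaddA : associative qadd.
Proof. by do 3![elim/hopfQuot_ind => ?]; rewrite !qaddE addrA. Qed.
Fact qaddC : commutative qadd.
Proof. by do 2![elim/hopfQuot_ind => ?]; rewrite !qaddE addrC. Qed.
Fact qadd0 : left_id (hpi 0) qadd.
Proof. by elim/hopfQuot_ind => ?; rewrite !qaddE add0r. Qed.
Fact qaddN : left_inverse (hpi 0) qopp qadd.
Proof. by elim/hopfQuot_ind => ?; rewrite qoppE qaddE addNr. Qed.
HB.instance Definition _ := GRing.isZmodule.Build hopfQuot qaddA qaddC qadd0 qaddN.

Fact qmulA : associative qmul.
Proof. by do 3![elim/hopfQuot_ind => ?]; rewrite !qmulE mulrA. Qed.
Fact qmul1l : left_id (hpi 1) qmul.
Proof. by elim/hopfQuot_ind => ?; rewrite qmulE mul1r. Qed.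
Fact qmul1r : right_id (hpi 1) qmul.
Proof. by elim/hopfQuot_ind => ?; rewrite qmulE mulr1. Qed.
Fact qmulDl : left_distributive qmul qadd.
Proof. by do 3![elim/hopfQuot_ind => ?]; rewrite !(qaddE, qmulE) mulrDl. Qed.
Fact qmulDr : right_distributive qmul qadd.
Proof. by do 3![elim/hopfQuot_ind => ?]; rewrite !(qaddE, qmulE) mulrDr. Qed.
Fact qone_neq0 : hpi 1 != hpi 0.
Proof.
apply/eqP => /hpiP; rewrite subr0 => /hopfIdeal_counit.
by rewrite counit1 => /eqP; rewrite oner_eq0.
Qed.
HB.instance Definition _ := GRing.Zmodule_isNzRing.Build hopfQuot
  qmulA qmul1l qmul1r qmulDl qmulDr qone_neq0.

Fact qscaleA c d x : qscale c (qscale d x) = qscale (c * d) x.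
Proof. by elim/hopfQuot_ind: x => ?; rewrite !qscaleE scalerA. Qed.
Fact qscale1 : left_id 1 qscale.
Proof. by elim/hopfQuot_ind => ?; rewrite qscaleE scale1r. Qed.
Fact qscaleDr : right_distributive qscale +%R.
Proof.
move=> c; do 2![elim/hopfQuot_ind => ?].
by rewrite -[_ + _ in RHS]/(qadd _ _) -[_ + _]/(qadd _ _) !(qaddE, qscaleE) scalerDr.
Qed.
Fact qscaleDl x : {morph qscale^~ x : a b / a + b >-> a + b}.
Proof.
move=> c d; elim/hopfQuot_ind: x => x.
by rewrite -[_ + _ in RHS]/(qadd _ _) !(qaddE, qscaleE) scalerDl.
Qed.
HB.instance Definition _ := GRing.Zmodule_isLmodule.Build K hopfQuot
  qscaleA qscale1 qscaleDr qscaleDl.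

Lemma hpiD a b : hpi (a + b) = hpi a + hpi b. Proof. by rewrite -qaddE. Qed.
Lemma hpiZ c a : hpi (c *: a) = c *: hpi a. Proof. by rewrite -qscaleE. Qed.
Lemma hpiM a b : hpi (a * b) = hpi a * hpi b. Proof. by rewrite -qmulE. Qed.
Lemma hpi1 : hpi 1 = 1. Proof. by []. Qed.
Lemma hpi_linear : linear hpi.
Proof. by move=> c a b; rewrite hpiD hpiZ. Qed.

Fact hopfQuot_scalerAl (c : K) (x y : hopfQuot) : c *: (x * y) = (c *: x) * y.
Proof.
elim/hopfQuot_ind: x => a; elim/hopfQuot_ind: y => b.
by rewrite -hpiM -!hpiZ -hpiM scalerAl.
Qed.
HB.instance Definition _ := GRing.Lmodule_isLalgebra.Build K hopfQuot
  hopfQuot_scalerAl.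
Fact hopfQuot_scalerAr (c : K) (x y : hopfQuot) : c *: (x * y) = x * (c *: y).
Proof.
elim/hopfQuot_ind: x => a; elim/hopfQuot_ind: y => b.
by rewrite -hpiM -!hpiZ -hpiM scalerAr.
Qed.
HB.instance Definition _ := GRing.Lalgebra_isAlgebra.Build K hopfQuot
  hopfQuot_scalerAr.

Let qspart i (x : hopfQuot) : hopfQuot := hpi (spart i (repr x)).
Let qspartE i a : qspart i (hpi a) = hpi (spart i a).
Proof.
apply/hpiP; rewrite -(linB (spart_linear i)).
by apply: hopfIdeal_part; exact: repr_hpi.
Qed.
Fact qspart_linear i : linear (qspart i).
Proof.
move=> c; do 2![elim/hopfQuot_ind => ?].
by rewrite -hpiZ -hpiD !qspartE -hpiZ -hpiD spart_linear.
Qed.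
Fact qspartD x : qspart false x + qspart true x = x.
Proof. by elim/hopfQuot_ind: x => a; rewrite !qspartE -hpiD spartD. Qed.
Fact qspartK i j x : qspart i (qspart j x) = if i == j then qspart j x else 0.
Proof. by elim/hopfQuot_ind: x => a; rewrite !qspartE spartK; case: (i == j). Qed.
HB.instance Definition _ := isSuperModule.Build K hopfQuot
  qspart_linear qspartD qspartK.

Lemma hpi_part i a : hpi (spart i a) = spart i (hpi a).
Proof. by rewrite -qspartE. Qed.
Lemma homog_lift i (x : hopfQuot) : spart i x = x -> exists2 a, x = hpi a & spart i a = a.
Proof.
elim/hopfQuot_ind: x => a; rewrite -hpi_part => <-; exists (spart i a) => //.
by rewrite spartK eqxx.
Qed.

Fact qspartM i j (x y : hopfQuot) : spart i x = x -> spart j y = y ->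
  spart (i (+) j) (x * y) = x * y.
Proof.
move=> /homog_lift[a -> ha] /homog_lift[b -> hb].
by rewrite -hpiM -hpi_part spartM.
Qed.
HB.instance Definition _ := isSuperAlgebra.Build K hopfQuot qspartM.
Fact qsuperC i j (x y : hopfQuot) : spart i x = x -> spart j y = y ->
  x * y = (-1) ^+ (i && j) *: (y * x).
Proof.
move=> /homog_lift[a -> ha] /homog_lift[b -> hb].
by rewrite -!hpiM -hpiZ (superC _ _ _ _ ha hb).
Qed.
HB.instance Definition _ := isSuperCommutative.Build K hopfQuot qsuperC.

Let hpi2 := tmap hpi hpi.
Let hpi2_linear : linear hpi2. Proof. exact: tmap_linear hpi_linear hpi_linear. Qed.
Let hpi_eq0 x : I x -> hpi x = 0.
Proof. by move=> hx; apply/hpiP; rewrite subr0. Qed.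

Definition qcomul (x : hopfQuot) : tensor hopfQuot hopfQuot := hpi2 (comul (repr x)).
Definition qcounit (x : hopfQuot) : K^o := counit (repr x).
Definition qantipode (x : hopfQuot) : hopfQuot := hpi (antipode (repr x)).

Let eq_of_I (W : lmodType K) (f : A -> W) : linear f -> (forall x, I x -> f x = 0) ->
  forall a, f (repr (hpi a)) = f a.
Proof.
by move=> lf h a; apply/eqP; rewrite -subr_eq0 -linB // h //; exact: repr_hpi.
Qed.

Lemma qcomulE a : qcomul (hpi a) = hpi2 (comul a).
Proof.
apply: (@eq_of_I _ (fun a => hpi2 (comul a))).
  exact: (linear_comp (@comul_linear _ _) hpi2_linear).
move=> x /hopfIdeal_comul [s hs ->]; rewrite (lin_sum hpi2_linear).
rewrite big_seq big1 // => p /hs hp; have [t1 t2] := @bilin_tens K hopfQuot hopfQuot.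
rewrite /hpi2 tmap_tens; [|exact: hpi_linear|exact: hpi_linear].
case: hp => /hpi_eq0 ->; first exact: (lin0 (t2 _)).
exact: (lin0 (t1 _)).
Qed.
Lemma qcounitE a : qcounit (hpi a) = counit a.
Proof.
exact: (eq_of_I (@counit_linear _ _) (fun x hx => @hopfIdeal_counit _ _ I x hx)).
Qed.
Lemma qantipodeE a : qantipode (hpi a) = hpi (antipode a).
Proof.
apply: (@eq_of_I _ (fun a => hpi (antipode a))).
  exact: (linear_comp (@antipode_linear _ _) hpi_linear).
by move=> x hx; exact/hpi_eq0/hopfIdeal_antipode.
Qed.

Let hl := hpi_linear.
Let tl (W : lmodType K) (b : hopfQuot -> hopfQuot -> W) a : bilin b ->
  tlift b (qcomul (hpi a)) = tlift (fun x y => b (hpi x) (hpi y)) (comul a).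
Proof. by move=> bb; rewrite qcomulE /hpi2 tlift_tmap. Qed.

Fact qcomul_linear : linear qcomul.
Proof.
move=> c; do 2![elim/hopfQuot_ind => ?].
by rewrite -hpiZ -hpiD !qcomulE comul_linear hpi2_linear.
Qed.
Fact qcomul1 : qcomul 1 = tens 1 1.
Proof. by rewrite qcomulE comul1 /hpi2 tmap_tens. Qed.
Fact qcomulM a b : qcomul (a * b) = tmul (qcomul a) (qcomul b).
Proof.
elim/hopfQuot_ind: a => a; elim/hopfQuot_ind: b => b.
by rewrite -hpiM !qcomulE comulM /hpi2 tmap_tmul //; (exact: hpiM || exact: hpi_part).
Qed.
Fact qcomul_part k a : qcomul (spart k a) = tpart k (qcomul a).
Proof.
elim/hopfQuot_ind: a => a.
by rewrite -hpi_part !qcomulE comul_part /hpi2 tmap_tpart //; exact: hpi_part.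
Qed.
Fact qcounit_linear : linear qcounit.
Proof.
move=> c; do 2![elim/hopfQuot_ind => ?].
by rewrite -hpiZ -hpiD !qcounitE counit_linear.
Qed.
Fact qcounit1 : qcounit 1 = 1. Proof. by rewrite qcounitE counit1. Qed.
Fact qcounitM a b : qcounit (a * b) = qcounit a * qcounit b.
Proof.
elim/hopfQuot_ind: a => a; elim/hopfQuot_ind: b => b.
by rewrite -hpiM !qcounitE counitM.
Qed.
Fact qcounit_odd a : qcounit (spart true a) = 0.
Proof. by elim/hopfQuot_ind: a => a; rewrite -hpi_part qcounitE counit_odd. Qed.
Fact qantipode_linear : linear qantipode.
Proof.
move=> c; do 2![elim/hopfQuot_ind => ?].
by rewrite -hpiZ -hpiD !qantipodeE antipode_linear hl.
Qed.
Fact qantipode1 : qantipode 1 = 1. Proof. by rewrite qantipodeE antipode1. Qed.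
Fact qantipodeM a b : qantipode (a * b) = qantipode a * qantipode b.
Proof.
elim/hopfQuot_ind: a => a; elim/hopfQuot_ind: b => b.
by rewrite -hpiM !qantipodeE antipodeM hpiM.
Qed.
Fact qantipode_part k a : qantipode (spart k a) = spart k (qantipode a).
Proof.
by elim/hopfQuot_ind: a => a; rewrite -hpi_part !qantipodeE antipode_part hpi_part.
Qed.
Fact qcomulA a : tassoc (tmap qcomul id (qcomul a)) = tmap id qcomul (qcomul a).
Proof.
elim/hopfQuot_ind: a => a; rewrite !qcomulE /hpi2 !tmap_comp //; try exact: qcomul_linear.
have -> : tmap (fun u => qcomul (hpi u)) hpi (comul a) =
    tmap hpi2 hpi (tmap comul id (comul a)).
  rewrite tmap_comp //; [|exact: comul_linear].
  by apply: eq_tlift => u v; rewrite qcomulE.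
have -> : tmap hpi (fun u => qcomul (hpi u)) (comul a) =
    tmap hpi hpi2 (tmap id comul (comul a)).
  rewrite tmap_comp //; [|exact: comul_linear].
  by apply: eq_tlift => u v; rewrite qcomulE.
by rewrite -comulA tmap_tassoc.
Qed.

Let sc_lin (W : lmodType K) (f : hopfQuot -> K^o) (w : W) :
  linear f -> linear (fun x => f x *: w).
Proof. by move=> lf c x y; rewrite lf scalerDl scalerA. Qed.
Let sc_lin2 (W : lmodType K) (c : K) : linear (fun w : W => c *: w).
Proof. by move=> d x y; rewrite scalerDr !scalerA mulrC. Qed.

Fact qcomul_counitl a : tlift (fun x y => qcounit x *: y) (qcomul a) = a.
Proof.
elim/hopfQuot_ind: a => a; rewrite tl.
  rewrite -[in RHS](comul_counitl a) (lin_tlift _ _ hl).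
  by apply: eq_bigr => p _; rewrite qcounitE hpiZ.
by split=> [x | y]; [exact: sc_lin2 | apply: sc_lin; exact: qcounit_linear].
Qed.
Fact qcomul_counitr a : tlift (fun x y => qcounit y *: x) (qcomul a) = a.
Proof.
elim/hopfQuot_ind: a => a; rewrite tl.
  rewrite -[in RHS](comul_counitr a) (lin_tlift _ _ hl).
  by apply: eq_bigr => p _; rewrite qcounitE hpiZ.
by split=> [x | y]; [apply: sc_lin; exact: qcounit_linear | exact: sc_lin2].
Qed.
Fact qantipodel a : tlift (fun x y => qantipode x * y) (qcomul a) = qcounit a *: 1.
Proof.
elim/hopfQuot_ind: a => a; rewrite tl.
  rewrite qcounitE -hpi1 -hpiZ -antipodel (lin_tlift _ _ hl).
  by apply: eq_bigr => p _; rewrite qantipodeE hpiM.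
split=> [x | y]; first exact: mulr_linear.
exact: (linear_comp qantipode_linear (@mull_linear _ _ _)).
Qed.
Fact qantipoder a : tlift (fun x y => x * qantipode y) (qcomul a) = qcounit a *: 1.
Proof.
elim/hopfQuot_ind: a => a; rewrite tl.
  rewrite qcounitE -hpi1 -hpiZ -antipoder (lin_tlift _ _ hl).
  by apply: eq_bigr => p _; rewrite qantipodeE hpiM.
split=> [x | y]; last exact: mull_linear.
exact: (linear_comp qantipode_linear (@mulr_linear _ _ _)).
Qed.

HB.instance Definition _ := isHopfSuperAlgebra.Build K hopfQuot
  qcomul_linear qcomul1 qcomulM qcomul_part
  qcounit_linear qcounit1 qcounitM qcounit_odd
  qantipode_linear qantipode1 qantipodeM qantipode_part
  qcomulA qcomul_counitl qcomul_counitr qantipodel qantipoder.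
End HopfQuotient.

Section GeneratedIdeal.
Variables (K : fieldType) (A : algType K).

Definition two_sided_ideal (J : A -> Prop) : Prop :=
  [/\ J 0, forall x y, J x -> J y -> J (x + y) &
      forall a x, J x -> J (a * x) /\ J (x * a)].

Definition ideal_gen (P : A -> Prop) (x : A) : Prop :=
  forall J, two_sided_ideal J -> (forall y, P y -> J y) -> J x.

Lemma ideal_genP (P : A -> Prop) : two_sided_ideal (ideal_gen P).
Proof.
split=> [J [] // | x y hx hy J hJ hP | a x hx].
  by have [_ hD _] := hJ; apply: hD; [exact: hx | exact: hy].
by split=> J hJ hP; have [_ _ hM] := hJ; case: (hM a x (hx J hJ hP)).
Qed.

Lemma ideal_gen_sub (P : A -> Prop) y : P y -> ideal_gen P y.
Proof. by move=> hy J _; exact. Qed.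

Lemma two_sided_idealZ (J : A -> Prop) c x : two_sided_ideal J -> J x -> J (c *: x).
Proof. by case=> _ _ hM hx; rewrite -[x]mul1r scalerAl; case: (hM (c *: 1) x hx). Qed.
End GeneratedIdeal.

Section TensSpan.
Variables (K : fieldType) (U V : lmodType K) (P : U -> V -> Prop).

Lemma tens_span0 : tens_span P 0.
Proof. by exists [::] => //; rewrite big_nil. Qed.
Lemma tens_spanD x y : tens_span P x -> tens_span P y -> tens_span P (x + y).
Proof.
move=> [s hs ->] [t ht ->]; exists (s ++ t); last by rewrite big_cat.
by move=> p; rewrite mem_cat => /orP[/hs | /ht].
Qed.
Lemma tens_span_sum (I : Type) (r : seq I) (Q : pred I) (F : I -> tensor U V) :
  (forall i, Q i -> tens_span P (F i)) -> tens_span P (\sum_(i <- r | Q i) F i).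
Proof. by move=> h; elim/big_ind: _ => //; [exact: tens_span0 | exact: tens_spanD]. Qed.
Lemma tens_span_tens u v : P u v -> tens_span P (tens u v).
Proof. by move=> h; exists [:: (u, v)]; [move=> p /[!inE] /eqP -> | rewrite big_seq1]. Qed.
End TensSpan.

Section OddIdeal.
Variables (K : fieldType) (A : hopfSuperAlgType K).

Definition odd_ideal : A -> Prop := ideal_gen (fun x => spart true x = x).

Let I := odd_ideal.
Let idI : two_sided_ideal I. Proof. exact: ideal_genP. Qed.
Let I0 : I 0. Proof. by case: idI. Qed.
Let ID x y : I x -> I y -> I (x + y). Proof. by case: idI => _ h _; exact: h. Qed.
Let IMl a x : I x -> I (a * x). Proof. by case: idI => _ _ h /(h a) []. Qed.
Let IMr a x : I x -> I (x * a). Proof. by case: idI => _ _ h /(h a) []. Qed.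
Let IZ c x : I x -> I (c *: x). Proof. exact: two_sided_idealZ. Qed.
Let Iodd x : I (spart true x).
Proof. by apply: ideal_gen_sub; rewrite spartK eqxx. Qed.
Let Isum (J : Type) (r : seq J) (F : J -> A) :
  (forall j, I (F j)) -> I (\sum_(j <- r) F j).
Proof. by move=> h; elim/big_ind: _ => //; exact: ID. Qed.

Fact odd_ideal_lin c x y : I x -> I y -> I (c *: x + y).
Proof. by move=> hx hy; apply: ID => //; exact: IZ. Qed.

Fact odd_ideal_part i x : I x -> I (spart i x).
Proof.
move=> hx; case: i; first exact: Iodd.
have -> : spart false x = x + (-1) *: spart true x.
  by rewrite scaleN1r -[X in X + _](spartD x) addrK.
by apply: ID => //; exact: IZ.
Qed.

Let P := (fun a b : A => I a \/ I b).

Let span_tmul4 (a b c d : A) : P a b \/ P c d -> tens_span P (tmul4 a b c d).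
Proof.
move=> h; rewrite /tmul4; apply: tens_span_sum => i _; apply: tens_span_sum => j _.
rewrite -(linZ ((bilin_tens _ _).2 (spart i b * d))).
apply: tens_span_tens.
case: h => -[] h; [left | right | left | right].
- by apply: IZ; apply: IMr.
- by apply: IMr; apply: odd_ideal_part.
- by apply: IZ; apply: IMl; apply: odd_ideal_part.
- exact: IMl.
Qed.

Let span_tmul (s t : tensor A A) :
  tens_span P s \/ tens_span P t -> tens_span P (tmul s t).
Proof.
have [m1 m2] := bilin_tmul A A.
case=> -[r hr ->].
  rewrite [t]tensorE (lin_sum (m2 _)) big_seq; apply: tens_span_sum => p hp.
  rewrite (lin_sum (m1 _)); apply: tens_span_sum => q _.
  by rewrite tmul_tens; apply: span_tmul4; left; exact: hr.
rewrite [s]tensorE (lin_sum (m1 _)) big_seq; apply: tens_span_sum => p hp.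
rewrite (lin_sum (m2 _)); apply: tens_span_sum => q _.
by rewrite tmul_tens; apply: span_tmul4; right; exact: hr.
Qed.

Fact odd_ideal_comul x : I x -> tens_span P (comul x).
Proof.
move=> hx; apply: (hx (fun x => tens_span P (comul x))).
  split=> [|y z hy hz|a y hy].
  - by rewrite (lin0 (@comul_linear _ _)); exact: tens_span0.
  - by rewrite (linD (@comul_linear _ _)); exact: tens_spanD.
  - by rewrite !comulM; split; apply: span_tmul; [right | left].
move=> y <-; rewrite comul_part; apply: tens_span_sum => i _.
rewrite /tmap /tlift; apply: tens_span_sum => p _; apply: tens_span_tens.
by case: i; [left | right]; exact: Iodd.
Qed.

Fact odd_ideal_counit x : I x -> counit x = 0.
Proof.
move=> hx; apply: (hx (fun x => counit x = 0)) => [|y <-]; last exact: counit_odd.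
split=> [|y z hy hz|a y hy]; first exact: (lin0 (@counit_linear _ _)).
  by rewrite (linD (@counit_linear _ _)) hy hz addr0.
by rewrite !counitM hy mulr0 mul0r.
Qed.

Fact odd_ideal_antipode x : I x -> I (antipode x).
Proof.
move=> hx; apply: (hx (fun x => I (antipode x))) => [|y <-].
  split=> [|y z hy hz|a y hy]; first by rewrite (lin0 (@antipode_linear _ _)).
    by rewrite (linD (@antipode_linear _ _)); exact: ID.
  by rewrite !antipodeM; split; [exact: IMl | exact: IMr].
by rewrite antipode_part; exact: Iodd.
Qed.

Definition oddIdeal : hopfIdeal A :=
  HopfIdeal I0 odd_ideal_lin IMl IMr odd_ideal_part odd_ideal_comul
    odd_ideal_counit odd_ideal_antipode.
End OddIdeal.

Section Lie.
Variables (K : fieldType) (A : hopfSuperAlgType K).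

(* Lie(GG) is the space of K-valued superderivations of A at the counit. No sign
   occurs in the Leibniz rule because counit kills odd elements. The third clause
   says that D is homogeneous of parity i. *)
Definition point_derivation (i : bool) (D : A -> K^o) : Prop :=
  [/\ linear D,
      forall a b, D (a * b) = D a * counit b + counit a * D b &
      forall a, D (spart (~~ i) a) = 0].

Definition lie_pred (i : bool) : {pred A -> K^o} :=
  fun D => `[< point_derivation i D >].

Fact lie_submod_closed i : submod_closed (lie_pred i).
Proof.
split=> [|c D E /asboolP[lD mD pD] /asboolP[lE mE pE]]; apply/asboolP.
  by split=> [c x y | x y | x] //=; rewrite ?scaler0 ?mul0r ?mulr0 ?addr0.
split=> [d x y | x y | x].
- rewrite !fctE lD lE /= !scalerDr !scalerA mulrC; exact: addrACA.
- rewrite !fctE mD mE /GRing.scale /= !mulrDr !mulrDl !mulrA (mulrC c (counit x)).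
  exact: addrACA.
- by rewrite !fctE pD pE scaler0 addr0.
Qed.
HB.instance Definition _ i :=
  GRing.isSubmodClosed.Build K (A -> K^o) (lie_pred i) (lie_submod_closed i).

Definition lie (i : bool) := {D : A -> K^o | D \in lie_pred i}.
HB.instance Definition _ i := [isSub of lie i for sval].
HB.instance Definition _ i := [Choice of lie i by <:].
HB.instance Definition _ i := [SubChoice_isSubLmodule of lie i by <:].

Definition pairing (i : bool) (D : lie i) (a : A) : K^o := val D a.

(* Product of the dual of the coalgebra A, for the pairing <f (x) g, a (x) b> =
   f(a) g(b); the convention with a Koszul sign only changes the bracket of two
   odd elements by a global sign. *)
Definition convol (f g : A -> K^o) (a : A) : K^o :=
  tlift (fun x y => f x * g y : K^o) (comul a).

Lemma counit_even (a : A) : counit (spart false a) = counit a.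
Proof.
by rewrite -[in RHS](spartD a) (linD (@counit_linear _ _)) counit_odd addr0.
Qed.

Lemma tensor_ext2 (U V U' V' : lmodType K) (W : lmodType K)
    (F G : tensor U V -> tensor U' V' -> W) :
  bilin F -> bilin G ->
  (forall u v u' v', F (tens u v) (tens u' v') = G (tens u v) (tens u' v')) ->
  forall s t, F s t = G s t.
Proof.
move=> [F1 F2] [G1 G2] h s t; apply: (tensor_ext (F2 t) (G2 t)) => u v.
exact: (tensor_ext (F1 _) (G1 _)).
Qed.

Lemma bilin_mulK (U V : lmodType K) (f : U -> K^o) (g : V -> K^o) :
  linear f -> linear g -> bilin (fun u v => f u * g v : K^o).
Proof.
move=> lf lg; split=> [u | v] c x y.
  by rewrite lg mulrDr -scalerAr.
by rewrite lf mulrDl -scalerAl.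
Qed.

Section Bracket.
Variables (i j : bool) (D E : A -> K^o).
Hypotheses (dD : point_derivation i D) (dE : point_derivation j E).
Let lD : linear D. Proof. by case: dD. Qed.
Let lE : linear E. Proof. by case: dE. Qed.
Let le : linear (@counit K A). Proof. exact: counit_linear. Qed.
Let T (f g : A -> K^o) (t : tensor A A) : K^o := tlift (fun x y => f x * g y : K^o) t.
Let T_linear f g : linear f -> linear g -> linear (T f g).
Proof. by move=> lf lg; apply: tlift_linear; exact: bilin_mulK. Qed.
Let T_tens f g a b : linear f -> linear g -> T f g (tens a b) = f a * g b.
Proof. by move=> lf lg; rewrite /T tlift_tens //; exact: bilin_mulK. Qed.

Let e := (@counit K A : A -> K^o).

Let convol_tmul s t :
  T D E (tmul s t) = T D E s * T e e t + T e e s * T D E t + T D e s * T e E t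
                     + (-1) ^+ (i && j) * (T e E s * T D e t).
Proof.
have [m1 m2] := bilin_tmul A A.
move: s t; apply: tensor_ext2.
- split=> [s | t].
    exact: (linear_comp (m1 s) (T_linear lD lE)).
  exact: (linear_comp (m2 t) (T_linear lD lE)).
- split=> [s | t] c x y; rewrite !(T_linear, lD, lE, le) // /GRing.scale /=; ring.
move=> a b c d; rewrite tmul_tens /tmul4 !big_bool /= !(linD (T_linear lD lE)).
rewrite !(linZ (T_linear lD lE)) !T_tens //.
case: dD => _ mD pD; case: dE => _ mE pE.
rewrite !mD !mE /e !counit_odd !counit_even.
have sD k : D (spart k c) = if k == i then D c else 0.
  have -> : k == i = (k != ~~ i) by case: (k) (i) => -[].
  case: eqP => [-> //|/eqP hk].
  rewrite -[in RHS](spartD c) (linD lD); case: k hk pD; case: (i) => //= _ h.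
    by rewrite h add0r.
  by rewrite h addr0.
have sE k : E (spart k b) = if k == j then E b else 0.
  have -> : k == j = (k != ~~ j) by case: (k) (j) => -[].
  case: eqP => [-> //|/eqP hk].
  rewrite -[in RHS](spartD b) (linD lE); case: k hk pE; case: (j) => //= _ h.
    by rewrite h add0r.
  by rewrite h addr0.
rewrite !sD !sE /GRing.scale /=.
by case: i; case: j => /=; ring.
Qed.

Lemma convolM a b :
  convol D E (a * b) = convol D E a * counit b + counit a * convol D E b
    + D a * E b + (-1) ^+ (i && j) * (D b * E a).
Proof.
have Tee x : T e e (comul x) = counit x.
  rewrite -[in RHS](comul_counitl x) (lin_tlift _ _ le).
  by apply: eq_bigr => p _; rewrite (linZ le).
have TDe x : T D e (comul x) = D x.
  rewrite -[in RHS](comul_counitr x) (lin_tlift _ _ lD).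
  by apply: eq_bigr => p _; rewrite (linZ lD) /GRing.scale /= mulrC.
have TeE x : T e E (comul x) = E x.
  rewrite -[in RHS](comul_counitl x) (lin_tlift _ _ lE).
  by apply: eq_bigr => p _; rewrite (linZ lE).
rewrite /convol comulM -/(T D E _) convol_tmul !Tee !TDe !TeE /T.
by rewrite [E a * _]mulrC.
Qed.

Lemma convol_linear : linear (convol D E).
Proof. exact: (linear_comp (@comul_linear _ _) (T_linear lD lE)). Qed.

Lemma convol_part k a : k != i (+) j -> convol D E (spart k a) = 0.
Proof.
move=> hk; rewrite /convol comul_part -/(T D E _) /tpart.
rewrite (lin_sum (T_linear lD lE)) big1 // => l _.
rewrite /T tlift_tmap; [|exact: spart_linear|exact: spart_linear|exact: bilin_mulK].
apply: big1 => p _; case: dD => _ _ pD; case: dE => _ _ pE.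
have [hl | hl] := eqVneq l (~~ i); first by rewrite hl pD mul0r.
have -> : l (+) k = ~~ j by move: hk hl; case: (i) (j) (k) (l) => -[] [] [].
by rewrite pE mulr0.
Qed.
End Bracket.

Lemma lieP i (D : lie i) : point_derivation i (pairing D).
Proof. by have /asboolP := valP D. Qed.

Definition lie_bracket_fun (i j : bool) (D : lie i) (E : lie j) : A -> K^o :=
  fun a => convol (pairing D) (pairing E) a
           - (-1) ^+ (i && j) * convol (pairing E) (pairing D) a.

Fact lie_bracket_subproof i j (D : lie i) (E : lie j) :
  lie_bracket_fun D E \in lie_pred (i (+) j).
Proof.
have [dD dE] := (lieP D, lieP E).
apply/asboolP; split=> [c x y | a b | a]; rewrite /lie_bracket_fun.
- by rewrite !(convol_linear dD dE, convol_linear dE dD) /GRing.scale /=; ring.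
- rewrite (convolM dD dE) (convolM dE dD) andbC.
  by case: (j && i); rewrite ?expr0 ?expr1; ring.
rewrite (convol_part dD dE) ?(convol_part dE dD) ?mulr0 ?subr0 //.
  by case: (j) (i) => -[].
by case: (j) (i) => -[].
Qed.

Definition lie_bracket i j (D : lie i) (E : lie j) : lie (i (+) j) :=
  Sub (lie_bracket_fun D E) (lie_bracket_subproof D E).
End Lie.

Definition subalgebra (K : fieldType) (A : algType K) (S : A -> Prop) : Prop :=
  [/\ S 1, forall c x y, S x -> S y -> S (c *: x + y) &
      forall x y, S x -> S y -> S (x * y)].

Definition finitely_generated (K : fieldType) (A : algType K) : Prop :=
  exists s : seq A, forall S : A -> Prop,
    subalgebra S -> (forall x, x \in s -> S x) -> forall a, S a.

Record supergroup (K : fieldType) := Supergroup {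
  coordAlg : hopfSuperAlgType K;
  coord_fg : finitely_generated coordAlg
}.

Record superHom (K : fieldType) (A B : superAlgType K) := SuperHom {
  superHom_fun :> {lrmorphism A -> B};
  superHom_part : forall i a, superHom_fun (spart i a) = spart i (superHom_fun a)
}.

Section Points.
Variables (K : fieldType) (GG : supergroup K) (R : scomAlgType K).

Definition points := superHom (coordAlg GG) R.

(* The group law of GG(R), as maps on K[GG]. *)
Definition point_mul (f g : coordAlg GG -> R) : coordAlg GG -> R :=
  fun a => tlift (fun x y => f x * g y) (comul a).

Definition point_inv (f : coordAlg GG -> R) : coordAlg GG -> R := fun a => f (antipode a).
End Points.

Fact hopfQuot_fg (K : fieldType) (GG : supergroup K) (I : hopfIdeal (coordAlg GG)) :
  finitely_generated (hopfQuot I).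
Proof.
have [s hs] := coord_fg GG; exists [seq hpi I a | a <- s] => S [S1 SD SM] hS.
elim/hopfQuot_ind; apply: (hs (fun a => S (hpi I a))).
  split=> [|c x y hx hy|x y hx hy]; first exact: S1.
    by rewrite hpiD hpiZ; exact: SD.
  by rewrite hpiM; exact: SM.
by move=> x hx; apply: hS; exact: map_f.
Qed.

Definition closedSub (K : fieldType) (GG : supergroup K) (I : hopfIdeal (coordAlg GG)) :
  supergroup K := Supergroup (hopfQuot_fg I).

Definition evenSub (K : fieldType) (GG : supergroup K) : supergroup K :=
  closedSub (oddIdeal (coordAlg GG)).

(* The quotient map K[GG] -> K[GG_ev]. *)
Definition evenRes (K : fieldType) (GG : supergroup K) :
    coordAlg GG -> coordAlg (evenSub GG) :=
  hpi (oddIdeal (coordAlg GG)).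

(* N(R) is normal in GG(R) for every supercommutative R; the points of the
   super-subgroup defined by I are the points of GG vanishing on I. *)
Definition normal_supersub (K : fieldType) (GG : supergroup K) (I : hopfIdeal (coordAlg GG)) : Prop :=
  forall (R : scomAlgType K) (g n : points GG R), (forall a, I a -> n a = 0) ->
    forall a, I a -> point_mul (point_mul (point_inv g) n) g a = 0.

(* A left GG-supermodule is a right K[GG]-supercomodule. *)
Record supermodule (K : fieldType) (GG : supergroup K) := Supermodule {
  smod_sort :> superModType K;
  coaction : smod_sort -> tensor smod_sort (coordAlg GG);
  coaction_linear : linear coaction;
  coaction_part : forall k m, coaction (spart k m) = tpart k (coaction m);
  coactionA : forall m, tassoc (tmap coaction id (coaction m)) =
                        tmap id comul (coaction m);
  coaction_counit : forall m : smod_sort,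
    tlift (fun (x : smod_sort) (a : coordAlg GG) => (counit a : K) *: x) (coaction m) = m
}.

Definition sub_supermodule (K : fieldType) (GG : supergroup K) (M : supermodule GG)
    (W : M -> Prop) : Prop :=
  [/\ W 0,
      forall c x y, W x -> W y -> W (c *: x + y),
      forall i x, W x -> W (spart i x) &
      forall x, W x -> tens_span (fun y _ => W y) (coaction x)].

Definition simple_supermodule (K : fieldType) (GG : supergroup K)
    (M : supermodule GG) : Prop :=
  (exists m : M, m <> 0) /\
  forall W : M -> Prop, sub_supermodule W ->
    (forall m, W m -> m = 0) \/ (forall m, W m).

Definition trivial1_supermodule (K : fieldType) (GG : supergroup K)
    (M : supermodule GG) : Prop :=
  (exists2 m : M, m <> 0 & forall x : M, exists c : K, x = c *: m) /\
  forall m : M, coaction m = tens m 1.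

Definition unipotent (K : fieldType) (GG : supergroup K) : Prop :=
  forall M : supermodule GG, simple_supermodule M -> trivial1_supermodule M.

(* Inclusion of super-subgroups is reverse inclusion of ideals. *)
Definition is_unipotent_radical (K : fieldType) (GG : supergroup K)
    (U : hopfIdeal (coordAlg GG)) : Prop :=
  [/\ normal_supersub U, unipotent (closedSub U) &
      forall N : hopfIdeal (coordAlg GG), normal_supersub N -> unipotent (closedSub N) ->
        forall a, U a -> N a].

(* The trivial super-subgroup is defined by the augmentation ideal. *)
Definition is_trivial_sub (K : fieldType) (GG : supergroup K)
    (U : hopfIdeal (coordAlg GG)) : Prop :=
  forall a, U a <-> counit a = 0.

(* The characters of GG_ev are the grouplikes of its coordinate algebra; the
   product of characters is the product of grouplikes, and the inverse of the
   character g is antipode g. *)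
Definition grouplike (K : fieldType) (H : hopfSuperAlgType K) (g : H) : Prop :=
  comul g = tens g g /\ counit g = 1.

Definition diagonalizable_group (K : fieldType) (GG : supergroup K) : Prop :=
  forall a : coordAlg GG, exists2 s : seq (K * coordAlg GG),
    (forall p, p \in s -> grouplike p.2) & a = \sum_(p <- s) p.1 *: p.2.

Definition even_diagonalizable (K : fieldType) (GG : supergroup K) : Prop :=
  diagonalizable_group (evenSub GG).

Definition super_diagonalizable (K : fieldType) (GG : supergroup K) : Prop :=
  even_diagonalizable GG /\
  exists U : hopfIdeal (coordAlg GG), is_unipotent_radical U /\ is_trivial_sub U.

Definition nondegenerate_pairing_on (K : fieldType) (V1 V2 L : lmodType K)
    (P1 : V1 -> Prop) (P2 : V2 -> Prop) (b : V1 -> V2 -> L) : Prop :=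
  (forall v, P1 v -> (forall w, P2 w -> b v w = 0) -> v = 0) /\
  (forall w, P2 w -> (forall v, P1 v -> b v w = 0) -> w = 0).

Definition nondegenerate_pairing (K : fieldType) (V1 V2 L : lmodType K)
    (b : V1 -> V2 -> L) : Prop :=
  nondegenerate_pairing_on (fun=> True) (fun=> True) b.

Section OddLie.
Variables (K : fieldType) (GG : supergroup K).

Definition oddLie := lie (coordAlg GG) true.
HB.instance Definition _ := GRing.Lmodule.on oddLie.
Definition evenLie := lie (coordAlg GG) false.
HB.instance Definition _ := GRing.Lmodule.on evenLie.

(* Lie(GG_ev) is the even component of Lie(GG). *)
Definition odd_bracket (v w : oddLie) : evenLie := lie_bracket v w.

Definition left_comodule (H : hopfSuperAlgType K) (M : lmodType K)
    (lam : M -> tensor H M) : Prop :=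
  [/\ linear lam,
      forall m, tassoc (tmap comul id (lam m)) = tmap id lam (lam m) &
      forall m : M, tlift (fun (a : H) (x : M) => (counit a : K) *: x) (lam m) = m].

Definition sweedler3 (H : hopfSuperAlgType K) (W : lmodType K)
    (f : H -> H -> H -> W) (a : H) : W :=
  tlift (fun x t => tlift (f x) t) (tmap id comul (comul a)).

(* lam is the left K[GG_ev]-comodule structure corresponding to the right
   GG_ev-module V = Lie(GG)_1 given by
   <v^gamma, a> = gamma^-1(a1) <v, a2> gamma(a3), where the comodule and the
   module structures are related by v^gamma = sum gamma(c) w for
   lam v = sum c (x) w. This determines lam. *)
Definition is_odd_coaction (lam : oddLie -> tensor (coordAlg (evenSub GG)) oddLie) : Prop :=
  left_comodule lam /\
  forall (R : comAlgType K) (gamma : {lrmorphism coordAlg (evenSub GG) -> R})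
      (v : oddLie) (a : coordAlg GG),
    tlift (fun c w => (pairing w a : K) *: gamma c) (lam v) =
    sweedler3 (fun x y z =>
        gamma (antipode (evenRes x)) * ((pairing v y : K) *: gamma (evenRes z))) a.

Definition weight_space (lam : oddLie -> tensor (coordAlg (evenSub GG)) oddLie)
  (g : coordAlg (evenSub GG)) (v : oddLie) : Prop := lam v = tens g v.
End OddLie.

(* Main.v *)
Require Import Defs.
From HB Require Import structures.
From mathcomp Require Import all_boot all_order all_algebra.
From mathcomp Require Import boolp classical_sets functions.
From mathcomp Require Import ring.
Set Implicit Arguments. Unset Strict Implicit. Unset Printing Implicit Defensive.
Import GRing.Theory.
Local Open Scope ring_scope.

(** Write [A = K[GG]], [J] for the ideal generated by the odd elements, [bar : A -> A/J] and
    [V = Lie(GG)_1].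

    A weight computation shows that [[V(g), V(h)] = 0] unless [g h = 1], so that the bracket
    is non-degenerate iff its restrictions to the [V(g) x V(g^-1)] are.

    The key fact is [lder_injective]: an element of [J] killed by all the invariant vector
    fields [lder u], [u] in [V], vanishes. Indeed [J/J^2] is generated by left coinvariants, on
    which the [lder u] act as a triangular system modulo [J], so that an element of [J^n]
    killed by all [lder u] is in [J^(n+1)]; and [J] is nilpotent.

    If the bracket is degenerate, its radical contains a weight vector [v]. As [[v, v] = 0], [v]
    spans the Lie superalgebra of a unipotent super-subgroup, defined by the ideal of all [a]
    with [counit a = 0] and [v a = 0]. The conjugate [adj v] of [v] by the generic point is
    killed by all [lder u] since [[v, V] = 0]; so it is determined by its image under [bar],
    and the key fact makes this super-subgroup normal.

    Conversely let [N] be normal and unipotent. A simple subobject of the space of functions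
    of left weight [g] on [N] is trivial only if [g = 1], so [N] has trivial even part. If
    [N <> 1], the key fact for [N] yields a nonzero [v] in [Lie(N)_1]; conjugating points of [N]
    by points of [GG] with values in the Grassmann algebra on two generators gives
    [[v, V] = 0]. *)

(** * Subspaces and tensor products *)

(** The characteristic enters in two ways: odd elements have square zero, which makes J nilpotent,
    and [v, v] = 2 v*v, so that a vector of the radical satisfies v*v = 0; this is what lets the
    kernels of [counit] and v cut out a Hopf ideal.

    Tensors are known only through bilinear maps, and A and V come without bases. Linear
    functionals, supplied by Zorn's lemma, take their place: tensors are compared through their
    contractions with functionals, and finiteness is measured by the lengths of spanning lists.

    Normality ranges over all supercommutative R. To establish it, the generic point suffices, since
    every point is its image under a morphism; to exploit it, two odd parameters suffice, one for
    each tangent vector.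

    Conjugating N only shows that [v, w] vanishes on the ideal of N, that is, that [v, w] is tangent
    to N. It is then zero because N has trivial even part, a fact that also places the functions on
    N vanishing at the identity inside J, where the key fact applies. *)

Section Subspaces.
Variable K : fieldType.

Definition subspace (U : lmodType K) (P : U -> Prop) : Prop :=
  P 0 /\ forall c x y, P x -> P y -> P (c *: x + y).

Section Closure.
Variables (U : lmodType K) (P : U -> Prop).
Hypothesis sP : subspace P.
Lemma subspace0 : P 0. Proof. by case: sP. Qed.
Lemma subspaceZ c x : P x -> P (c *: x).
Proof. by case: sP => P0 PD hx; have := PD c x 0 hx P0; rewrite addr0. Qed.
Lemma subspaceD x y : P x -> P y -> P (x + y).
Proof. by case: sP => P0 PD hx hy; have := PD 1 x y hx hy; rewrite scale1r. Qed.
Lemma subspaceN x : P x -> P (- x).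
Proof. by rewrite -scaleN1r; exact: subspaceZ. Qed.
Lemma subspaceB x y : P x -> P y -> P (x - y).
Proof. by move=> hx hy; apply: subspaceD => //; exact: subspaceN. Qed.
Lemma subspace_sum I (r : seq I) (Q : pred I) (F : I -> U) :
  (forall i, Q i -> P (F i)) -> P (\sum_(i <- r | Q i) F i).
Proof. by move=> h; elim/big_ind: _ => //; [exact: subspace0|exact: subspaceD]. Qed.
End Closure.

Lemma subspace_comp (U V : lmodType K) (f : U -> V) (P : V -> Prop) :
  linear f -> subspace P -> subspace (fun x => P (f x)).
Proof.
move=> lf sP; split=> [|c x y hx hy]; first by rewrite (lin0 lf); exact: subspace0.
by rewrite lf; case: sP => _; apply.
Qed.

Local Open Scope classical_set_scope.
Lemma subspace_compl (U : lmodType K) (P : U -> Prop) : subspace P ->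
  exists C : U -> Prop, [/\ subspace C, forall x, P x -> C x -> x = 0 &
    forall x, exists2 y, P y & C (x - y)].
Proof.
move=> sP.
(* Membership of 0 is left out of [good]: the union of the empty chain is empty and has to be good.
   Maximality restores it in [C0]. *)
pose good (C : set U) := (forall c x y, C x -> C y -> C (c *: x + y)) /\
  (forall x, P x -> C x -> x = 0).
have [F gF totF|C [[CD CP] Cmax]] := @Zorn_bigcup U good.
  split=> [c x y [X FX Xx] [Y FY Yy]|x Px [X FX Xx]]; last first.
    by have [_ ] := gF _ FX; apply.
  have [XY|YX] := totF _ _ FX FY.
    by exists Y => //; have [h _] := gF _ FY; apply: h => //; exact: XY.
  by exists X => //; have [h _] := gF _ FX; apply: h => //; exact: YX.
have C0 : C 0.
  apply: contrapT => nC0; apply: (Cmax [set 0]); last first.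
    by split=> [c x y -> ->|x _ ->//]; rewrite /= scaler0 addr0.
  split; last by move=> /(_ 0 erefl).
  by move=> x Cx; have := CD (-1) x x Cx Cx; rewrite scaleN1r addNr => /nC0.
have sC : subspace C by [].
exists C; split=> // x; apply: contrapT => nx.
(* This is C + K x; an element of P with a nonzero coefficient on x would decompose x. *)
pose C' : set U := fun y => exists c, C (y - c *: x).
apply: (Cmax C').
  split; first by move=> y Cy; exists 0; rewrite scale0r subr0.
  move=> Cx; apply: nx; exists 0; first exact: (subspace0 sP).
  by rewrite subr0; apply: Cx; exists 1; rewrite scale1r subrr.
split=> [c y z [a ha] [b hb]|y Py [c hc]].
  exists (c * a + b); have := CD c _ _ ha hb; congr C.
  by rewrite scalerBr scalerDl scalerA opprD addrACA.
have [c0|c0] := eqVneq c 0; first by apply: CP => //; move: hc; rewrite c0 scale0r subr0.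
case: nx; exists (c^-1 *: y); first exact: subspaceZ.
rewrite -opprB; apply: subspaceN => //.
have -> : c^-1 *: y - x = c^-1 *: (y - c *: x) by rewrite scalerBr scalerA mulVf // scale1r.
exact: subspaceZ.
Qed.
Local Close Scope classical_set_scope.

Lemma projection (U : lmodType K) (P : U -> Prop) : subspace P ->
  exists p : U -> U, [/\ linear p, forall x, P (p x) & forall x, P x -> p x = x].
Proof.
move=> sP; have [C [sC PC dec]] := subspace_compl sP.
have {dec} [p hp] : {p : U -> U & forall x, P (p x) /\ C (x - p x)}.
  by apply: (@choice _ _ (fun x y => P y /\ C (x - y))) => x; have [y] := dec x; exists y.
have uniqp x y : P y -> C (x - y) -> p x = y.
  move=> Py Cy; apply/eqP; rewrite -subr_eq0; apply/eqP; have [Pp Cp] := hp x.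
  apply: PC; first exact: subspaceB.
  have -> : p x - y = (x - y) - (x - p x).
    by rewrite opprB [RHS]addrC addrA subrK.
  exact: subspaceB.
exists p; split=> [c x y|x|x Px].
- apply: uniqp; first by case: sP => _; apply; case: (hp x); case: (hp y).
  have -> : c *: x + y - (c *: p x + p y) = c *: (x - p x) + (y - p y).
    by rewrite scalerBr opprD addrACA.
  by case: sC => _; apply; [case: (hp x)|case: (hp y)].
- by case: (hp x).
by apply: uniqp => //; rewrite subrr; exact: subspace0.
Qed.

(** With [q] a projection onto P, the vector x - q x is nonzero. The functional projects y - q y
    onto the line of this vector and reads off the coefficient. *)
Lemma separating_functional (U : lmodType K) (P : U -> Prop) x :
  subspace P -> ~ P x ->
  exists f : U -> K^o, [/\ linear f, forall y, P y -> f y = 0 & f x = 1].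
Proof.
move=> sP nPx; have [q [lq Pq qP]] := projection sP.
pose r y := y - q y.
have lr : linear r by move=> c y z; rewrite /r lq scalerBr opprD addrACA.
have rx0 : r x <> 0.
  by move=> /eqP; rewrite /r subr_eq0 => /eqP xq; apply: nPx; rewrite xq.
pose L y := exists c, y = c *: r x.
have sL : subspace L.
  split; first by exists 0; rewrite scale0r.
  by move=> c _ _ [a ->] [b ->]; exists (c * a + b); rewrite scalerDl scalerA.
have [p [lp Lp pL]] := projection sL.
have [f hf] : {f : U -> K^o & forall y, p y = f y *: r x}.
  exact: (@choice _ _ (fun y c => p y = c *: r x)).
have fE c y : p y = c *: r x -> f y = c.
  rewrite hf => /eqP; rewrite -subr_eq0 -scalerBl scaler_eq0 subr_eq0.
  by case/orP => [/eqP//|/eqP].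
exists (fun y => f (r y)); split.
- apply: (linear_comp lr) => c y z; apply: fE.
  by rewrite lp !hf scalerDl scalerA.
- by move=> y Py; apply: fE; rewrite /r qP // subrr (lin0 lp) scale0r.
- by apply: fE; rewrite pL ?scale1r //; exists 1; rewrite scale1r.
Qed.

(** Membership is a successive elimination of the generators, which suits inductions on the list;
    the length of a spanning list stands in for the dimension. *)
Fixpoint lspan (U : lmodType K) (s : seq U) (x : U) : Prop :=
  if s is y :: s' then exists c, lspan s' (x - c *: y) else x = 0.

Lemma lspan_subspace (U : lmodType K) (s : seq U) : subspace (lspan s).
Proof.
elim: s => [|y s [s0 sD]] /=; first by split=> // c x y -> ->; rewrite scaler0 addr0.
split; first by exists 0; rewrite scale0r subr0.
move=> c x z [a ha] [b hb]; exists (c * a + b).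
have := sD c _ _ ha hb; congr lspan.
by rewrite scalerBr scalerDl scalerA opprD addrACA.
Qed.

Lemma lspan_mem (U : lmodType K) (s : seq U) x : x \in s -> lspan s x.
Proof.
elim: s => //= y s IH; rewrite inE => /orP[/eqP <-|/IH h].
  by exists 1; rewrite scale1r subrr; exact: subspace0 (lspan_subspace _).
by exists 0; rewrite scale0r subr0.
Qed.

Lemma lspan_min (U : lmodType K) (s : seq U) (P : U -> Prop) :
  subspace P -> (forall y, y \in s -> P y) -> forall x, lspan s x -> P x.
Proof.
move=> sP; elim: s => [|y s IH] hs x /=; first by move=> ->; exact: subspace0.
move=> [c /IH h]; rewrite -[x](subrK (c *: y)); apply: subspaceD => //.
  by apply: h => z hz; apply: hs; rewrite inE hz orbT.
by apply: subspaceZ => //; apply: hs; exact: mem_head.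
Qed.

(** Contraction of the second factor with a functional. Slices replace coordinates: they detect
    equality of tensors and membership in P (x) V. *)
Definition slice (U V : lmodType K) (b : V -> K^o) (t : tensor U V) : U :=
  tlift (fun u v => (b v : K) *: u) t.

Lemma bilin_slice (U V : lmodType K) (b : V -> K^o) : linear b ->
  bilin (fun (u : U) v => (b v : K) *: u).
Proof.
move=> lb; split=> [u|v] c x y; first by rewrite lb scalerDl scalerA.
by rewrite scalerDr !scalerA mulrC.
Qed.

Lemma slice_linear (U V : lmodType K) (b : V -> K^o) :
  linear b -> linear (@slice U V b).
Proof. by move=> lb; apply: tlift_linear; exact: bilin_slice. Qed.

Lemma slice_tens (U V : lmodType K) (b : V -> K^o) (u : U) v :
  linear b -> slice b (tens u v) = (b v : K) *: u.
Proof. by move=> lb; rewrite /slice tlift_tens //; exact: bilin_slice. Qed.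

Lemma slice_tmap (U V U' V' : lmodType K) (f : U -> U') (g : V -> V') (b : V' -> K^o) t :
  linear f -> linear g -> linear b ->
  slice b (tmap f g t) = f (slice (fun v => b (g v)) t).
Proof.
move=> lf lg lb; rewrite /slice tlift_tmap //; last exact: bilin_slice.
rewrite (lin_tlift _ _ lf); apply: eq_tlift => u v.
by rewrite (linZ lf).
Qed.

(** Induction on the number of terms. If the first right-hand factor depends on the others, it is
    absorbed into their terms and the sum gets shorter; otherwise a functional equal to 1 on it and
    to 0 on the others shows that its left-hand factor is 0. *)
Lemma tensor_separation (U V : lmodType K) (t : tensor U V) :
  (forall b : V -> K^o, linear b -> slice b t = 0) -> t = 0.
Proof.
have [t1 t2] := bilin_tens U V.
rewrite [t]tensorE; move: (repr t) => s; have [n] := ubnP (size s).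
elim: n s => // n IH [|[u v] s] ; first by rewrite big_nil.
rewrite ltnS /= => hs h.
have [svs|/(separating_functional (lspan_subspace _))[b [lb b0 b1]]] :=
    pselect (lspan [seq p.2 | p <- s] v).
  have [s' hs' /= E] : exists2 s' : seq (U * V), size s' = size s &
      \sum_(p <- (u, v) :: s) tens p.1 p.2 = \sum_(p <- s') tens p.1 p.2.
    elim: s v svs {IH hs h} => [|[u1 v1] s IH] v /=.
      by move=> ->; exists [::] => //; rewrite big_seq1 big_nil /= (lin0 (t1 _)).
    move=> [c /IH[s' hs' E]]; exists ((c *: u + u1, v1) :: s'); first by rewrite /= hs'.
    rewrite !big_cons -E big_cons /= (linD (t2 _)) (linZ (t2 _)) (linB (t1 _)) (linZ (t1 _)).
    by rewrite addrACA [X in _ = X + _]addrC subrK.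
  by rewrite E; apply: IH; rewrite ?hs' // => b lb; rewrite -E; exact: h.
have u0 : u = 0.
  have := h b lb; rewrite (lin_sum (slice_linear lb)) big_cons slice_tens //= b1 scale1r.
  rewrite big_seq big1 ?addr0 // => p hp; rewrite slice_tens // b0 ?scale0r //.
  by apply: lspan_mem; exact: map_f.
rewrite big_cons /= u0 (lin0 (t2 _)) add0r; apply: IH => // b0' lb0.
by have := h _ lb0; rewrite big_cons /= u0 (lin0 (t2 _)) add0r.
Qed.

Lemma tensor_slice_ext (U V : lmodType K) (s t : tensor U V) :
  (forall b : V -> K^o, linear b -> slice b s = slice b t) -> s = t.
Proof.
move=> h; apply/eqP; rewrite -subr_eq0; apply/eqP; apply: tensor_separation => b lb.
by rewrite (linB (slice_linear lb)) h // subrr.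
Qed.

Lemma slice_span (U V : lmodType K) (P : U -> Prop) (t : tensor U V) (b : V -> K^o) :
  subspace P -> linear b -> tens_span (fun u _ => P u) t -> P (slice b t).
Proof.
move=> sP lb [s hs ->]; rewrite (lin_sum (slice_linear lb)) big_seq.
by apply: subspace_sum => // p hp; rewrite slice_tens //; apply: subspaceZ => //; exact: hs.
Qed.

(** A projection onto P, applied to the left factor, changes no slice of t and hence fixes t. *)
Lemma tens_span_slice (U V : lmodType K) (P : U -> Prop) (t : tensor U V) :
  subspace P -> (forall b : V -> K^o, linear b -> P (slice b t)) ->
  tens_span (fun u _ => P u) t.
Proof.
move=> sP h; have [p [lp Pp pP]] := projection sP.
have -> : t = tmap p id t.
  by apply: tensor_slice_ext => b lb; rewrite slice_tmap // pP //; exact: h.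
by rewrite /tmap /tlift /formal_sum; apply: tens_span_sum => q _; exact: tens_span_tens.
Qed.
End Subspaces.

(** * Superalgebras and convolution *)

Lemma linear_o (K : fieldType) (U V W : lmodType K) (f : U -> V) (g : V -> W) :
  linear f -> linear g -> linear (g \o f).
Proof. exact: linear_comp. Qed.

Section Parity.
Variables (K : fieldType).

Lemma spartDr (V : superModType K) i (x y : V) : spart i (x + y) = spart i x + spart i y.
Proof. exact: (linD (spart_linear i)). Qed.
Lemma spartZ (V : superModType K) i c (x : V) : spart i (c *: x) = c *: spart i x.
Proof. exact: (linZ (spart_linear i)). Qed.
Lemma spart0 (V : superModType K) i : spart i (0 : V) = 0.
Proof. exact: (lin0 (spart_linear i)). Qed.
Lemma spart_id (V : superModType K) i (x : V) : spart i (spart i x) = spart i x.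
Proof. by rewrite spartK eqxx. Qed.
(** The grading automorphism; composing with it encodes Koszul signs without splitting into
    homogeneous parts. *)
Definition parity (V : superModType K) (x : V) : V := spart false x - spart true x.

Lemma parity_linear (V : superModType K) : linear (@parity V).
Proof. by move=> c x y; rewrite /parity !spart_linear scalerBr opprD addrACA. Qed.
Lemma parity_part (V : superModType K) i (x : V) : parity (spart i x) = (-1) ^+ i *: spart i x.
Proof.
by case: i; rewrite /parity !spartK /= ?subr0 ?sub0r ?scaleN1r ?scale1r.
Qed.
Lemma parityK (V : superModType K) : cancel (@parity V) (@parity V).
Proof.
move=> x; rewrite {2}/parity (linB (@parity_linear V)) !parity_part scale1r scaleN1r.
by rewrite opprK spartD.
Qed.

Section Algebra.
Variable A : superAlgType K.

Lemma spart_mulp k i j (x y : A) :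
  spart k (spart i x * spart j y) = if k == i (+) j then spart i x * spart j y else 0.
Proof.
rewrite -(spartM _ _ (spart i x) (spart j y) (spart_id _ _) (spart_id _ _)).
by rewrite spartK.
Qed.

Lemma spart_mulr k j (x y : A) : spart k (x * spart j y) = spart (k (+) j) x * spart j y.
Proof.
rewrite -[X in spart k (X * _)](spartD x) mulrDl spartDr !spart_mulp.
by case: k; case: j; rewrite /= ?addr0 ?add0r.
Qed.

Lemma spart_mull k i (x y : A) : spart k (spart i x * y) = spart i x * spart (k (+) i) y.
Proof.
rewrite -[X in spart k (_ * X)](spartD y) mulrDr spartDr !spart_mulp.
by case: k; case: i; rewrite /= ?addr0 ?add0r.
Qed.

Lemma spart_mul k (x y : A) :
  spart k (x * y) = spart false x * spart k y + spart true x * spart (~~ k) y.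
Proof.
rewrite -[X in spart k (X * _)](spartD x) mulrDl spartDr !spart_mull.
by rewrite addbF addbT.
Qed.

(** Write 1 = e0 + e1. The odd part of e0 = 1 e0 is e1 e0, so e1 e0 = 0; the odd part of e1 = e1 1
    is e1 e0 as well, so e1 = 0. *)
Lemma spart_one i : spart i (1 : A) = if i then 0 else 1.
Proof.
have h0 : spart true (1 : A) = 0.
  have /= := spart_mulr true false (1 : A) 1; rewrite mul1r spartK /= => z.
  by have /= := spart_mull true true (1 : A) 1; rewrite mulr1 spart_id -z.
by case: i => //; rewrite -[RHS]spartD h0 addr0.
Qed.

Lemma parityM (x y : A) : parity (x * y) = parity x * parity y.
Proof.
by rewrite /parity !spart_mul /= mulrBl !mulrBr opprD opprB addrACA.
Qed.
End Algebra.

Section Commutative.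
Variable A : scomAlgType K.
Lemma even_comm (x y : A) : spart false x * y = y * spart false x.
Proof.
rewrite -[y]spartD mulrDl mulrDr.
rewrite (superC false false (spart false x) (spart false y)) ?spart_id // scale1r.
by rewrite (superC false true (spart false x) (spart true y)) ?spart_id // scale1r.
Qed.
Lemma odd_comm (x t : A) : spart true t = t -> t * x = parity x * t.
Proof.
move=> ht; rewrite -[in LHS](spartD x) mulrDr.
rewrite (superC true false t) ?spart_id // (superC true true t) ?spart_id //.
by rewrite scale1r scaleN1r -mulrBl.
Qed.
Lemma odd_sqr (t : A) : 2%N \notin [pchar K] -> spart true t = t -> t * t = 0.
Proof.
move=> h2 ht; have := superC true true t t ht ht; rewrite scaleN1r => /eqP.
rewrite -subr_eq0 opprK -mulr2n -scaler_nat scaler_eq0 => /orP[|/eqP //].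
by rewrite !inE /= in h2 *; move/negP: h2.
Qed.
End Commutative.
End Parity.

(** * Convolution algebras, odd vector fields and conjugation by the generic point *)

Section Convolution.
Variables (K : fieldType) (A : hopfSuperAlgType K).

(** Sweedler computations take place in the linear maps A -> R under this associative product:
    [scal counit] is the unit and, for R = A, [antipode] is the inverse of the identity. *)
Definition conv (R : algType K) (f g : A -> R) (a : A) : R :=
  tlift (fun x y => f x * g y) (comul a).

Definition scal {R : algType K} (f : A -> K^o) (a : A) : R := (f a : K) *: (1 : R).

Lemma bilin_mulo (U V : lmodType K) (R : algType K) (f : U -> R) (g : V -> R) :
  linear f -> linear g -> bilin (fun x y => f x * g y).
Proof.
move=> lf lg; split=> [u|v].
  exact: (linear_comp lg (@mulr_linear _ _ _)).
exact: (linear_comp lf (@mull_linear _ _ _)).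
Qed.

Lemma scal_linear (R : algType K) (f : A -> K^o) : linear f -> linear (@scal R f).
Proof. by move=> lf c x y; rewrite /scal lf scalerDl scalerA. Qed.

Lemma conv_linear (R : algType K) (f g : A -> R) :
  linear f -> linear g -> linear (conv f g).
Proof.
move=> lf lg; apply: (linear_comp (@comul_linear _ _)).
by apply: tlift_linear; exact: bilin_mulo.
Qed.

Lemma conv_assoc (R : algType K) (f g h : A -> R) :
  linear f -> linear g -> linear h -> conv (conv f g) h = conv f (conv g h).
Proof.
move=> lf lg lh; apply/funext => a.
pose T2 (p q : A -> R) := tlift (fun x y => p x * q y) : tensor A A -> R.
have lT2 p q : linear p -> linear q -> linear (T2 p q).
  by move=> lp lq; apply: tlift_linear; exact: bilin_mulo.
have lc := @comul_linear K A.
transitivity (tlift (fun (t : tensor A A) y => T2 f g t * h y) (tmap comul id (comul a))).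
  by rewrite tlift_tmap //; apply: bilin_mulo => //; exact: lT2.
transitivity (tlift (fun x (t : tensor A A) => f x * T2 g h t) (tmap id comul (comul a))); last first.
  by rewrite tlift_tmap //; apply: bilin_mulo => //; exact: lT2.
rewrite -comulA; move: (tmap _ _ _) => t; move: t.
have lT : linear (tlift (fun x (t : tensor A A) => f x * T2 g h t)).
  by apply: tlift_linear; apply: bilin_mulo => //; exact: lT2.
apply: tensor_ext.
- by apply: tlift_linear; apply: bilin_mulo => //; exact: lT2.
- exact: (linear_comp (@tassoc_linear _ _ _ _) lT).
move=> t z; rewrite tlift_tens; last by apply: bilin_mulo => //; exact: lT2.
move: t; apply: tensor_ext.
- exact: (linear_comp (lT2 _ _ lf lg) (@mull_linear _ _ _)).
- exact: (linear_comp ((bilin_tens (tensor A A) A).2 z) (linear_comp (@tassoc_linear _ _ _ _) lT)).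
move=> x y; rewrite tassoc_tens tlift_tens; last by apply: bilin_mulo => //; exact: lT2.
by rewrite /T2 !tlift_tens ?mulrA //; exact: bilin_mulo.
Qed.

Lemma convDl (R : algType K) (f1 f2 g : A -> R) a :
  conv (fun x => f1 x + f2 x) g a = conv f1 g a + conv f2 g a.
Proof. by rewrite /conv /tlift /formal_sum -big_split; apply: eq_bigr => p _; rewrite mulrDl. Qed.
Lemma convDr (R : algType K) (f g1 g2 : A -> R) a :
  conv f (fun x => g1 x + g2 x) a = conv f g1 a + conv f g2 a.
Proof. by rewrite /conv /tlift /formal_sum -big_split; apply: eq_bigr => p _; rewrite mulrDr. Qed.
Lemma convNl (R : algType K) (f g : A -> R) a : conv (fun x => - f x) g a = - conv f g a.
Proof. by rewrite /conv /tlift /formal_sum -sumrN; apply: eq_bigr => p _; rewrite mulNr. Qed.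
Lemma convNr (R : algType K) (f g : A -> R) a : conv f (fun x => - g x) a = - conv f g a.
Proof. by rewrite /conv /tlift /formal_sum -sumrN; apply: eq_bigr => p _; rewrite mulrN. Qed.

Lemma conv1l (R : algType K) (f : A -> R) : linear f -> conv (scal (@counit K A)) f = f.
Proof.
move=> lf; apply/funext => a; rewrite -[in RHS](comul_counitl a) (lin_tlift _ _ lf).
by apply: eq_tlift => x y; rewrite /scal -scalerAl mul1r (linZ lf).
Qed.
Lemma conv1r (R : algType K) (f : A -> R) : linear f -> conv f (scal (@counit K A)) = f.
Proof.
move=> lf; apply/funext => a; rewrite -[in RHS](comul_counitr a) (lin_tlift _ _ lf).
by apply: eq_tlift => x y; rewrite /scal -scalerAr mulr1 (linZ lf).
Qed.

Lemma conv_rmorph (R R' : algType K) (h : R -> R') (f g : A -> R) :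
  linear h -> {morph h : x y / x * y} -> h \o conv f g = conv (h \o f) (h \o g).
Proof.
move=> lh hM; apply/funext => a; rewrite /= /conv (lin_tlift _ _ lh).
by apply: eq_tlift => x y; rewrite hM.
Qed.

Lemma conv_scal (R : algType K) (f g : A -> K^o) :
  conv (scal f) (scal g) = @scal R (convol f g).
Proof.
apply/funext => a; rewrite /scal /convol /conv /tlift /formal_sum scaler_suml.
by apply: eq_bigr => p _; rewrite -scalerAl mul1r scalerA.
Qed.

Lemma conv_scall (R : algType K) (f : A -> K^o) (g : A -> R) a :
  conv (scal f) g a = tlift (fun x y => (f x : K) *: g y) (comul a).
Proof. by apply: eq_tlift => x y; rewrite /scal -scalerAl mul1r. Qed.

Lemma conv_part (R : algType K) (f g : A -> R) k a : linear f -> linear g ->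
  conv f g (spart k a) = \sum_(i : bool) conv (f \o spart i) (g \o spart (i (+) k)) a.
Proof.
move=> lf lg; have bfg := bilin_mulo lf lg.
rewrite /conv comul_part /tpart (lin_sum (tlift_linear bfg)).
by apply: eq_bigr => i _; rewrite tlift_tmap //; exact: spart_linear.
Qed.

(** Comultiplication preserves the total parity, and the sign of a total parity is the product of
    the two signs. *)
Lemma conv_parity (R : algType K) (f g : A -> R) : linear f -> linear g ->
  conv f g \o @parity K A = conv (f \o @parity K A) (g \o @parity K A).
Proof.
move=> lf lg; apply/funext => a; rewrite /= {1}/parity (linB (conv_linear lf lg)).
rewrite !conv_part // !big_bool /=.
have -> : f \o @parity K A = (fun x => f (spart false x) + - f (spart true x)).
  by apply/funext => x; rewrite /= /parity (linB lf).
have -> : g \o @parity K A = (fun x => g (spart false x) + - g (spart true x)).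
  by apply/funext => x; rewrite /= /parity (linB lg).
rewrite convDl !convDr !convNl !convNr opprK.
by rewrite opprD addrACA addrC [X in _ + X]addrC -!addrA; congr (_ + _); rewrite addrC -!addrA.
Qed.

Lemma conv_antipodel : conv antipode id = scal (@counit K A) :> (A -> A).
Proof. by apply/funext => a; exact: antipodel. Qed.
Lemma conv_antipoder : conv id antipode = scal (@counit K A) :> (A -> A).
Proof. by apply/funext => a; exact: antipoder. Qed.

Lemma scal_id (f : A -> K^o) : scal f = f.
Proof. by apply/funext => a; rewrite /scal /GRing.scale /= mulr1. Qed.

Lemma counit_antipode (a : A) : counit (antipode a) = counit a.
Proof.
have le := @counit_linear K A; have lS := @antipode_linear K A.
have := conv_rmorph antipode id le (@counitM K A); rewrite conv_antipodel.
have -> : conv (counit \o antipode) (counit \o id) = counit \o antipode :> (A -> K^o).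
  by rewrite -[RHS]conv1r ?scal_id //; exact: linear_o.
move=> /(congr1 (fun f => f a)) /= <-.
by rewrite /scal (linZ le) counit1 /GRing.scale /= mulr1.
Qed.

Lemma derivation1 i (D : A -> K^o) : point_derivation i D -> D 1 = 0.
Proof.
case=> _ mD _; have := mD 1 1; rewrite mulr1 counit1 mulr1 mul1r => /eqP.
by rewrite -subr_eq subrr eq_sym => /eqP.
Qed.

(** The derivation vanishes on constants, and by the Leibniz rule its value on the convolution of S
    and id is D S + D. *)
Lemma derivation_antipode i (D : A -> K^o) a :
  point_derivation i D -> D (antipode a) = - D a.
Proof.
move=> dD; have [lD mD _] := dD; have le := @counit_linear K A.
have lS := @antipode_linear K A.
have : D (conv antipode id a) = 0.
  by rewrite conv_antipodel /scal (linZ lD) (derivation1 dD) scaler0.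
rewrite /conv (lin_tlift _ _ lD).
rewrite (_ : tlift _ _ = conv (D \o antipode) counit a + conv counit D a); last first.
  rewrite /conv /tlift /formal_sum -big_split /=; apply: eq_bigr => p _.
  by rewrite mD counit_antipode.
rewrite -{1}[@counit K A]scal_id conv1r; last exact: linear_o.
rewrite -{1}[@counit K A]scal_id conv1l // => /eqP.
by rewrite addr_eq0 => /eqP.
Qed.

(** The invariant vector field whose value at the identity is u. *)
Definition lder (u : A -> K^o) : A -> A := conv (scal u) id.

Lemma lderE u a : lder u a = tlift (fun x y => (u x : K) *: y) (comul a).
Proof. exact: conv_scall. Qed.

Section OddDerivation.
Variable u : A -> K^o.
Hypothesis du : point_derivation true u.
Let lu : linear u. Proof. by case: du. Qed.

Lemma odd_der_even a : u (spart false a) = 0.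
Proof. by case: du => _ _; apply. Qed.
Lemma odd_der_odd a : u (spart true a) = u a.
Proof. by rewrite -[in RHS](spartD a) (linD lu) odd_der_even add0r. Qed.

Lemma lder_linear : linear (lder u).
Proof. by apply: conv_linear => //; exact: scal_linear. Qed.

Lemma lder_part k a : lder u (spart k a) = spart (~~ k) (lder u a).
Proof.
have lsu := @scal_linear A _ lu.
rewrite /lder conv_part // big_bool /= [X in _ + X]big1 ?addr0 => [|p _]; last first.
  by rewrite /= /scal odd_der_even scale0r mul0r.
rewrite /conv (lin_tlift _ _ (spart_linear _)); apply: eq_tlift => x y /=.
by rewrite /scal odd_der_odd -!scalerAl !mul1r spartZ.
Qed.

(** The sign of moving the odd u past a is [parity a]. The identity is proved with arbitrary tensors
    in place of the two comultiplications, where bilinearity reduces it to pure tensors. *)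
Lemma lderM a b : lder u (a * b) = lder u a * b + parity a * lder u b.
Proof.
pose T (t : tensor A A) := tlift (fun x y : A => (u x : K) *: y) t.
pose E (t : tensor A A) := tlift (fun x y : A => (counit x : K) *: y) t.
have le := @counit_linear K A.
have bT (f : A -> K^o) : linear f -> bilin (fun x y : A => (f x : K) *: y).
  move=> lf; split=> [x|y] c z w; first by rewrite scalerDr !scalerA mulrC.
  by rewrite lf scalerDl scalerA.
have lT : linear T by apply: tlift_linear; exact: bT.
have lE : linear E by apply: tlift_linear; exact: bT.
have TM s t : T (tmul s t) = T s * E t + parity (E s) * T t.
  have [m1 m2] := bilin_tmul A A; have lp := @parity_linear K A.
  move: s t; apply: tensor_ext2.
  - split=> [s|t]; first exact: (linear_comp (m1 s) lT).
    exact: (linear_comp (m2 t) lT).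
  - split=> [s|t] c x y.
      by rewrite lT lE !mulrDr -!scalerAr scalerDr addrACA.
      rewrite lT lE lp; move: (parity _) (parity _) => p q.
      by rewrite !mulrDl -!scalerAl scalerDr addrACA.
  move=> a1 a2 b1 b2; rewrite tmul_tens /tmul4 (lin_sum lT) big_bool /=.
  rewrite !(lin_sum lT) !big_bool /= !(linZ lT) /T /E !tlift_tens; try exact: bT.
  case: du => _ mu _; rewrite !mu counit_odd counit_even odd_der_even odd_der_odd.
  rewrite !(mulr0, mul0r, add0r, addr0) !scale1r scaleN1r.
  rewrite (linZ lp) !scalerBr mulrBl -!scalerAl -!scalerAr !scalerA.
  rewrite -[in RHS](spartD a2) mulrDl scalerDr !spartDr !spartK /= addr0 add0r.
  by rewrite [LHS]addrC addrACA [RHS]addrC addrACA.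
have L x y : lder u (x * y) = T (tmul (comul x) (comul y)) by rewrite lderE comulM.
rewrite L TM -!/(T _) /T -!lderE; congr (_ * _ + parity _ * _); exact: comul_counitl.
Qed.

Lemma lder_conv (f g : A -> A) :
  lder u \o conv f g = fun a => conv (lder u \o f) g a + conv (@parity K A \o f) (lder u \o g) a.
Proof.
apply/funext => a; rewrite /= {1}/conv (lin_tlift _ _ lder_linear).
rewrite /conv /tlift /formal_sum -big_split; apply: eq_bigr => p _.
exact: lderM.
Qed.

Lemma lder_scal (f : A -> K^o) : lder u \o scal f = fun=> 0.
Proof.
apply/funext => a; rewrite /= /scal (linZ lder_linear) lderE comul1.
rewrite tlift_tens; last first.
  split=> [x|y] c z w; first by rewrite scalerDr !scalerA mulrC.
  by rewrite lu scalerDl scalerA.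
by rewrite (derivation1 du) scale0r scaler0.
Qed.

Lemma parity_scal (f : A -> K^o) : @parity K A \o scal f = scal f.
Proof.
by apply/funext => a; rewrite /= /scal (linZ (@parity_linear _ _)) /parity !spart_one subr0.
Qed.

(** Differentiating S * id = counit expresses the convolution of [lder u \o antipode] with id
    through [lder u]; convolving with S on the right cancels id, and lder u * S = u. *)
Lemma lder_antipode :
  lder u \o antipode = fun a => - conv (@parity K A \o antipode) (scal u) a.
Proof.
have lS := @antipode_linear K A; have lsu := @scal_linear A _ lu.
have lp := @parity_linear K A; have lL := lder_linear; have l1 := @linear_id' K A.
have lpS := linear_o lS lp; have lLS := linear_o lS lL.
have h a : conv (lder u \o antipode) id a = - conv (@parity K A \o antipode) (lder u) a.
  have := congr1 (fun f => f a) (lder_conv antipode id).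
  rewrite conv_antipodel lder_scal => /eqP; rewrite eq_sym addr_eq0 => /eqP ->.
  by congr (- _).
have {}h := funext h.
rewrite -[LHS]conv1r // -conv_antipoder -conv_assoc // h.
apply/funext => a; rewrite convNl; congr (- _).
have E : conv (lder u) antipode = scal u.
  by rewrite /lder conv_assoc // conv_antipoder conv1r.
by rewrite conv_assoc // E.
Qed.

Lemma odd_der_parity : u \o @parity K A = fun a => - u a.
Proof.
by apply/funext => a; rewrite /= /parity (linB lu) odd_der_even odd_der_odd sub0r.
Qed.
End OddDerivation.

Lemma antipode_parity (a : A) : antipode (parity a) = parity (antipode a).
Proof. by rewrite /parity (linB (@antipode_linear _ _)) !antipode_part. Qed.

(* The tangent vector [v] conjugated by the generic point of [GG]; [parity] is the Koszul sign
   that appears when the odd parameter along [v] is moved to the front. *)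
Definition adj (v : A -> K^o) : A -> A :=
  conv (antipode \o @parity K A) (conv (scal v) id).

(** The Leibniz rule turns the derivative into S * (u*v + v*u) * id, the conjugate of the bracket;
    the two occurrences of [parity] cancel. *)
Lemma lder_adj (u v : A -> K^o) : point_derivation true u -> point_derivation true v ->
  (forall a, convol u v a + convol v u a = 0) -> forall a, lder u (adj v a) = 0.
Proof.
move=> du dv uv a; have [lu _ _] := du; have [lv _ _] := dv.
have lS := @antipode_linear K A; have lsu := @scal_linear A _ lu.
have lsv := @scal_linear A _ lv; have l1 := @linear_id' K A.
have lp := @parity_linear K A; have lSp := linear_o lp lS; have lpS := linear_o lS lp.
have lL := lder_linear du.
have E1 : lder u \o (antipode \o @parity K A) = conv antipode (scal u).
  have := lder_antipode du => /(congr1 (fun f => f \o @parity K A)) => E.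
  rewrite -[LHS]/((lder u \o antipode) \o @parity K A) E; apply/funext => b.
  rewrite /= -[conv _ _ (parity b)]/((conv _ _ \o @parity K A) b) conv_parity //.
  rewrite (_ : scal u \o @parity K A = fun b => - scal u b); last first.
    apply/funext => c; rewrite /= /scal.
    by rewrite -[u (parity c)]/((u \o @parity K A) c) odd_der_parity // scaleNr.
  rewrite convNr opprK; congr (conv _ _ b); apply/funext => c /=.
  by rewrite antipode_parity parityK.
have E2 : @parity K A \o (antipode \o @parity K A) = antipode :> (A -> A).
  by apply/funext => c; rewrite /= antipode_parity parityK.
have E3 : lder u \o conv (scal v) id = conv (scal v) (conv (scal u) id).
  apply/funext => b; rewrite lder_conv // lder_scal // parity_scal.
  rewrite [X in X + _](_ : _ = 0) ?add0r //.
  by apply: big1 => p _; rewrite mul0r.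
rewrite -[lder u _]/((lder u \o conv _ _) a) lder_conv // E1 E2 E3.
have lid := conv_linear lsv l1.
rewrite conv_assoc //  -convDr; apply: big1 => p _; rewrite -!conv_assoc // -convDl !conv_scal.
rewrite [X in _ * X](_ : _ = 0) ?mulr0 //.
by apply: big1 => q _; rewrite /scal -scalerDl uv scale0r mul0r.
Qed.
End Convolution.

(** * The odd ideal and invariant vector fields *)

Section OddIdealPowers.
Variables (K : fieldType) (A : hopfSuperAlgType K).

Lemma hopfIdeal_subspace (I : hopfIdeal A) : subspace I.
Proof. by split; [exact: hopfIdeal0|exact: hopfIdealP]. Qed.

Local Notation J := (odd_ideal (A := A)).
Let sJ : subspace J. Proof. exact: (hopfIdeal_subspace (oddIdeal A)). Qed.
Lemma oddJ x : spart true x = x -> J x.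
Proof. exact: (@ideal_gen_sub K A (fun x => spart true x = x)). Qed.
Lemma spart_trueJ x : J (spart true x).
Proof. by apply: oddJ; exact: spart_id. Qed.
Let JMl a x : J x -> J (a * x). Proof. exact: (hopfIdealMl (h := oddIdeal A)). Qed.
Let JMr a x : J x -> J (x * a). Proof. exact: (hopfIdealMr (h := oddIdeal A)). Qed.

Definition iprod (P Q : A -> Prop) (x : A) : Prop :=
  forall S : A -> Prop, subspace S -> (forall p q, P p -> Q q -> S (p * q)) -> S x.

Lemma iprod_subspace P Q : subspace (iprod P Q).
Proof.
split=> [S sS _|c x y hx hy S sS h]; first exact: subspace0.
by case: (sS) => _; apply; [exact: hx|exact: hy].
Qed.
Lemma iprod_mul (P Q : A -> Prop) p q : P p -> Q q -> iprod P Q (p * q).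
Proof. by move=> hp hq S _; apply. Qed.

Fixpoint Jpow (n : nat) : A -> Prop :=
  if n is m.+1 then iprod J (Jpow m) else fun=> True.

#[global] Arguments Jpow : simpl never.

Lemma Jpow_subspace n : subspace (Jpow n).
Proof. by case: n => [|n]; [|exact: iprod_subspace]. Qed.

Lemma JpowMl n a x : Jpow n x -> Jpow n (a * x).
Proof.
case: n => // n hx; have lM := @mulr_linear K A a.
apply: (hx (fun x => Jpow n.+1 (a * x))).
  exact: (subspace_comp lM (Jpow_subspace _)).
by move=> p q hp hq; rewrite mulrA; apply: iprod_mul => //; exact: JMl.
Qed.

Lemma JpowMr n a x : Jpow n x -> Jpow n (x * a).
Proof.
elim: n x => // n IH x hx; have lM := @mull_linear K A a.
apply: (hx (fun x => Jpow n.+1 (x * a))).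
  exact: (subspace_comp lM (Jpow_subspace _)).
by move=> p q hp hq; rewrite -mulrA; apply: iprod_mul => //; exact: IH.
Qed.

Lemma Jpow1 x : Jpow 1 x <-> J x.
Proof.
split=> [h|h]; last by rewrite -[x]mulr1; exact: iprod_mul.
by apply: h => // p q hp _; exact: JMr.
Qed.

Lemma Jpow_mul m n x y : Jpow m x -> Jpow n y -> Jpow (m + n) (x * y).
Proof.
move=> hx hy; elim: m x hx => [|m IH] x hx; first exact: JpowMl.
have lM := @mull_linear K A y.
apply: (hx (fun x => Jpow (m.+1 + n) (x * y))).
  exact: (subspace_comp lM (Jpow_subspace _)).
by move=> p q hp hq; rewrite -mulrA; apply: iprod_mul => //; exact: IH.
Qed.

Lemma Jpow_mulJ n x y : Jpow n x -> J y -> Jpow n.+1 (x * y).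
Proof. by move=> hx /Jpow1 hy; rewrite -addn1; exact: Jpow_mul. Qed.
Lemma J_mulJpow n x y : J x -> Jpow n y -> Jpow n.+1 (x * y).
Proof. exact: iprod_mul. Qed.
Lemma J_mulJ x y : J x -> J y -> Jpow 2 (x * y).
Proof. by move=> hx /Jpow1 hy; exact: iprod_mul. Qed.

Lemma Jpow_part n i x : Jpow n x -> Jpow n (spart i x).
Proof.
elim: n i x => // n IH i x hx.
apply: (hx (fun x => Jpow n.+1 (spart i x))).
  exact: (subspace_comp (spart_linear i) (Jpow_subspace _)).
move=> p q hp hq; rewrite spart_mul; apply: (subspaceD (Jpow_subspace _)).
  by apply: iprod_mul; [exact: (odd_ideal_part false)|exact: IH].
by apply: iprod_mul; [exact: (odd_ideal_part true)|exact: IH].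
Qed.

Lemma Jpow_parity n x : Jpow n x -> Jpow n (parity x).
Proof. by move=> h; apply: (subspaceB (Jpow_subspace _)); exact: Jpow_part. Qed.
Lemma J_parity x : J x -> J (parity x).
Proof. by move=> /Jpow1/Jpow_parity/Jpow1. Qed.

Lemma lder_Jpow u n x : point_derivation true u -> Jpow n.+1 x -> Jpow n (lder u x).
Proof.
move=> du; elim: n x => // n IH x hx; have lL := lder_linear du.
apply: (hx (fun x => Jpow n.+1 (lder u x))).
  exact: (subspace_comp lL (Jpow_subspace _)).
move=> p q hp hq; rewrite lderM //; apply: (subspaceD (Jpow_subspace _)).
  exact: JpowMl.
by apply: iprod_mul; [exact: J_parity|exact: IH].
Qed.

(* Left combinations of the products of [n] of the [ts], taken with decreasing indices. *)
Fixpoint monomials (ts : seq A) (n : nat) (c : A) : Prop :=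
  match n, ts with
  | 0, _ => True
  | n'.+1, [::] => c = 0
  | n'.+1, t :: ts' => exists p q, [/\ monomials ts' n'.+1 p, monomials ts' n' q & c = p + q * t]
  end.

Lemma monomials0 ts c : monomials ts 0 c.
Proof. by case: ts. Qed.

Lemma monomials_subspace ts n : subspace (monomials ts n).
Proof.
elim: ts n => [|t ts IH] [|n] //=; first by split=> // c x y -> ->; rewrite scaler0 addr0.
split; first by exists 0, 0; split; rewrite ?mul0r ?addr0 //; exact: subspace0.
move=> c _ _ [p [q [hp hq ->]]] [p' [q' [hp' hq' ->]]].
exists (c *: p + p'), (c *: q + q'); split.
- by case: (IH n.+1) => _; apply.
- by case: (IH n) => _; apply.
by rewrite mulrDl -scalerAl scalerDr addrACA.
Qed.

Lemma monomialsMl ts n a c : monomials ts n c -> monomials ts n (a * c).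
Proof.
elim: ts n c => [|t ts IH] [|n] c //=; first by move=> ->; rewrite mulr0.
move=> [p [q [hp hq ->]]]; exists (a * p), (a * q); split; try exact: IH.
by rewrite mulrDr mulrA.
Qed.

(** Each generator occurs at most once in a product; the nilpotency of J comes from here. *)
Lemma monomials_gt ts n c : (size ts < n)%N -> monomials ts n c -> c = 0.
Proof.
elim: ts n c => [|t ts IH] [|n] c //= hn [p [q [hp hq ->]]].
by rewrite (IH _ _ _ hp) ?(IH _ _ _ hq) ?mul0r ?addr0 // ltnW.
Qed.

Definition all_odd (s : seq A) := forall t, t \in s -> spart true t = t.

Lemma all_odd_cons t s : all_odd (t :: s) -> spart true t = t /\ all_odd s.
Proof.
move=> h; split; first by apply: h; exact: mem_head.
by move=> x hx; apply: h; rewrite inE hx orbT.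
Qed.
Lemma monomials_parity ts n c : all_odd ts -> monomials ts n c -> monomials ts n (parity c).
Proof.
elim: ts n c => [|t ts IH] [|n] c //=.
  by move=> _ ->; rewrite (lin0 (@parity_linear _ _)).
move=> /all_odd_cons[ot ots] [p [q [hp hq ->]]].
exists (parity p), (- parity q); split; first exact: IH.
  by apply: subspaceN; [exact: monomials_subspace|exact: IH].
rewrite (linD (@parity_linear _ _)) parityM -[in parity t]ot parity_part scaleN1r ot.
by rewrite mulrN mulNr.
Qed.

Lemma monomialsMr ts n a c : all_odd ts -> monomials ts n c -> monomials ts n (c * a).
Proof.
elim: ts n c a => [|t ts IH] [|n] c a //=; first by move=> _ ->; rewrite mul0r.
move=> /all_odd_cons[ot ots] [p [q [hp hq ->]]].
exists (p * a), (q * parity a); split; try exact: IH.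
by rewrite mulrDl -!mulrA (odd_comm _ ot).
Qed.

Lemma monomials_Jpow ts n c : all_odd ts -> monomials ts n c -> Jpow n c.
Proof.
elim: ts n c => [|t ts IH] [|n] c //=.
  by move=> _ ->; exact: subspace0 (Jpow_subspace n.+1).
move=> /all_odd_cons[ot ots] [p [q [hp hq ->]]].
apply: (subspaceD (Jpow_subspace n.+1)); first exact: (IH n.+1).
by apply: Jpow_mulJ; [exact: IH|exact: oddJ].
Qed.

Hypothesis char2 : 2%N \notin [pchar K].

(** The new factor is moved, up to parity, to its place among the decreasing indices; where it meets
    itself, its square vanishes by [char2]. *)
Lemma monomials_cons t ts n c : all_odd ts -> t \in ts ->
  monomials ts n c -> monomials ts n.+1 (t * c).
Proof.
elim: ts n c => [|t' ts IH] n c //= /all_odd_cons[ot ots].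
have mon0 m : monomials ts m 0 by exact: subspace0 (monomials_subspace _ _).
rewrite inE => /orP[/eqP ->|hin].
  case: n => [_|n [p [q [hp hq ->]]]].
    exists 0, (parity c); split; [exact: mon0|exact: monomials0|].
    by rewrite add0r odd_comm.
  exists 0, (parity p); split; [exact: mon0|exact: monomials_parity|].
  rewrite mulrDr mulrA !(odd_comm _ ot) -mulrA odd_sqr //.
  by rewrite mulr0 addr0 add0r.
case: n => [_|n [p [q [hp hq ->]]]].
  exists (t * c), 0; split; [|exact: monomials0|by rewrite mul0r addr0].
  by apply: IH => //; exact: monomials0.
exists (t * p), (t * q); split; [exact: IH|exact: IH|by rewrite mulrDr mulrA].
Qed.

Lemma monomials1_mul ts n x c : all_odd ts ->
  monomials ts 1 x -> monomials ts n c -> monomials ts n.+1 (x * c).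
Proof.
move=> ots hx hc.
suff : forall s, {subset s <= ts} -> forall x, monomials s 1 x -> monomials ts n.+1 (x * c).
  by move=> h; exact: (h ts).
elim=> [|t s IH] hs y /=.
  by move=> ->; rewrite mul0r; exact: subspace0 (monomials_subspace _ _).
move=> [p [q [hp _ ->]]]; rewrite mulrDl.
apply: (subspaceD (monomials_subspace _ _)).
  by apply: IH => // z hz; apply: hs; rewrite inE hz orbT.
rewrite -mulrA; apply: monomialsMl; apply: monomials_cons => //.
by apply: hs; exact: mem_head.
Qed.

Lemma J_generated ts (Q : A -> Prop) : all_odd ts -> two_sided_ideal Q ->
  (forall y, spart true y = y -> exists2 z, monomials ts 1 z & Q (y - z)) ->
  forall x, J x -> exists2 z, monomials ts 1 z & Q (x - z).
Proof.
move=> ots [Q0 QD QM] gen x hx; have sm := monomials_subspace ts 1.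
apply: (hx (fun x => exists2 z, monomials ts 1 z & Q (x - z))) => //.
split=> [|y z [y' my qy] [z' mz qz]|a y [y' my qy]].
- by exists 0; rewrite ?subr0 //; exact: subspace0.
- exists (y' + z'); first exact: (subspaceD sm).
  by rewrite opprD addrACA; exact: QD.
split; [exists (a * y')|exists (y' * a)].
- exact: monomialsMl.
- by rewrite -mulrBr; case: (QM a _ qy).
- exact: monomialsMr.
by rewrite -mulrBl; case: (QM a _ qy).
Qed.

Lemma Jpow_ideal n : two_sided_ideal (Jpow n).
Proof.
have sJn := Jpow_subspace n.
split; [exact: subspace0 | exact: subspaceD |].
by move=> a x hx; split; [exact: JpowMl|exact: JpowMr].
Qed.

Lemma Jpow_monomials ts : all_odd ts ->
  (forall x, J x -> exists2 z, monomials ts 1 z & Jpow 2 (x - z)) ->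
  forall n x, Jpow n x -> exists2 z, monomials ts n z & Jpow n.+1 (x - z).
Proof.
move=> ots gen; elim=> [|n IH] x hx.
  by exists x; [exact: monomials0|rewrite subrr; exact: subspace0 (Jpow_subspace 1)].
have sm := monomials_subspace ts n.+1; have sJn := Jpow_subspace n.+2.
apply: (hx (fun x => exists2 z, monomials ts n.+1 z & Jpow n.+2 (x - z))).
  split=> [|c y z [y' my qy] [z' mz qz]].
    by exists 0; rewrite ?subr0; exact: subspace0.
  exists (c *: y' + z'); first by case: sm => _; apply.
  have -> : c *: y + z - (c *: y' + z') = c *: (y - y') + (z - z').
    by rewrite scalerBr opprD addrACA.
  by case: sJn => _; apply.
move=> p q /gen[p' mp qp] hq; have [q' mq qq] := IH _ hq.
exists (p' * q'); first exact: monomials1_mul.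
have -> : p * q - p' * q' = (p - p') * q + p' * (q - q').
  by rewrite mulrBl mulrBr addrA subrK.
apply: (subspaceD sJn); first by have := Jpow_mul qp hq.
by apply: J_mulJpow => //; apply/Jpow1; exact: monomials_Jpow mp.
Qed.

Lemma Jpow_generated ts : all_odd ts -> (forall x, J x -> monomials ts 1 x) ->
  forall n x, Jpow n x -> monomials ts n x.
Proof.
move=> ots gen; elim=> [|n IH] x hx; first exact: monomials0.
apply: hx; first exact: monomials_subspace.
by move=> p q /gen hp /IH hq; exact: monomials1_mul.
Qed.

Lemma odd_generators : finitely_generated A ->
  exists2 xs, all_odd xs & forall x, J x -> monomials xs 1 x.
Proof.
move=> [s hs]; pose xs := [seq spart true x | x <- s].
have oxs : all_odd xs by move=> _ /mapP[x _ ->]; exact: spart_id.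
exists xs => // x hx; have sm := monomials_subspace xs 1.
apply: hx => [|y <-].
  split; [exact: subspace0|exact: subspaceD|].
  by move=> a y hy; split; [exact: monomialsMl|exact: monomialsMr].
(* The elements whose odd part is a combination of [xs] form a subalgebra, because the odd part of z
   w is z0 w1 + z1 w0. *)
apply: (hs (fun y => monomials xs 1 (spart true y))) => [|z hz].
  split=> [|c z w hz hw|z w hz hw].
  - by rewrite spart_one; exact: subspace0.
  - by rewrite spart_linear; case: sm => _; apply.
  rewrite spart_mul; apply: subspaceD => //; first exact: monomialsMl.
  exact: monomialsMr.
rewrite -[spart true z]mulr1; apply: monomials_cons => //; first exact: map_f.
exact: monomials0.
Qed.

Lemma J_nilpotent : finitely_generated A -> exists n, forall x, Jpow n x -> x = 0.
Proof.
move=> /odd_generators[xs oxs gen]; exists (size xs).+1 => x hx.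
by apply: (monomials_gt (leqnn _)); exact: (Jpow_generated oxs gen).
Qed.
End OddIdealPowers.
#[global] Arguments Jpow {K A} n _ : simpl never.

(** * Left coinvariants modulo the square of the odd ideal *)

Section OddCoordinates.
Variables (K : fieldType) (A : hopfSuperAlgType K).
Local Notation J := (odd_ideal (A := A)).
Let sJ : subspace J. Proof. exact: (hopfIdeal_subspace (oddIdeal A)). Qed.
Let JMl a x : J x -> J (a * x). Proof. exact: (hopfIdealMl (h := oddIdeal A)). Qed.
Let JMr a x : J x -> J (x * a). Proof. exact: (hopfIdealMr (h := oddIdeal A)). Qed.
Let lS := @antipode_linear K A.
Let l1 := @linear_id' K A.
Let le i := @spart_linear K A i.
Let lSe i : linear (antipode \o @spart K A i). Proof. exact: linear_o. Qed.

Lemma antipode_spart_trueJ x : J (antipode (spart true x)).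
Proof. by rewrite antipode_part; exact: spart_trueJ. Qed.

Lemma id_sub_even x : x - spart false x = spart true x :> A.
Proof. by rewrite -[X in X - _](spartD x) addrC addKr. Qed.

Lemma conv_congrJ (f f' g g' : A -> A) a :
  (forall x, J (f x - f' x)) -> (forall x, J (g x - g' x)) ->
  J (conv f g a - conv f' g' a).
Proof.
move=> hf hg; rewrite /conv /tlift /formal_sum -sumrB; apply: (subspace_sum sJ) => p _.
have -> : f p.1 * g p.2 - f' p.1 * g' p.2 =
    (f p.1 - f' p.1) * g p.2 + f' p.1 * (g p.2 - g' p.2).
  by rewrite mulrBl mulrBr addrA subrK.
by apply: (subspaceD sJ); [exact: JMr|exact: JMl].
Qed.

(* Modulo the square of the odd ideal, [coinv] sends an odd element to its left coinvariant
   part, as in the fundamental theorem of Hopf modules. *)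
Definition coinv : A -> A := conv (spart true) (antipode \o spart false).

Lemma coinv_linear : linear coinv.
Proof. exact: conv_linear. Qed.

Lemma coinv_odd y : spart true (coinv y) = coinv y.
Proof.
rewrite /coinv /conv (lin_tlift _ _ (le true)); apply: eq_tlift => x z /=.
by rewrite spart_mull /= antipode_part spart_id.
Qed.

Lemma coinv_even y : coinv (spart false y) = 0.
Proof.
rewrite /coinv conv_part // big_bool /= /conv /tlift /formal_sum -big_split big1 //= => p _.
by rewrite !spartK /= mul0r (lin0 lS) mulr0 addr0.
Qed.

Lemma coinvJ y : J (coinv y).
Proof. by apply: oddJ; exact: coinv_odd. Qed.

Lemma lder_coinv u y : point_derivation true u -> J (lder u (coinv y) - (u y : K) *: 1).
Proof.
move=> du; have lL := lder_linear du; have [lu _ _] := du.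
have E : scal u = conv (lder u) antipode.
  by rewrite /lder conv_assoc ?conv_antipoder ?conv1r //; exact: scal_linear.
rewrite -[_ *: 1]/(scal u y) E -[lder u _]/((lder u \o coinv) y) lder_conv //.
rewrite addrAC; apply: (subspaceD sJ).
  apply: conv_congrJ => x /=.
    have -> : lder u (spart true x) - lder u x = - lder u (spart false x).
      by rewrite -[in lder u x](spartD x) (linD lL) opprD addrCA subrr addr0.
    by rewrite lder_part //; apply: (subspaceN sJ); exact: spart_trueJ.
  have -> : antipode (spart false x) - antipode x = - antipode (spart true x).
    by rewrite -[in X in _ - X](spartD x) (linD lS) opprD addrA subrr sub0r.
  by apply: (subspaceN sJ); exact: antipode_spart_trueJ.
apply: (subspace_sum sJ) => p _; apply: JMr; apply: J_parity; exact: spart_trueJ.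
Qed.

(** Insert S * id after the odd projection and keep only even parts in it: the error is a sum of
    products of two elements of J. Hence the coinvariants generate J modulo its square. *)
Lemma odd_coinv y : Jpow 2 (spart true y - conv coinv (spart false) y).
Proof.
have sJ2 := @Jpow_subspace K A 2.
have -> : spart true y = conv (spart true) (conv antipode id) y.
  by rewrite conv_antipodel conv1r.
rewrite /coinv conv_assoc // /conv /tlift /formal_sum -sumrB.
apply: (subspace_sum sJ2) => p _; rewrite -mulrBr; apply: J_mulJ.
  exact: spart_trueJ.
apply: (@conv_congrJ antipode (antipode \o spart false) id (spart false)) => x /=.
  by rewrite -(linB lS) id_sub_even; exact: antipode_spart_trueJ.
by rewrite id_sub_even; exact: spart_trueJ.
Qed.

Lemma even_part_counit y :
  J (conv (spart false) (antipode \o spart false) y - (counit y : K) *: 1).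
Proof.
have -> : (counit y : K) *: (1 : A) = conv id antipode y by rewrite conv_antipoder.
rewrite -opprB; apply: (subspaceN sJ); apply: conv_congrJ => x /=.
  by rewrite id_sub_even; exact: spart_trueJ.
by rewrite -(linB lS) id_sub_even; exact: antipode_spart_trueJ.
Qed.

(** The terms in which the antipode meets two odd factors lie in the square of J; in the others the
    even factors commute and [even_part_counit] turns them into counits. So a functional vanishing
    on the square of J, composed with [coinv], is an odd point derivation. *)
Lemma coinvM a b :
  Jpow 2 (coinv (a * b) - ((counit b : K) *: coinv a + (counit a : K) *: coinv b)).
Proof.
have sJ2 := @Jpow_subspace K A 2.
pose P (t : tensor A A) := tlift (fun x y : A => spart true x * antipode (spart false y)) t.
pose E (t : tensor A A) := tlift (fun x y : A => spart false x * antipode (spart false y)) t.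
have bP i : bilin (fun x y : A => spart i x * antipode (spart false y)).
  by apply: (bilin_mulo (le i)); exact: lSe.
have lP : linear P by apply: tlift_linear; exact: bP.
have lE : linear E by apply: tlift_linear; exact: bP.
have [m1 m2] := bilin_tmul A A.
have PM s t : Jpow 2 (P (tmul s t) - (P s * E t + E s * P t)).
  move: s; apply: tensor_elim => [a1 a2||x y hx hy]; last first.
  - rewrite (linD (m2 t)) (linD lP) (linD lP x) (linD lE) !mulrDl addrACA opprD addrACA.
    exact: (subspaceD sJ2).
  - rewrite (lin0 (m2 t)) (lin0 lP) (lin0 lE) !mul0r addr0 subr0.
    exact: (subspace0 sJ2).
  move: t; apply: tensor_elim => [b1 b2||x y hx hy]; last first.
  - rewrite (linD (m1 _)) (linD lP) (linD lP x) (linD lE) !mulrDr addrACA opprD addrACA.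
    exact: (subspaceD sJ2).
  - rewrite (lin0 (m1 _)) (lin0 lP) (lin0 lE) !mulr0 addr0 subr0.
    exact: (subspace0 sJ2).
  rewrite tmul_tens /tmul4 (lin_sum lP) big_bool /= !(lin_sum lP) !big_bool /=.
  rewrite !(linZ lP) /P /E !tlift_tens // !spart_mulr !spart_mull /= !antipodeM.
  rewrite !scale1r -!addrA.
  have J2 (x y z : A) : Jpow 2 (x * (antipode (spart true y) * antipode (spart true z))).
    by apply: JpowMl; apply: J_mulJ; exact: antipode_spart_trueJ.
  apply: (subspaceD sJ2); first by apply: (subspaceZ sJ2); exact: J2.
  apply: (subspaceD sJ2); first exact: J2.
  have ec (x y z w : A) : x * y * (antipode (spart false z) * w) =
      (x * antipode (spart false z)) * (y * w).
    rewrite antipode_part -!mulrA; congr (_ * _).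
    by rewrite mulrA -even_comm mulrA.
  by rewrite !ec addrA [X in X - _]addrC subrr; exact: subspace0 sJ2.
rewrite -[coinv (a * b)]/(P (comul (a * b))) comulM.
have -> : P (tmul (comul a) (comul b)) -
    ((counit b : K) *: coinv a + (counit a : K) *: coinv b) =
  (P (tmul (comul a) (comul b)) - (coinv a * E (comul b) + E (comul a) * coinv b)) +
  (coinv a * (E (comul b) - (counit b : K) *: 1) + (E (comul a) - (counit a : K) *: 1) * coinv b).
  rewrite mulrBr mulrBl -scalerAr -scalerAl mulr1 mul1r.
  by rewrite [X in _ = _ + X]addrACA [RHS]addrA subrK opprD.
apply: (subspaceD sJ2); first exact: PM.
by apply: (subspaceD sJ2); apply: J_mulJ; (exact: coinvJ || exact: even_part_counit).
Qed.
End OddCoordinates.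
Arguments coinv {K A} a : rename.

(** * Elements of J killed by all odd invariant vector fields *)

Section InvariantVanishing.
Variables (K : fieldType) (A : hopfSuperAlgType K).
Local Notation J := (odd_ideal (A := A)).

(** Only the values on later elements are prescribed, so that a family can be built by adding one
    pair at a time at the head. *)
Fixpoint triangular (ps : seq ((A -> K^o) * A)) : Prop :=
  if ps is p :: ps' then
    [/\ point_derivation true p.1, spart true p.2 = p.2, p.1 p.2 = 1,
        forall y, y \in map snd ps' -> p.1 y = 0 & triangular ps']
  else True.

Lemma point_derivationZ i c (D : A -> K^o) :
  point_derivation i D -> point_derivation i (fun a => c * D a).
Proof.
case=> lD mD pD; split=> [d x y|a b|a].
- by rewrite lD mulrDr /GRing.scale /=; congr (_ + _); ring.
- by rewrite mD mulrDr mulrA; congr (_ + _); ring.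
by rewrite pD mulr0.
Qed.

(** Gaussian elimination: an element is added only if some derivation vanishing on those already
    chosen is nonzero on it. *)
Lemma triangular_exists (xs : seq A) : all_odd xs ->
  exists2 ps, triangular ps &
    forall v, point_derivation true v -> (forall y, y \in map snd ps -> v y = 0) ->
      forall x, x \in xs -> v x = 0.
Proof.
elim: xs => [|x xs IH]; first by exists [::].
move=> /all_odd_cons[ox /IH[ps tps hps]].
have [[v [dv vps vx]]|nv] := pselect (exists v, [/\ point_derivation true v,
    forall y, y \in map snd ps -> v y = 0 & v x != 0]).
  exists ((fun a => (v x)^-1 * v a, x) :: ps) => [|w dw hw y].
    split=> //=; [exact: point_derivationZ|by rewrite mulVf|].
    by move=> y /vps ->; rewrite mulr0.
  rewrite inE => /orP[/eqP -> |]; first by apply: hw; rewrite /= mem_head.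
  by apply: hps => // z hz; apply: hw; rewrite /= inE hz orbT.
exists ps => // w dw hw y; rewrite inE => /orP[/eqP ->|]; last exact: hps.
by apply: contrapT => /eqP wx; apply: nv; exists w.
Qed.

Lemma monomials_lspan (ts : seq A) x : lspan ts x -> monomials ts 1 x.
Proof.
apply: lspan_min; first exact: monomials_subspace.
move=> t; elim: ts => //= t' ts IH; rewrite inE => /orP[/eqP ->|/IH h].
  exists 0, 1; split; [|exact: monomials0|by rewrite add0r mul1r].
  exact: (subspace0 (monomials_subspace _ _)).
by exists t, 0; split; [|exact: monomials0|rewrite mul0r addr0].
Qed.

Lemma monomials_lder ts v n c : all_odd ts -> point_derivation true v ->
  (forall t, t \in ts -> J (lder v t)) -> monomials ts n c -> Jpow n (lder v c).
Proof.
move=> + dv; have lL := lder_linear dv.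
elim: ts n c => [|t ts IH] [|n] c //=.
  by move=> _ _ ->; rewrite (lin0 lL); exact: (subspace0 (@Jpow_subspace K A n.+1)).
move=> /all_odd_cons[ot ots] ht [p [q [hp hq ->]]].
have hts s : s \in ts -> J (lder v s) by move=> hs; apply: ht; rewrite inE hs orbT.
have sJn := @Jpow_subspace K A n.+1.
rewrite (linD lL) lderM //; apply: (subspaceD sJn); first exact: IH.
apply: (subspaceD sJn).
  by apply: Jpow_mulJ; [exact: IH|exact: oddJ].
apply: Jpow_mulJ; last by apply: ht; exact: mem_head.
by apply: Jpow_parity; exact: (monomials_Jpow ots).
Qed.

(** Write c = p + q t. Modulo J^(n+1), [lder v] kills p, since v vanishes on the later elements, and
    sends q t to [parity q]. So q lies in J^(n+1) and q t in J^(n+2), and the induction goes on with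
    p. *)
Lemma coinv_descent ps n c : triangular ps ->
  monomials (map coinv (map snd ps)) n.+1 c ->
  (forall v, point_derivation true v -> Jpow n.+1 (lder v c)) -> Jpow n.+2 c.
Proof.
elim: ps c => [|[v y] ps IH] c.
  by move=> _ /= -> _; exact: (subspace0 (@Jpow_subspace K A _)).
move=> [/= dv oy vy vps tps] [p [q [hp hq cE]]] hL.
set ts := map coinv (map snd ps) in hp hq; set t := coinv y in cE.
have ots : all_odd ts by move=> _ /mapP[z _ ->]; exact: coinv_odd.
have ot : spart true t = t by exact: coinv_odd.
have hts s : s \in ts -> J (lder v s).
  move=> /mapP[z hz ->]; have := lder_coinv z dv.
  by rewrite (vps z hz) scale0r subr0.
have sJn m := @Jpow_subspace K A m; have lL := lder_linear dv.
have qJ : Jpow n q by exact: (monomials_Jpow ots).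
have qJ1 : Jpow n.+1 q.
  rewrite -[q]parityK; apply: Jpow_parity.
  have -> : parity q = lder v c - lder v p - lder v q * t - parity q * (lder v t - 1).
    rewrite cE (linD lL) lderM // mulrBr mulr1 [X in X - lder v p]addrC addrK.
    by rewrite [X in X - lder v q * t]addrC addrK opprB addrC subrK.
  apply: (subspaceB (sJn _)).
    apply: (subspaceB (sJn _)).
      apply: (subspaceB (sJn _)); first exact: hL.
      exact: monomials_lder hp.
    by apply: Jpow_mulJ; [exact: monomials_lder hq|exact: oddJ].
  apply: Jpow_mulJ; first exact: Jpow_parity.
  by have := lder_coinv y dv; rewrite vy scale1r.
have qt : Jpow n.+2 (q * t) by apply: Jpow_mulJ => //; exact: oddJ.
rewrite cE; apply: (subspaceD (sJn _)) => //; apply: IH => // w dw.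
have -> : p = c - q * t by rewrite cE addrK.
rewrite (linB (lder_linear dw)); apply: (subspaceB (sJn _)); first exact: hL.
exact: lder_Jpow.
Qed.

Hypotheses (char2 : 2%N \notin [pchar K]) (fgA : finitely_generated A).

Lemma coinv_generate : exists2 ps, triangular ps &
  forall y, exists2 z, lspan (map coinv (map snd ps)) z & Jpow 2 (coinv y - z).
Proof.
have [xs oxs gen] := odd_generators char2 fgA.
have [ps tps hps] := triangular_exists oxs; exists ps => // y.
set L := lspan _; have sL : subspace L by exact: lspan_subspace.
have sJ2 := @Jpow_subspace K A 2.
pose S x := exists2 z, L z & Jpow 2 (x - z).
have sS : subspace S.
  split; first by exists 0; rewrite ?subr0; exact: subspace0.
  move=> c a b [z hz qz] [w hw qw]; exists (c *: z + w); first by case: sL => _; apply.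
  have -> : c *: a + b - (c *: z + w) = c *: (a - z) + (b - w).
    by rewrite scalerBr opprD addrACA.
  by case: sJ2 => _; apply.
(* A functional f killing S with value 1 at [coinv y] would make f composed with [coinv] an odd
   derivation. It vanishes on the chosen elements, hence on the generators [xs] of J, on J, and
   finally on y. *)
apply: contrapT => /(separating_functional sS)[f [lf fS f1]].
have fJ2 x : Jpow 2 x -> f x = 0.
  by move=> hx; apply: fS; exists 0; [exact: subspace0|rewrite subr0].
have dv : point_derivation true (fun a => f (coinv a)).
  split=> [|a b|a].
  - exact: (linear_comp (@coinv_linear K A) lf).
  - have := fJ2 _ (coinvM a b); rewrite (linB lf) (linD lf) !(linZ lf) => /eqP.
    by rewrite subr_eq0 => /eqP ->; rewrite /GRing.scale /= mulrC.
  - by rewrite coinv_even (lin0 lf).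
have v0 x : x \in xs -> f (coinv x) = 0.
  apply: (hps _ dv) => z hz; apply: fS; exists (coinv z); last first.
    by rewrite subrr; exact: subspace0.
  by apply: lspan_mem; exact: map_f.
have vJ x : J x -> f (coinv x) = 0.
  move=> /gen; case: (dv) => lv mv _.
  elim: xs x v0 oxs {gen hps} => [|t ts IH] x hv /= => [_ -> | /all_odd_cons[ot ots]].
    exact: (lin0 lv).
  move=> [p [q [hp _ ->]]]; rewrite (linD lv) mv (hv t) ?mem_head //.
  rewrite -[in counit t]ot counit_odd !mulr0 !addr0.
  by apply: IH => // s hs; apply: hv; rewrite inE hs orbT.
have := vJ _ (spart_trueJ y); move: f1.
rewrite -[in coinv y](spartD y) (linD (@coinv_linear K A)) coinv_even add0r => -> /eqP.
by rewrite oner_eq0.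
Qed.

Theorem lder_injective c : J c ->
  (forall u, point_derivation true u -> lder u c = 0) -> c = 0.
Proof.
move=> Jc hc; have sJn m := @Jpow_subspace K A m; have sJ2 := sJn 2.
have [ps tps gen] := coinv_generate; set ts := map coinv _ in gen.
have ots : all_odd ts by move=> _ /mapP[z _ ->]; exact: coinv_odd.
have genJ x : J x -> exists2 z, monomials ts 1 z & Jpow 2 (x - z).
  apply: (J_generated ots (@Jpow_ideal K A 2)) => y oy.
  have gen1 w : exists2 z, monomials ts 1 z & Jpow 2 (coinv w - z).
    by have [z /monomials_lspan hz qz] := gen w; exists z.
  have sm := monomials_subspace ts 1.
  pose S x := exists2 z, monomials ts 1 z & Jpow 2 (x - z).
  suff : S (conv coinv (spart false) y).
    move=> [z hz qz]; exists z => //; have := odd_coinv y; rewrite oy => h.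
    by have := subspaceD sJ2 h qz; rewrite addrA subrK.
  have sS : subspace S.
    split; first by exists 0; rewrite ?subr0; exact: subspace0.
    move=> d a b [z hz qz] [w hw qw]; exists (d *: z + w); first by case: sm => _; apply.
    have -> : d *: a + b - (d *: z + w) = d *: (a - z) + (b - w).
      by rewrite scalerBr opprD addrACA.
    by case: sJ2 => _; apply.
  apply: (subspace_sum sS) => p _; have [z hz qz] := gen1 p.1.
  exists (z * spart false p.2); first exact: monomialsMr.
  by rewrite -mulrBl; exact: JpowMr.
have step n : Jpow n.+1 c.
  elim: n => [|n IH]; first exact/Jpow1.
  have [z mz qz] := Jpow_monomials char2 ots genJ IH.
  rewrite -[c](subrK z); apply: (subspaceD (sJn _)) => //.
  apply: (coinv_descent tps mz) => v dv.
  have -> : z = c - (c - z) by rewrite opprB addrC subrK.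
  rewrite (linB (lder_linear dv)) hc // sub0r; apply: (subspaceN (sJn _)).
  exact: lder_Jpow.
have [[|N] hN] := J_nilpotent char2 fgA; first exact: hN.
exact: hN.
Qed.
End InvariantVanishing.

(** * Weights and the bracket *)

Section Grouplikes.
Variables (K : fieldType) (H : hopfSuperAlgType K).

(** By induction [gs] has dual functionals [phi]. Contracting [comul g] with [phi h] gives phi_h(g)
    g because g is grouplike, and phi_h(g) h because g lies in the span. As g differs from every h,
    all phi_h(g) vanish, so g = 0, against counit g = 1. *)
Lemma grouplike_independent (g : H) (gs : seq H) :
  uniq gs -> (forall h, h \in gs -> grouplike h) -> grouplike g -> g \notin gs ->
  ~ lspan gs g.
Proof.
have [n] := ubnP (size gs); elim: n g gs => // n IH g gs; rewrite ltnS => sz ugs ggs gg ngs.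
have lc := @comul_linear K H.
have {IH} [phi hphi] : {phi : H -> H -> K^o & forall h, h \in gs ->
    [/\ linear (phi h) & forall k, k \in gs -> phi h k = (h == k)%:R]}.
  apply: (@choice _ _ (fun h (f : H -> K^o) => h \in gs ->
    [/\ linear f & forall k, k \in gs -> f k = (h == k)%:R])) => h.
  have [hin|hout] := boolP (h \in gs); last by exists (fun=> 0).
  have urem := rem_uniq h ugs.
  have hrem : h \notin rem h gs by rewrite mem_rem_uniq // inE eqxx.
  have ilt : (size (rem h gs) < n)%N.
    by rewrite size_rem // (leq_trans _ sz) // prednK //; case: (gs) hin.
  have grem k : k \in rem h gs -> grouplike k by move=> /mem_rem; exact: ggs.
  have [f [lf f0 f1]] := separating_functional (lspan_subspace _)
    (IH h _ ilt urem grem (ggs _ hin) hrem).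
  exists f => _; split=> // k hk; have [<- //|nhk] := eqVneq h k.
  by apply: f0; apply: lspan_mem; rewrite mem_rem_uniq // inE eq_sym nhk.
move=> sg.
have E x : lspan gs x -> x = \sum_(h <- gs) (phi h x : K) *: h.
  apply: (@lspan_min _ _ _ (fun x => x = \sum_(h <- gs) (phi h x : K) *: h)) => [|y hy].
    split.
      by rewrite big_seq big1 // => h /hphi[lf _]; rewrite (lin0 lf) scale0r.
    move=> c y z hy hz; rewrite {1}hy {1}hz scaler_sumr -big_split /=.
    rewrite big_seq [RHS]big_seq; apply: eq_bigr => h /hphi[lf _].
    by rewrite lf scalerDl scalerA.
  rewrite (bigD1_seq y) //= big_seq_cond big1 ?addr0 => [|h /andP[/hphi[_ ->//]]].
    by have [_ ->] := hphi _ hy; rewrite // eqxx scale1r.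
  by move=> /negPf ->; rewrite scale0r.
have S h x : h \in gs -> lspan gs x -> slice (phi h) (comul x) = (phi h x : K) *: h.
  move=> hin; have [lf fE] := hphi _ hin.
  apply: (@lspan_min _ _ _ (fun x => slice (phi h) (comul x) = (phi h x : K) *: h)) => [|y hy].
    split; first by rewrite (lin0 lc) (lin0 (slice_linear lf)) (lin0 lf) scale0r.
    by move=> c y z hy hz; rewrite lc (slice_linear lf) hy hz lf scalerDl scalerA.
  have [-> _] := ggs _ hy; rewrite slice_tens // fE //.
  by case: eqP => [->//|]; rewrite !scale0r.
have phig h : h \in gs -> phi h g = 0.
  move=> hin; have := S h g hin sg; have [-> _] := gg.
  have [lf fE] := hphi _ hin; rewrite slice_tens // => /eqP.
  rewrite -subr_eq0 -scalerBr scaler_eq0 => /orP[/eqP //|].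
  by rewrite subr_eq0 => /eqP gh; rewrite gh hin in ngs.
have g0 : g = 0 by rewrite [LHS]E // big_seq big1 // => h /phig ->; rewrite scale0r.
case: gg => _; rewrite g0 (lin0 (@counit_linear K H)) => /eqP.
by rewrite eq_sym oner_eq0.
Qed.

Lemma grouplike_functional (gs : seq H) g :
  uniq gs -> (forall h, h \in gs -> grouplike h) -> g \in gs ->
  exists2 f : H -> K^o, linear f & forall h, h \in gs -> f h = (g == h)%:R.
Proof.
move=> ugs ggs gin; have urem := rem_uniq g ugs.
have hrem : g \notin rem g gs by rewrite mem_rem_uniq // inE eqxx.
have grem k : k \in rem g gs -> grouplike k by move=> /mem_rem; exact: ggs.
have [f [lf f0 f1]] := separating_functional (lspan_subspace _)
  (grouplike_independent urem grem (ggs _ gin) hrem).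
exists f => // k hk; have [<- //|nhk] := eqVneq g k.
by apply: f0; apply: lspan_mem; rewrite mem_rem_uniq // inE eq_sym nhk.
Qed.

Lemma grouplike_antipode (g : H) : grouplike g -> antipode g * g = 1 /\ g * antipode g = 1.
Proof.
have lS := @antipode_linear K H.
case=> dg eg; have := antipodel g; have := antipoder g.
rewrite dg eg scale1r !tlift_tens; first by move=> -> ->.
  exact: (@bilin_mulo K H H H antipode id).
exact: (@bilin_mulo K H H H id antipode).
Qed.

Definition grouplike_spanned : Prop :=
  forall a : H, exists2 s : seq (K * H),
    (forall p, p \in s -> grouplike p.2) & a = \sum_(p <- s) p.1 *: p.2.

Definition weight_sum (M : lmodType K) (t : tensor H M) : Prop :=
  exists gs (w : H -> M), [/\ uniq gs, forall g, g \in gs -> grouplike g &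
    t = \sum_(g <- gs) tens g (w g)].

Lemma sum_subseq (V : nmodType) (gs gs' : seq H) (F : H -> V) :
  uniq gs -> uniq gs' -> {subset gs <= gs'} ->
  \sum_(g <- gs') (if g \in gs then F g else 0) = \sum_(g <- gs) F g.
Proof.
move=> u u' sub; rewrite -big_mkcond -big_filter; apply: perm_big.
apply: uniq_perm => //; first exact: filter_uniq.
by move=> g; rewrite mem_filter; case: (boolP (g \in gs)) => //= /sub.
Qed.

Lemma weight_sumP (M : lmodType K) (t : tensor H M) :
  grouplike_spanned -> weight_sum t.
Proof.
move=> spanH; have [t1 t2] := bilin_tens H M.
have w0 : weight_sum (0 : tensor H M) by exists [::], (fun=> 0); rewrite big_nil.
have wD (x y : tensor H M) : weight_sum x -> weight_sum y -> weight_sum (x + y).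
  move=> [gs [w [u ggs ->]]] [gs' [w' [u' ggs' ->]]].
  exists (undup (gs ++ gs')), (fun g => (if g \in gs then w g else 0) +
    (if g \in gs' then w' g else 0)); split; first exact: undup_uniq.
    by move=> g; rewrite mem_undup mem_cat => /orP[/ggs|/ggs'].
  rewrite -(@sum_subseq _ gs (undup (gs ++ gs'))) ?undup_uniq //; last first.
    by move=> g hg; rewrite mem_undup mem_cat hg.
  rewrite -(@sum_subseq _ gs' (undup (gs ++ gs'))) ?undup_uniq //; last first.
    by move=> g hg; rewrite mem_undup mem_cat hg orbT.
  rewrite -big_split /=; apply: eq_bigr => g _; rewrite (linD (t1 g)).
  by congr (_ + _); case: ifP => //; rewrite (lin0 (t1 g)).
move: t; apply: tensor_elim => // u v; have [s hs ->] := spanH u.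
rewrite (lin_sum (t2 v)) big_seq; elim/big_ind: _ => // p /hs gp.
exists [:: p.2], (fun=> p.1 *: v); split=> //.
  by move=> g; rewrite inE => /eqP ->.
by rewrite big_seq1 (linZ (t2 v)) (linZ (t1 _)).
Qed.

Lemma bilin_scale (M : lmodType K) (b : H -> K^o) : linear b ->
  bilin (fun h (m : M) => (b h : K) *: m).
Proof.
move=> lb; split=> [u|v] c x y; first by rewrite scalerDr !scalerA mulrC.
by rewrite lb scalerDl scalerA.
Qed.

(** Coassociativity equates the sums of h (x) h (x) w h and of h (x) lam (w h); contracting the
    first factor with the functional dual to g leaves g (x) w g = lam (w g). The counit axiom sums
    the w g to m. *)
Lemma weight_decomposition (M : lmodType K) (lam : M -> tensor H M) (m : M) :
  grouplike_spanned -> left_comodule lam ->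
  exists gs (w : H -> M), [/\ uniq gs, forall g, g \in gs -> grouplike g,
    forall g, g \in gs -> lam (w g) = tens g (w g) & m = \sum_(g <- gs) w g].
Proof.
move=> spanH [ll lA lcu]; have [gs [w [u ggs E]]] := weight_sumP (lam m) spanH.
have lc := @comul_linear K H; have le := @counit_linear K H.
exists gs, w; split=> //; last first.
  rewrite -[LHS]lcu E (lin_sum (tlift_linear (bilin_scale M le))).
  rewrite big_seq [RHS]big_seq; apply: eq_bigr => g /ggs[_ eg].
  by rewrite tlift_tens ?eg ?scale1r //; exact: bilin_scale.
move=> g hg; have [f lf fE] := grouplike_functional u ggs hg.
have bf : bilin (fun h (t : tensor H M) => (f h : K) *: t) by exact: (bilin_scale _ lf).
have := congr1 (tlift (fun h (t : tensor H M) => (f h : K) *: t)) (lA m).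
rewrite E (lin_sum (tmap_linear lc (@linear_id' K M))) (lin_sum (@tassoc_linear K H H M)).
rewrite (lin_sum (tmap_linear (@linear_id' K H) ll)) !(lin_sum (tlift_linear bf)).
have pick (F : H -> tensor H M) : \sum_(h <- gs) (f h : K) *: F h = F g.
  rewrite (bigD1_seq g) //= fE // eqxx scale1r big_seq_cond big1 ?addr0 //.
  by move=> h /andP[hh /negPf nh]; rewrite fE // eq_sym nh scale0r.
rewrite big_seq (eq_bigr (fun h => (f h : K) *: tens h (w h))) => [|h /ggs[dh _]].
  rewrite -big_seq pick (eq_bigr (fun h => (f h : K) *: lam (w h))) => [|h _].
    by rewrite pick.
  by rewrite tmap_tens // tlift_tens.
by rewrite tmap_tens // dh tassoc_tens tlift_tens.
Qed.
End Grouplikes.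

Lemma pairing_linear (K : fieldType) (A : hopfSuperAlgType K) i (a : A) :
  linear (fun v : lie A i => pairing v a).
Proof. by move=> c v w; rewrite /pairing linearP. Qed.

(** * Restriction to the even part and orthogonality of weight spaces *)

Section EvenRestriction.
Variables (K : fieldType) (GG : supergroup K).
Local Notation A := (coordAlg GG).
Local Notation H := (coordAlg (evenSub GG)).
Local Notation bar := (@evenRes K GG).

Lemma bar_linear : linear bar. Proof. exact: hpi_linear. Qed.
Lemma barM : {morph bar : x y / x * y}. Proof. exact: hpiM. Qed.
Lemma bar_comul a : comul (bar a) = tmap bar bar (comul a).
Proof. exact: qcomulE. Qed.
Lemma bar_counit a : counit (bar a) = counit a :> K.
Proof. exact: qcounitE. Qed.
Lemma bar_antipode a : antipode (bar a) = bar (antipode a).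
Proof. exact: qantipodeE. Qed.
Lemma bar_eq0 a : bar a = 0 <-> odd_ideal a.
Proof. by split=> [/hpiP|h]; rewrite ?subr0 //; apply/hpiP; rewrite subr0. Qed.
Lemma bar_surj (x : H) : exists a, x = bar a.
Proof. by exists (repr x); rewrite /evenRes hpi_repr. Qed.
Lemma bar_odd a : bar (spart true a) = 0.
Proof. by apply/bar_eq0; exact: spart_trueJ. Qed.
Lemma bar_parity a : bar (parity a) = bar a.
Proof.
rewrite /parity (linB bar_linear) bar_odd subr0 -[in RHS](spartD a).
by rewrite (linD bar_linear) bar_odd addr0.
Qed.

Lemma even_quotient_comm (x y : H) : x * y = y * x.
Proof.
have [a ->] := bar_surj x; rewrite -[a]spartD (linD bar_linear) bar_odd addr0.
have [b ->] := bar_surj y; rewrite -!barM.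
by rewrite even_comm.
Qed.

(** The coaction is specified on points in commutative algebras. The identity of K[G] is the generic
    point, so K[G] has to be given a commutative structure. *)
Definition evenComAlg : comAlgType K :=
  HB.pack_for (comAlgType K) H (GRing.PzRing_hasCommutativeMul.Build H even_quotient_comm).

Definition evenId : {lrmorphism H -> evenComAlg} := idfun.

Variable lam : oddLie GG -> tensor H (oddLie GG).
Hypothesis lamE : is_odd_coaction lam.

Lemma weight_spaceE g (v : oddLie GG) a : weight_space lam g v ->
  conv (antipode \o bar) (conv (scal (pairing v)) bar) a = (pairing v a : K) *: g.
Proof.
move=> wv; have lb := bar_linear; have lS := @antipode_linear K H.
have [lv _ _] := lieP v; have lc := @comul_linear K A.
have := lamE.2 _ evenId v a; rewrite /= wv tlift_tens => [->|]; last first.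
  split=> [h|w] c x y; last by rewrite scalerDr !scalerA mulrC.
  by rewrite (pairing_linear a) scalerDl scalerA.
have bvb : bilin (fun y z => (pairing v y : K) *: bar z).
  split=> [h|w] c x y; last by rewrite lv scalerDl scalerA.
  by rewrite lb scalerDr !scalerA mulrC.
have E x (t : tensor A A) :
    tlift (fun y z => antipode (bar x) * ((pairing v y : K) *: bar z)) t =
    antipode (bar x) * tlift (fun y z => (pairing v y : K) *: bar z) t.
  by rewrite (lin_tlift _ _ (@mulr_linear _ _ _)).
rewrite /sweedler3 (eq_tlift (g := fun x t => antipode (bar x) *
  tlift (fun y z => (pairing v y : K) *: bar z) t)) //.
rewrite tlift_tmap //; last first.
  apply: (bilin_mulo (f := antipode \o bar)); first exact: linear_o.
  exact: tlift_linear.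
by apply: eq_tlift => x y; rewrite conv_scall.
Qed.

(** The identity at the generic point, convolved on the left with [bar] to cancel its inverse. *)
Lemma weight_conv g (v : oddLie GG) : weight_space lam g v ->
  conv (scal (pairing v)) bar = fun a => conv bar (scal (pairing v)) a * g.
Proof.
move=> wv; have lb := bar_linear; have lS := @antipode_linear K H.
have [lv _ _] := lieP v; have lsv := @scal_linear K A H _ lv.
have E := funext (fun a => weight_spaceE a wv).
have Eb : conv bar (antipode \o bar) = scal (@counit K A).
  have -> : antipode \o bar = bar \o antipode by apply/funext => a; exact: bar_antipode.
  have := conv_rmorph id antipode lb barM; rewrite conv_antipoder => <-.
  by apply/funext => a; rewrite /= /scal (linZ lb).
have lSb : linear (antipode \o bar) by exact: linear_o.
have lvb := conv_linear lsv lb.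
rewrite -[LHS]conv1l // -Eb conv_assoc // E; apply/funext => a.
rewrite /conv (lin_tlift _ _ (@mull_linear _ _ g)); apply: eq_tlift => x y.
by rewrite /scal -mulrA -scalerAl mul1r.
Qed.

Lemma conv_weights g h (v w : oddLie GG) a : weight_space lam g v -> weight_space lam h w ->
  conv (scal (convol (pairing v) (pairing w))) bar a =
  conv bar (scal (convol (pairing v) (pairing w))) a * (g * h).
Proof.
move=> wv ww; have lb := bar_linear; have [lv _ _] := lieP v; have [lw _ _] := lieP w.
have lsv := @scal_linear K A H _ lv; have lsw := @scal_linear K A H _ lw.
rewrite -!conv_scal conv_assoc // (weight_conv ww).
have -> : conv (scal (pairing v)) (fun b => conv bar (scal (pairing w)) b * h) a =
    conv (scal (pairing v)) (conv bar (scal (pairing w))) a * h.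
  rewrite [RHS](lin_tlift _ _ (@mull_linear _ _ h)); apply: eq_tlift => x y.
  by rewrite mulrA.
rewrite -conv_assoc // (weight_conv wv) mulrA; congr (_ * h).
have -> : conv (fun b => conv bar (scal (pairing v)) b * g) (scal (pairing w)) a =
    conv (conv bar (scal (pairing v))) (scal (pairing w)) a * g.
  rewrite [RHS](lin_tlift _ _ (@mull_linear _ _ g)); apply: eq_tlift => x y.
  by rewrite /scal -!scalerAr !mulr1 scalerAl.
by rewrite conv_assoc.
Qed.

Lemma even_derivation_odd_ideal (d : A -> K^o) x :
  point_derivation false d -> odd_ideal x -> d x = 0.
Proof.
move=> [ld md pd] hx; suff [] : d x = 0 /\ counit x = 0 by [].
apply: (hx (fun x => d x = 0 /\ counit x = 0)) => [|y <-]; last first.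
  by rewrite counit_odd; split=> //; exact: pd.
have le := @counit_linear K A.
split=> [|y z [dy ey] [dz ez]|y z [dz ez]].
- by rewrite (lin0 ld) (lin0 le).
- by rewrite (linD ld) (linD le) dy dz ey ez !addr0.
by rewrite !md !counitM dz ez !mulr0 !mul0r addr0.
Qed.

Hypothesis diagG : even_diagonalizable GG.

(** The bracket d factors through K[G], where d * id is id * d multiplied by g h. On a grouplike b
    this reads d(b) b = d(b) b g h; b is invertible and g h <> 1, so d(b) = 0. Grouplikes span
    K[G]. *)
Lemma weight_bracket g h (v w : oddLie GG) :
  g * h <> 1 ->
  weight_space lam g v -> weight_space lam h w -> odd_bracket v w = 0.
Proof.
move=> gh1 wv ww; apply/val_inj/funext => a /=.
set d := lie_bracket_fun v w; have dd : point_derivation false d.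
  exact: (lieP (lie_bracket v w)).
have lb := bar_linear; have [ld md pd] := dd.
have dE b : d b = convol (pairing v) (pairing w) b + convol (pairing w) (pairing v) b.
  by rewrite /d /lie_bracket_fun mulN1r opprK.
have sd b : scal d b = scal (convol (pairing v) (pairing w)) b +
    scal (convol (pairing w) (pairing v)) b :> H.
  by rewrite /scal dE scalerDl.
have dconv b : conv (scal d) bar b = conv bar (scal d) b * (g * h).
  rewrite (funext sd) convDl convDr (conv_weights _ wv ww) (conv_weights _ ww wv).
  by rewrite [h * g]even_quotient_comm mulrDl.
pose d' (x : H) : K^o := d (repr x).
have d'E b : d' (bar b) = d b.
  apply/eqP; rewrite -subr_eq0 -(linB ld) (even_derivation_odd_ideal dd) //.
  exact: (@repr_hpi K A (oddIdeal A) b).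
have ld' : linear d'.
  move=> c x y; have [x' ->] := bar_surj x; have [y' ->] := bar_surj y.
  by rewrite -lb !d'E ld.
have dgl b : grouplike (bar b) -> d b = 0.
  move=> gb; have [db eb] := gb; have := dconv b.
  have lid := @linear_id' K H.
  have -> : conv (scal d) bar b = (d b : K) *: bar b.
    have bl : bilin (fun x y : H => (d' x : K) *: y).
      split=> [x|y] c z t; last by rewrite ld' scalerDl scalerA.
      by rewrite scalerDr !scalerA mulrC.
    rewrite -d'E -(tlift_tens (f := fun x y : H => (d' x : K) *: y)) // -db bar_comul.
    rewrite tlift_tmap // conv_scall; apply: eq_tlift => x y.
    by rewrite d'E.
  have -> : conv bar (scal d) b = (d b : K) *: bar b.
    have bl : bilin (fun x y : H => (d' y : K) *: x) by exact: bilin_slice.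
    rewrite -d'E -(tlift_tens (f := fun x y : H => (d' y : K) *: x)) // -db bar_comul.
    rewrite tlift_tmap //; apply: eq_tlift => x y.
    by rewrite d'E /scal -scalerAr mulr1.
  move=> /eqP; rewrite -scalerAl -subr_eq0 -scalerBr scaler_eq0 => /orP[/eqP //|].
  rewrite subr_eq0 => /eqP /(congr1 (fun x => antipode (bar b) * x)).
  have [Sb _] := grouplike_antipode gb.
  by rewrite mulrA Sb mul1r => /esym.
have [s hs E] := diagG (bar a).
have : d' (bar a) = 0.
  rewrite E (lin_sum ld') big_seq big1 // => p hp; rewrite (linZ ld').
  have [b pb] := bar_surj p.2; rewrite pb d'E dgl ?scaler0 // -pb; exact: hs.
by rewrite d'E.
Qed.

Lemma odd_bracketE (v w : oddLie GG) a : pairing (odd_bracket v w) a =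
  convol (pairing v) (pairing w) a + convol (pairing w) (pairing v) a.
Proof. by rewrite /pairing /= /lie_bracket_fun mulN1r opprK. Qed.

Lemma odd_bracketC (v w : oddLie GG) : odd_bracket v w = odd_bracket w v.
Proof.
apply/val_inj/funext => a; rewrite -[LHS]/(pairing (odd_bracket v w) a).
by rewrite odd_bracketE addrC -odd_bracketE.
Qed.

Lemma odd_bracket_linear (w : oddLie GG) : linear (fun v => odd_bracket v w).
Proof.
move=> c v v'; apply/val_inj/funext => a.
rewrite -[LHS]/(pairing (odd_bracket (c *: v + v') w) a).
rewrite -[RHS]/(pairing (c *: odd_bracket v w + odd_bracket v' w) a).
rewrite (pairing_linear a) !odd_bracketE /convol /tlift /formal_sum.
have -> : \sum_(p <- repr (comul a)) pairing (c *: v + v') p.1 * pairing w p.2 =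
    c * (\sum_(p <- repr (comul a)) pairing v p.1 * pairing w p.2) +
    \sum_(p <- repr (comul a)) pairing v' p.1 * pairing w p.2.
  rewrite mulr_sumr -big_split; apply: eq_bigr => p _.
  by rewrite (pairing_linear p.1) mulrDl -scalerAl.
have -> : \sum_(p <- repr (comul a)) pairing w p.1 * pairing (c *: v + v') p.2 =
    c * (\sum_(p <- repr (comul a)) pairing w p.1 * pairing v p.2) +
    \sum_(p <- repr (comul a)) pairing w p.1 * pairing v' p.2.
  rewrite mulr_sumr -big_split; apply: eq_bigr => p _.
  by rewrite (pairing_linear p.2) mulrDr -scalerAr.
by rewrite scalerDr addrACA.
Qed.

Lemma odd_weights (v : oddLie GG) :
  exists gs (f : H -> oddLie GG), [/\ uniq gs, forall g, g \in gs -> grouplike g,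
    forall g, g \in gs -> weight_space lam g (f g) & v = \sum_(g <- gs) f g].
Proof. exact: (weight_decomposition v diagG lamE.1). Qed.


Lemma grouplike_mul_eq1 (g h : H) : grouplike h -> g * h = 1 -> g = antipode h.
Proof.
by move=> /grouplike_antipode[_ hS] gh; rewrite -[LHS]mulr1 -hS mulrA gh mul1r.
Qed.

Lemma grouplike_antipode_inj (g h : H) : grouplike g -> grouplike h ->
  g * antipode h = 1 -> g = h.
Proof.
move=> gg /grouplike_antipode[Sh _] gSh.
by rewrite -[LHS]mulr1 -Sh mulrA gSh mul1r.
Qed.

Lemma odd_bracketDr (v : oddLie GG) gs (f : H -> oddLie GG) :
  odd_bracket v (\sum_(g <- gs) f g) = \sum_(g <- gs) odd_bracket v (f g).
Proof.
rewrite odd_bracketC (lin_sum (odd_bracket_linear v)).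
by apply: eq_bigr => g _; rewrite odd_bracketC.
Qed.

Lemma nondegenerate_weights :
  nondegenerate_pairing (@odd_bracket K GG) ->
  forall g : H, grouplike g ->
     nondegenerate_pairing_on (weight_space lam g) (weight_space lam (antipode g))
       (@odd_bracket K GG).
Proof.
move=> [nd _] g gg.
split=> [v wv h|w ww h]; apply: nd => // u _.
  have [gs [f [ugs ggs fw ->]]] := odd_weights u; rewrite odd_bracketDr.
  rewrite big_seq big1 // => k hk.
  have [gk1|/eqP gk1] := eqVneq (g * k) 1; last exact: weight_bracket wv (fw k hk).
  apply: h; rewrite -(@grouplike_mul_eq1 k g) //; first exact: fw.
  by rewrite even_quotient_comm.
have [gs [f [ugs ggs fw ->]]] := odd_weights u; rewrite odd_bracketDr.
rewrite big_seq big1 // => k hk; rewrite odd_bracketC.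
have [gk1|/eqP gk1] := eqVneq (k * antipode g) 1; last exact: weight_bracket (fw k hk) ww.
by apply: h; rewrite -(@grouplike_antipode_inj k g) //; [exact: fw|exact: ggs].
Qed.

Lemma odd_bracket_component (v w : oddLie GG) gs (f : H -> oddLie GG) g :
  uniq gs -> (forall k, k \in gs -> grouplike k) ->
  (forall k, k \in gs -> weight_space lam k (f k)) -> g \in gs ->
  weight_space lam (antipode g) w -> v = \sum_(k <- gs) f k ->
  odd_bracket v w = odd_bracket (f g) w.
Proof.
move=> ugs ggs fw hg ww ->; rewrite (lin_sum (odd_bracket_linear w)).
rewrite (bigD1_seq g) //= big_seq_cond big1 ?addr0 // => k /andP[hk nkg].
apply: weight_bracket (fw k hk) ww => kg.
by move/eqP: nkg; apply; apply: grouplike_antipode_inj => //; exact: ggs.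
Qed.

(** The component of weight g pairs nontrivially only with weight g^-1, and there it pairs as v
    does. *)
Lemma radical_component (v : oddLie GG) gs (f : H -> oddLie GG) g :
  uniq gs -> (forall k, k \in gs -> grouplike k) ->
  (forall k, k \in gs -> weight_space lam k (f k)) -> g \in gs ->
  v = \sum_(k <- gs) f k -> (forall w, odd_bracket v w = 0) ->
  forall w, odd_bracket (f g) w = 0.
Proof.
move=> ugs ggs fw hg vE hv w.
have [gs' [f' [ugs' ggs' fw' ->]]] := odd_weights w; rewrite odd_bracketDr.
rewrite big_seq big1 // => k hk.
have [gk1|/eqP gk1] := eqVneq (g * k) 1; last exact: weight_bracket (fw g hg) (fw' k hk).
rewrite -(odd_bracket_component ugs ggs fw hg _ vE) //.
rewrite -(@grouplike_mul_eq1 k g) //; [exact: fw'|exact: ggs|].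
by rewrite even_quotient_comm.
Qed.

Lemma weights_nondegenerate :
  (forall g : H, grouplike g -> (exists2 v, weight_space lam g v & v <> 0) ->
     nondegenerate_pairing_on (weight_space lam g) (weight_space lam (antipode g))
       (@odd_bracket K GG)) ->
  nondegenerate_pairing (@odd_bracket K GG).
Proof.
move=> nd; suff h (v : oddLie GG) : (forall w : oddLie GG, odd_bracket v w = 0) -> v = 0.
  split=> [v _ hv|w _ hw]; apply: h => u; first exact: hv.
  by rewrite odd_bracketC; exact: hw.
move=> hv; have [gs [f [ugs ggs fw vE]]] := odd_weights v.
rewrite vE big_seq big1 // => g hg; apply: contrapT => fg.
have [nd1 _] := nd g (ggs g hg) (ex_intro2 _ _ _ (fw g hg) fg).
by apply: fg; apply: nd1 (fw g hg) _ => w _; exact: (radical_component ugs ggs fw hg vE hv).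
Qed.
End EvenRestriction.

(** * Super-subgroups with one odd dimension *)

Section Supermodules.
Variables (K : fieldType) (GG : supergroup K).
Local Notation B := (coordAlg GG).

Lemma tpart_tens1 (M : superModType K) k (m : M) : tpart k (tens m (1 : B)) = tens (spart k m) 1.
Proof.
have [t1 t2] := bilin_tens M B.
rewrite /tpart big_bool !tmap_tens; try exact: spart_linear.
by case: k; rewrite /= !spart_one /= (lin0 (t1 _)) ?addr0 ?add0r.
Qed.

(** The invariant vectors form a sub-supermodule, so a simple M has trivial coaction; then the line
    of a homogeneous vector is a sub-supermodule. *)
Lemma unipotent_invariants :
  (forall (M : supermodule GG) (m : M), m <> 0 ->
     exists2 m' : M, m' <> 0 & coaction m' = tens m' 1) ->
  unipotent GG.
Proof.
move=> inv M [[m m0] simpleM]; have [t1 t2] := bilin_tens M B.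
have lc := @coaction_linear K GG M.
have triv (x : M) : coaction x = tens x 1.
  have [|h|h] := simpleM (fun x => coaction x = tens x 1); last exact: h.
    split=> [|c y z hy hz|i y hy|y hy].
    - by rewrite (lin0 lc) (lin0 (t2 _)).
    - by rewrite lc hy hz (t2 1).
    - by rewrite coaction_part hy tpart_tens1.
    - by rewrite hy; exact: tens_span_tens.
  by have [m' m'0 /h] := inv M m m0.
split=> //; have [i i0] : exists i, spart i m <> 0.
  apply: contrapT => h; apply: m0; rewrite -(spartD m).
  have z i : spart i m = 0 by apply: contrapT => hi; apply: h; exists i.
  by rewrite !z addr0.
exists (spart i m) => //.
have [|h|h] := simpleM (fun x => exists c : K, x = c *: spart i m); last exact: h.
  split=> [|c y z [a ->] [b ->]|j y [c ->]|y [c hy]].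
  - by exists 0; rewrite scale0r.
  - by exists (c * a + b); rewrite scalerDl scalerA.
  - exists (if j == i then c else 0); rewrite spartZ spartK.
    by case: eqP; rewrite ?scaler0 ?scale0r.
  - by rewrite triv; apply: tens_span_tens; exists c.
by case: i0; apply: h; exists 1; rewrite scale1r.
Qed.

(** Slices make M a module over the dual algebra of B, whose product is convolution. *)
Lemma slice_coaction (M : supermodule GG) (b b' : B -> K^o) (m : M) :
  linear b -> linear b' ->
  slice b' (coaction (slice b (coaction m))) = slice (convol b' b) (coaction m).
Proof.
move=> lb lb'; have lc := @coaction_linear K GG M; have lid := @linear_id' K M.
pose T (t : tensor B B) : K^o := tlift (fun x y => b' x * b y : K^o) t.
have lT : linear T by apply: tlift_linear; exact: bilin_mulK.
have E (t : tensor M B) :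
    slice b' (coaction (slice b t)) = slice T (tassoc (tmap (@coaction K GG M) id t)).
  have lid' := @linear_id' K B; have lta := @tassoc_linear K M B B.
  move: t; apply: tensor_ext.
  - exact: (linear_comp (linear_comp (slice_linear lb) lc) (slice_linear lb')).
  - exact: (linear_comp (tmap_linear lc lid') (linear_comp lta (slice_linear lT))).
  move=> x y; rewrite slice_tens // (linZ lc) (linZ (slice_linear lb')) tmap_tens //.
  move: (coaction x); apply: tensor_ext.
  - by move=> c s t; rewrite (slice_linear lb') scalerDr !scalerA mulrC.
  - exact: (linear_comp ((bilin_tens (tensor M B) B).2 y) (linear_comp lta (slice_linear lT))).
  move=> u v; rewrite tassoc_tens !slice_tens //.
  by rewrite /T tlift_tens ?scalerA 1?mulrC //; exact: bilin_mulK.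
rewrite E coactionA slice_tmap //; first exact: comul_linear.
Qed.

Lemma slice_counit (M : supermodule GG) (m : M) : slice (@counit K B) (coaction m) = m.
Proof. exact: coaction_counit. Qed.
End Supermodules.

Lemma superHom_parity (K : fieldType) (A B : superAlgType K) (f : superHom A B) x :
  f (parity x) = parity (f x).
Proof.
have lf : linear f by exact: linearP.
rewrite /parity.
have -> : f (spart false x - spart true x) = f (spart false x) - f (spart true x) by exact: (linB lf).
by rewrite !superHom_part.
Qed.

Section LineSubgroup.
Variables (K : fieldType) (GG : supergroup K).
Local Notation A := (coordAlg GG).
Variables (v : A -> K^o) (t : A).
Hypotheses (dv : point_derivation true v) (vv : forall a, convol v v a = 0).
Hypotheses (ot : spart true t = t) (vt : forall a, v a * v t = v a).
Let lv : linear v. Proof. by case: dv. Qed.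
Let le := @counit_linear K A.

(** Modulo this ideal the functions are spanned by 1 and t. The assumption v a * v t = v a covers
    both v t = 1, an odd line with tangent vector v, and v = 0, the trivial super-subgroup. *)
Definition line_ideal (x : A) : Prop := counit x = 0 /\ v x = 0.

Let et : counit t = 0. Proof. by rewrite -ot counit_odd. Qed.

Let p (a : A) : A := (counit a : K) *: 1 + (v a : K) *: t.

Lemma line_ideal_sub a : line_ideal (a - p a).
Proof.
rewrite /p; split.
  rewrite (linB le) (linD le) !(linZ le) et counit1 scaler0 addr0.
  by rewrite /GRing.scale /= mulr1 subrr.
rewrite (linB lv) (linD lv) !(linZ lv) (derivation1 dv) scaler0 add0r.
by rewrite /GRing.scale /= vt subrr.
Qed.

Lemma convol_counitl (f : A -> K^o) : linear f -> convol (@counit K A) f = f.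
Proof.
by move=> lf; have := @conv1l K A K^o f lf; rewrite scal_id.
Qed.
Lemma convol_counitr (f : A -> K^o) : linear f -> convol f (@counit K A) = f.
Proof.
by move=> lf; have := @conv1r K A K^o f lf; rewrite scal_id.
Qed.

(** Modulo the span in question [comul x] equals its image under p (x) p, whose coefficients on 1
    (x) 1, 1 (x) t, t (x) 1 and t (x) t are counit x, v x, v x and v*v at x, all zero. *)
Lemma line_comul x : line_ideal x ->
  tens_span (fun a b => line_ideal a \/ line_ideal b) (comul x).
Proof.
move=> [ex vx]; have [t1 t2] := bilin_tens A A.
have lp : linear p.
  by move=> c y z; rewrite /p le lv !scalerDl scalerDr !scalerA addrACA.
have pp0 : \sum_(q <- repr (comul x)) tens (p q.1) (p q.2) = 0.
  have E (a b : A) : tens (p a) (p b) =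
    (counit a * counit b : K) *: tens 1 1 + (counit a * v b : K) *: tens 1 t +
    ((v a * counit b : K) *: tens t 1 + (v a * v b : K) *: tens t t).
    rewrite /p (linD (t2 _)) !(linD (t1 _)) !(linZ (t1 _)) !(linZ (t2 _)) !scalerA.
    by congr (_ + _ + (_ + _)); rewrite mulrC.
  rewrite (eq_bigr _ (fun q _ => E q.1 q.2)) !big_split /= -!scaler_suml.
  rewrite -[X in X *: tens 1 1]/(convol (@counit K A) (@counit K A) x).
  rewrite -[X in X *: tens 1 t]/(convol (@counit K A) v x).
  rewrite -[X in X *: tens t 1]/(convol v (@counit K A) x).
  rewrite -[X in X *: tens t t]/(convol v v x).
  by rewrite !convol_counitl // convol_counitr // vv ex vx !scale0r !addr0.
have -> : comul x = \sum_(q <- repr (comul x)) (tens q.1 q.2 - tens (p q.1) (p q.2)).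
  by rewrite sumrB pp0 subr0 -tensorE.
apply: tens_span_sum => q _.
have -> : tens q.1 q.2 - tens (p q.1) (p q.2) =
    tens (q.1 - p q.1) q.2 + tens (p q.1) (q.2 - p q.2).
  by rewrite (linB (t2 _)) (linB (t1 _)) addrA subrK.
by apply: tens_spanD; apply: tens_span_tens; [left|right]; exact: line_ideal_sub.
Qed.

Definition lineIdeal : hopfIdeal A.
Proof.
apply: (@HopfIdeal K A line_ideal).
- by split; [exact: (lin0 le)|exact: (lin0 lv)].
- move=> c x y [ex vx] [ey vy].
  by split; [rewrite le ex ey|rewrite lv vx vy]; rewrite scaler0 addr0.
- case: dv => _ mv _ a x [ex vx].
  by split; [rewrite counitM ex mulr0|rewrite mv ex vx !mulr0 addr0].
- case: dv => _ mv _ a x [ex vx].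
  by split; [rewrite counitM ex mul0r|rewrite mv ex vx !mul0r addr0].
- move=> [] x [ex vx]; split; first exact: counit_odd.
  + by rewrite (odd_der_odd dv).
  + by rewrite counit_even.
  + by rewrite (odd_der_even dv).
- exact: line_comul.
- by move=> x [].
- move=> x [ex vx]; split; first by rewrite counit_antipode.
  by rewrite (derivation_antipode _ dv) vx oppr0.
Defined.

(** The coaction sends m to m (x) 1 + phi m (x) t, where phi is the action of v, and phi phi = 0
    because v*v = 0. So m or phi m is a nonzero invariant. *)
Lemma line_unipotent : unipotent (closedSub lineIdeal).
Proof.
apply: unipotent_invariants => M m m0.
pose B := coordAlg (closedSub lineIdeal); pose q : A -> B := hpi lineIdeal.
have lq : linear q by exact: hpi_linear.
pose vb (x : B) : K^o := v (repr x).
have vbE a : vb (q a) = v a.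
  have [_] : line_ideal (repr (q a) - a) by exact: (@repr_hpi K A lineIdeal a).
  by rewrite (linB lv) => /eqP; rewrite subr_eq0 => /eqP.
have lvb : linear vb.
  move=> c; elim/hopfQuot_ind => x; elim/hopfQuot_ind => y.
  by rewrite -[hpi _ x]/(q x) -[hpi _ y]/(q y) -lq !vbE lv.
have qE x : x = (counit x : K) *: 1 + (vb x : K) *: q t :> B.
  elim/hopfQuot_ind: x => a; rewrite -[hpi _ a]/(q a) vbE.
  have -> : counit (q a) = counit a by exact: qcounitE.
  rewrite -[1](hpi1 lineIdeal) -[hpi _ 1]/(q 1) -!(linZ lq) -(linD lq).
  exact/hpiP/line_ideal_sub.
have vbvb x : convol vb vb x = 0.
  elim/hopfQuot_ind: x => a; rewrite /convol.
  have -> : comul (hpi lineIdeal a : B) = tmap q q (comul a) by exact: qcomulE.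
  rewrite tlift_tmap //; last exact: bilin_mulK.
  by rewrite -[RHS](vv a); apply: eq_tlift => x y; rewrite !vbE.
have lc := @coaction_linear K _ M; have leB := @counit_linear K B.
have [t1 t2] := bilin_tens M B.
have cE (x : M) : coaction x = tens x 1 + tens (slice vb (coaction x)) (q t).
  rewrite -{2}(slice_counit x) {1}[coaction x]tensorE /slice /tlift /formal_sum.
  rewrite (lin_sum (t2 _)) (lin_sum (t2 _)) -big_split /=; apply: eq_bigr => z _.
  rewrite [X in tens _ X]qE (linD (t1 _)) !(linZ (t1 _)) !(linZ (t2 _)).
  by [].
have [phi0|phi0] := pselect (slice vb (coaction m) = 0).
  by exists m => //; rewrite cE phi0 (lin0 (t2 _)) addr0.
exists (slice vb (coaction m)) => //; rewrite {1}cE slice_coaction //.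
rewrite [X in tens X (q t)](_ : _ = 0) ?(lin0 (t2 _)) ?addr0 //.
by apply: big1 => z _; rewrite vbvb scale0r.
Qed.

(** A point n of the subgroup is counit + v n(t), so its conjugate by g takes a to counit a + n(t)
    g(adj v a). *)
Lemma line_normal : (forall a, v a = 0 -> adj v a = 0) -> normal_supersub lineIdeal.
Proof.
move=> adj0 R g n hn a [ea va].
have lg : linear g by exact: linearP.
have ln : linear n by exact: linearP.
have lS := @antipode_linear K A; have lsv := @scal_linear K A A _ lv.
have nE x : n x = (counit x : K) *: 1 + (v x : K) *: n t.
  have := hn _ (line_ideal_sub x); rewrite (linB ln) (linD ln) !(linZ ln) rmorph1.
  by move=> /eqP; rewrite subr_eq0 => /eqP.
have on : spart true (n t) = n t by rewrite -superHom_part ot.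
have lgS := linear_o lS lg.
rewrite -[point_mul _ _ _]/(conv (conv (g \o antipode) n) g a) conv_assoc //.
have E1 : conv n g = fun x => g x + n t * g (lder v x).
  have gE x : g x = g (conv (scal (@counit K A)) id x) by rewrite conv1l.
  apply/funext => x; rewrite [X in _ = X + _]gE.
  rewrite /lder /conv !(lin_tlift _ _ lg) (lin_tlift _ _ (@mulr_linear _ _ _)).
  rewrite /tlift /formal_sum -big_split; apply: eq_bigr => z _ /=.
  rewrite nE mulrDl /scal -!scalerAl !mul1r !(linZ lg) -scalerAr; congr (_ + _).
rewrite E1 convDr.
have -> : conv (g \o antipode) g a = 0.
  transitivity ((g \o conv antipode id) a).
    by rewrite conv_rmorph //; exact: rmorphM.
  by rewrite conv_antipodel /= /scal ea scale0r (lin0 lg).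
have -> : conv (g \o antipode) (fun x => n t * g (lder v x)) a = n t * g (adj v a).
  rewrite /adj /conv (lin_tlift _ _ lg) (lin_tlift _ _ (@mulr_linear _ _ _)).
  apply: eq_tlift => x y /=; rewrite rmorphM mulrA mulrA; congr (_ * _).
  rewrite -[g (antipode x)]parityK -odd_comm //; congr (_ * _).
  rewrite antipode_parity; exact: (esym (superHom_parity g (antipode x))).
by rewrite adj0 // (lin0 lg) mulr0 addr0.
Qed.
End LineSubgroup.

(** * From a degenerate bracket to a normal unipotent super-subgroup *)

Section RadicalOfBracket.
Variables (K : fieldType) (char2 : 2%N \notin [pchar K]) (GG : supergroup K).
Local Notation A := (coordAlg GG).
Local Notation H := (coordAlg (evenSub GG)).
Variable lam : oddLie GG -> tensor H (oddLie GG).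
Hypotheses (lamE : is_odd_coaction lam) (diagG : even_diagonalizable GG).

Lemma oddLie_of (u : A -> K^o) : point_derivation true u ->
  exists u' : oddLie GG, pairing u' = u.
Proof. by move=> du; exists (exist _ u (asboolT du)). Qed.

(** Since v has weight g, the image of [adj v a] under [bar] is v(a) g = 0; so [adj v a] lies in
    J. *)
Lemma adj_radical g (v : oddLie GG) a : weight_space lam g v ->
  (forall w, odd_bracket v w = 0) -> pairing v a = 0 -> adj (pairing v) a = 0.
Proof.
move=> wv hv va; have lb := @bar_linear K GG; have dv := lieP v; have [lv _ _] := dv.
apply: (lder_injective char2 (coord_fg GG)) => [|u du].
  apply/(@bar_eq0 K GG); rewrite -[LHS]/((@evenRes K GG \o adj _) a) /adj.
  rewrite !(conv_rmorph _ _ lb (@barM K GG)).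
  have E1 : @evenRes K GG \o (antipode \o @parity K A) = antipode \o @evenRes K GG.
    by apply/funext => x; rewrite /= -bar_antipode bar_parity.
  have E2 : @evenRes K GG \o scal (pairing v) = scal (pairing v).
    by apply/funext => x; rewrite /= /scal (linZ lb).
  by rewrite E1 E2 (weight_spaceE lamE a wv) va scale0r.
apply: lder_adj => // b; have [u' <-] := oddLie_of du.
by rewrite -odd_bracketE odd_bracketC hv.
Qed.

Lemma super_diagonalizable_nondegenerate :
  super_diagonalizable GG -> nondegenerate_pairing (@odd_bracket K GG).
Proof.
move=> [_ [U [[_ _ Umax] Utriv]]].
suff h (v : oddLie GG) : (forall w : oddLie GG, odd_bracket v w = 0) -> v = 0.
  split=> [v _ hv|w _ hw]; apply: h => u; first exact: hv.
  by rewrite odd_bracketC; exact: hw.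
move=> hv; have [gs [f [ugs ggs fw vE]]] := odd_weights lamE diagG v.
rewrite vE big_seq big1 // => g hg; set u := f g.
have hu : forall w, odd_bracket u w = 0.
  exact: (radical_component lamE diagG ugs ggs fw hg vE hv).
apply: contrapT => u0.
have [a ua] : exists a, pairing u a != 0.
  apply: contrapT => h; apply: u0; apply/val_inj/funext => a.
  by apply: contrapT => /eqP ua; apply: h; exists a.
have du := lieP u; have [lu _ _] := du.
pose t : A := ((pairing u a)^-1 : K) *: spart true a.
have ot : spart true t = t by rewrite spartZ spart_id.
have ut : pairing u t = 1.
  by rewrite /t (linZ lu) (odd_der_odd du) /GRing.scale /= mulVf.
have uut b : pairing u b * pairing u t = pairing u b by rewrite ut mulr1.
(* Here [u, u] = 2 u*u, and 2 is invertible. *)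
have uu b : convol (pairing u) (pairing u) b = 0.
  have := odd_bracketE u u b; rewrite hu => /eqP; rewrite eq_sym.
  rewrite -mulr2n -scaler_nat scaler_eq0 => /orP[|/eqP //].
  by have := char2; rewrite !inE /= => /negP.
(* As U is the whole augmentation ideal, maximality puts a - counit a in the line ideal, which
   contradicts the choice of a. *)
have [] := Umax (lineIdeal du uu ot uut) _ _ (a - (counit a : K) *: 1).
- by apply: line_normal => b; exact: (adj_radical (fw g hg) hu).
- exact: line_unipotent.
- apply/Utriv; rewrite (linB (@counit_linear _ _)) (linZ (@counit_linear _ _)) counit1.
  by rewrite /GRing.scale /= mulr1 subrr.
move=> _; rewrite (linB lu) (linZ lu) (derivation1 du) scaler0 subr0 => ua0.
by rewrite ua0 eqxx in ua.
Qed.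
End RadicalOfBracket.

(** * Normal unipotent super-subgroups *)

Section FiniteDimension.
Variables (K : fieldType) (U : lmodType K).

Lemma subspace_cap (P Q : U -> Prop) : subspace P -> subspace Q ->
  subspace (fun x => P x /\ Q x).
Proof.
move=> sP sQ; split; first by split; exact: subspace0.
move=> c x y [px qx] [py qy]; split; first by case: sP => _; apply.
by case: sQ => _; apply.
Qed.

(** If P is not contained in the span of the tail, a vector [x0] of P outside it replaces y, and P
    is the sum of the line of [x0] and of the part of P in the span of the tail. *)
Lemma lspan_subspace_dim (s : seq U) (P : U -> Prop) : subspace P ->
  (forall x, P x -> lspan s x) ->
  (forall x, lspan s x -> P x) \/
  exists s', (size s' < size s)%N /\ forall x, P x <-> lspan s' x.
Proof.
elim: s P => [|y s IH] P sP sub.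
  by left => x /= ->; exact: subspace0.
have sL := lspan_subspace s.
pose Q x := P x /\ lspan s x.
have sQ : subspace Q by exact: subspace_cap.
have [PL|nPL] := pselect (forall x, P x -> lspan s x).
  right; have [sLP|[s' [lt E]]] := IH P sP PL.
    by exists s; split=> // x; split; [exact: PL|exact: sLP].
  by exists s'; split=> //; exact: ltnW.
have [x0 [Px0 nLx0]] : exists x0, P x0 /\ ~ lspan s x0.
  apply: contrapT => h; apply: nPL => x Px; apply: contrapT => nx.
  by apply: h; exists x.
have [c0 hc0] := sub x0 Px0.
have c00 : c0 != 0 by apply/eqP => c0E; apply: nLx0; move: hc0; rewrite c0E scale0r subr0.
have red x : P x -> exists c, Q (x - c *: x0).
  move=> Px; have [c hc] := sub x Px; exists (c / c0); split.
    by apply: (subspaceB sP) => //; exact: subspaceZ.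
  have -> : x - (c / c0) *: x0 = (x - c *: y) - (c / c0) *: (x0 - c0 *: y).
    by rewrite scalerBr scalerA divfK // opprB addrA subrK.
  by apply: (subspaceB sL) => //; exact: subspaceZ.
have [LQ|[s' [lt E]]] := IH Q sQ (fun x h => h.2).
  left=> x [c hc].
  have Py : P y.
    have -> : y = c0^-1 *: (x0 - (x0 - c0 *: y)).
      by rewrite opprB addrC subrK scalerA mulVf // scale1r.
    apply: (subspaceZ sP); apply: (subspaceB sP) => //.
    by case: (LQ _ hc0).
  by rewrite -[x](subrK (c *: y)); apply: (subspaceD sP); [case: (LQ _ hc)|exact: subspaceZ].
right; exists (x0 :: s'); split=> // x; split=> [/red[c hc]|[c hc]].
  by exists c; apply/E.
have [Px _] := (E _).2 hc.
by rewrite -[x](subrK (c *: x0)); apply: (subspaceD sP) => //; exact: subspaceZ.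
Qed.

(** A proper subspace in the family has a strictly shorter spanning list, so the descent stops. *)
Lemma minimal_subspace (Phi : (U -> Prop) -> Prop) (s : seq U) (P : U -> Prop) :
  (forall Q, Phi Q -> subspace Q) -> Phi P -> (forall x, P x -> lspan s x) ->
  exists2 S, Phi S & (forall x, S x -> P x) /\
    forall Q, Phi Q -> (forall x, Q x -> S x) -> forall x, S x -> Q x.
Proof.
move=> Phis; have [n] := ubnP (size s); elim: n s P => // n IH s P.
rewrite ltnS => sz PP PL.
have [mini|nmin] := pselect (forall Q, Phi Q -> (forall x, Q x -> P x) -> forall x, P x -> Q x).
  by exists P.
have [Q [PQ QP nPQ]] : exists Q, [/\ Phi Q, forall x, Q x -> P x & ~ forall x, P x -> Q x].
  apply: contrapT => h; apply: nmin => Q PQ QP; apply: contrapT => nPQ.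
  by apply: h; exists Q.
have [LQ|[s' [lt E]]] := lspan_subspace_dim (Phis _ PQ) (fun x h => PL x (QP x h)).
  by case: nPQ => x /PL/LQ.
have [S PS [SQ minS]] := IH s' Q (leq_trans lt sz) PQ (fun x h => (E x).1 h).
by exists S => //; split=> // x /SQ/QP.
Qed.
End FiniteDimension.

(** * Sub-supermodules as supermodules in their own right *)

Section SubSupermodule.
Variables (K : fieldType) (GG : supergroup K) (M : supermodule GG).
Local Notation B := (coordAlg GG).

Lemma sub_supermodule_subspace (W : M -> Prop) : sub_supermodule W -> subspace W.
Proof. by case. Qed.

Variables (S : M -> Prop) (hS : sub_supermodule S).

(** The proof of stability is an argument so that the closure instances can depend on it. *)
Definition subsmod_pred of sub_supermodule S : {pred M} := fun x => `[< S x >].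

Fact subsmod_closed : submod_closed (subsmod_pred hS).
Proof.
have [S0 SD _ _] := hS; split; first exact/asboolP.
by move=> c x y /asboolP hx /asboolP hy; apply/asboolP; exact: SD.
Qed.
HB.instance Definition _ :=
  GRing.isSubmodClosed.Build K M (subsmod_pred hS) subsmod_closed.

Definition subsmod := {x : M | x \in subsmod_pred hS}.
HB.instance Definition _ := [isSub of subsmod for sval].
HB.instance Definition _ := [Choice of subsmod by <:].
HB.instance Definition _ := [SubChoice_isSubLmodule of subsmod by <:].

Let valS (x : subsmod) : M := val x.
Let valS_linear : linear valS. Proof. by move=> c x y; rewrite /valS linearP. Qed.
Let valSP x : S (valS x). Proof. by have /asboolP := valP x. Qed.
Let valS_inj : injective valS. Proof. exact: val_inj. Qed.
Let mkS x (h : S x) : subsmod := Sub x (asboolT h).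

Fact subsmod_spartP i x : S (spart i (valS x)).
Proof. by have [_ _ h _] := hS; apply: h; exact: valSP. Qed.
Let spartS i x : subsmod := mkS (subsmod_spartP i x).
Fact subsmod_spart_linear i : linear (spartS i).
Proof.
move=> c x y; apply: valS_inj; rewrite valS_linear /=.
by rewrite -[LHS]/(spart i (valS (c *: x + y))) valS_linear spart_linear.
Qed.
Fact subsmod_spartD x : spartS false x + spartS true x = x.
Proof.
apply: valS_inj; rewrite (linD valS_linear); exact: (spartD (valS x)).
Qed.
Fact subsmod_spartK i j x : spartS i (spartS j x) = if i == j then spartS j x else 0.
Proof.
apply: valS_inj; rewrite (fun_if valS) (lin0 valS_linear); exact: spartK.
Qed.
HB.instance Definition _ := isSuperModule.Build K subsmod
  subsmod_spart_linear subsmod_spartD subsmod_spartK.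

Lemma subsmod_retraction : exists2 r : M -> subsmod, linear r & cancel valS r.
Proof.
have [p [lp Sp pS]] := projection (sub_supermodule_subspace hS).
exists (fun x => mkS (Sp x)) => [c x y|x]; apply: valS_inj; last exact: pS.
by rewrite valS_linear; exact: lp.
Qed.

(** The retraction is only linear, but every slice of the coaction of an element of S lies in S,
    where the retraction inverts the inclusion. *)
Lemma subsmod_coaction : exists2 co : subsmod -> tensor subsmod B, linear co &
  forall x, tmap valS id (co x) = coaction (valS x).
Proof.
have [r lr rK] := subsmod_retraction; have lid := @linear_id' K B.
have lc := @coaction_linear K GG M.
exists (fun x => tmap r id (coaction (valS x))) => [|x].
  exact: (linear_comp valS_linear (linear_comp lc (tmap_linear lr lid))).
apply: tensor_slice_ext => b lb; rewrite !slice_tmap //.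
have h : S (slice b (coaction (valS x))).
  apply: slice_span => //; first exact: sub_supermodule_subspace.
  by case: (hS) => _ _ _; apply; exact: valSP.
by rewrite -[X in valS (r X)]/(valS (mkS h)) rK.
Qed.

(** The inclusion splits linearly and so stays injective after tensoring; this lets the comodule
    axioms be checked in M. *)
Lemma tmap_val_inj (V : lmodType K) : injective (@tmap K subsmod V M V valS id).
Proof.
have [r lr rK] := subsmod_retraction; have lid := @linear_id' K V.
move=> s t /(congr1 (tmap r id)); rewrite !tmap_comp //.
have E (u : tensor subsmod V) : tmap (fun x => r (valS x)) id u = u.
  by rewrite [RHS]tensorE; apply: eq_bigr => p _; rewrite rK.
by rewrite !E.
Qed.

Lemma subsmod_supermodule : exists M' : supermodule GG, exists f : M' -> M,
  [/\ linear f, injective f, forall i x, f (spart i x) = spart i (f x),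
      forall m, S m <-> exists x, f x = m & forall x, tmap f id (coaction x) = coaction (f x)].
Proof.
have [co lco coE] := subsmod_coaction.
have lid V := @linear_id' K V; have lc := @coaction_linear K GG M.
have lD := @comul_linear K B.
have copart k x : co (spart k x) = tpart k (co x).
  apply: tmap_val_inj; rewrite coE -[valS _]/(spart k (valS x)) coaction_part -coE.
  by rewrite tmap_tpart.
have coA x : tassoc (tmap co id (co x)) = tmap id comul (co x).
  apply: (@tmap_val_inj (tensor B B)).
  have E (t : tensor (tensor subsmod B) B) : tmap valS id (tassoc t) =
      tassoc (tmap (tmap valS id) id t).
    have <- : tmap id id = id :> (tensor B B -> tensor B B).
      by apply/funext => u; rewrite [RHS]tensorE.
    by rewrite -tmap_tassoc.
  rewrite E !tmap_comp //; last exact: tmap_linear.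
  have -> : (fun u => tmap valS id (co u)) = (fun u => coaction (valS u)).
    by apply/funext.
  rewrite -(tmap_comp (f := valS) (g := id) (f' := @coaction K GG M) (g' := id)) //.
  rewrite coE coactionA -coE tmap_comp //.
have cocounit x : tlift (fun (y : subsmod) (a : B) => (counit a : K) *: y) (co x) = x.
  apply: valS_inj; rewrite (lin_tlift _ _ valS_linear) -[RHS]coaction_counit -coE.
  rewrite tlift_tmap //; last by apply: bilin_slice; exact: counit_linear.
exists (Supermodule lco copart coA cocounit), valS; split=> //.
move=> m; split=> [hm|[x <-]]; last exact: valSP.
by exists (mkS hm).
Qed.
End SubSupermodule.

(** * Local finiteness and invariant vectors of unipotent supergroups *)

Section Invariants.
Variables (K : fieldType) (GG : supergroup K).
Local Notation B := (coordAlg GG).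

(** In a tensor of total parity i, left factors of parity k are paired with right factors of parity
    i + k. *)
Lemma slice_tpart (M : superModType K) (b : B -> K^o) k i (t : tensor M B) : linear b ->
  spart k (slice b (tpart i t)) = slice (b \o spart (i (+) k)) (tpart i t).
Proof.
move=> lb; have lid V := @linear_id' K V; have ls V j := @spart_linear K V j.
have lbs j : linear (b \o @spart K B j) by exact: (linear_o (spart_linear j) lb).
have E j : slice b (tmap (@spart K M j) (@spart K B (j (+) i)) t) =
    spart j (slice (b \o spart (j (+) i)) t).
  exact: (slice_tmap _ (ls _ _) (ls _ _) lb).
rewrite addbC /tpart (lin_sum (slice_linear lb)) (lin_sum (slice_linear (lbs _))) (lin_sum (ls _ _)).
apply: eq_bigr => j _; rewrite E (slice_tmap _ (ls _ _) (ls _ _) (lbs _)) spartK.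
rewrite /slice /=; have [<-|nkj] := eqVneq k j.
  by congr (spart k _); apply: eq_tlift => x y /=; rewrite spart_id.
rewrite (_ : tlift _ _ = 0) ?(lin0 (ls _ _)) //.
apply: big1 => p _; rewrite spartK (_ : _ == _ = false) ?(lin0 lb) ?scale0r //.
by move: nkj; case: (i) (j) (k) => -[] [].
Qed.

(** The slices of [coaction m] form the orbit of m under the dual algebra, inside the span of
    finitely many left factors. Homogeneity of m makes the orbit stable under the grading. *)
Lemma orbit_supermodule (M : supermodule GG) (P : M -> Prop) m i :
  sub_supermodule P -> P m -> m <> 0 -> spart i m = m ->
  exists2 Q : M -> Prop, [/\ sub_supermodule Q, Q m & forall x, Q x -> P x] &
    exists s, forall x, Q x -> lspan s x.
Proof.
move=> hP Pm m0 mi; have sP := sub_supermodule_subspace hP.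
have lc := @coaction_linear K GG M.
pose Q (x : M) := exists2 b : B -> K^o, linear b & x = slice b (coaction m).
have memQ b : linear b -> Q (slice b (coaction m)) by move=> lb; exists b.
exists Q; last first.
  exists (map fst (repr (coaction m))) => _ [b lb ->].
  rewrite [X in slice b X]tensorE (lin_sum (slice_linear lb)) big_seq.
  apply: (subspace_sum (lspan_subspace _)) => p hp; rewrite slice_tens //.
  apply: (subspaceZ (lspan_subspace _)).
  by apply: lspan_mem; exact: map_f.
have sQ : subspace Q.
  split.
    exists (fun=> 0); first by move=> c x y; rewrite scaler0 addr0.
    by apply/esym/big1 => p _; rewrite scale0r.
  move=> c _ _ [b lb ->] [b' lb' ->]; exists (fun y => c *: b y + b' y).
    by move=> d x y; rewrite lb lb' !scalerDr !scalerA mulrC addrACA.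
  rewrite /slice /tlift /formal_sum scaler_sumr -big_split; apply: eq_bigr => p _.
  by rewrite /= scalerDl scalerA.
split.
- case: (sQ) => Q0 QD; split=> // [k _ [b lb ->]|_ [b lb ->]].
    rewrite -mi coaction_part slice_tpart // -coaction_part mi; apply: memQ.
    exact: (linear_o (spart_linear _) lb).
  apply: tens_span_slice => // b' lb'; rewrite slice_coaction //; apply: memQ.
  exact: (linear_comp (@comul_linear K B) (tlift_linear (bilin_mulK lb' lb))).
- by exists (@counit K B); [exact: counit_linear|rewrite slice_counit].
move=> _ [b lb ->]; apply: slice_span => //.
by case: hP => _ _ _; apply.
Qed.

(** A minimal nonzero sub-supermodule of the finite-dimensional orbit is simple, hence trivial. *)
Lemma unipotent_invariant_vector (M : supermodule GG) (P : M -> Prop) m :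
  unipotent GG -> sub_supermodule P -> P m -> m <> 0 ->
  exists x, [/\ P x, x <> 0 & coaction x = tens x 1].
Proof.
move=> uniG hP Pm m0.
have [i mi0] : exists i, spart i m <> 0.
  apply: contrapT => h; apply: m0; rewrite -(spartD m).
  have z i : spart i m = 0 by apply: contrapT => hi; apply: h; exists i.
  by rewrite !z addr0.
have Pmi : P (spart i m) by case: hP => _ _ h _; exact: h.
have [Q [hQ Qm QP] [s Qs]] := orbit_supermodule hP Pmi mi0 (spart_id i m).
pose Phi (W : M -> Prop) := sub_supermodule W /\ exists2 x, W x & x <> 0.
have PhiQ : Phi Q by split=> //; exists (spart i m).
have Phis W : Phi W -> subspace W by case=> /sub_supermodule_subspace.
have [S [hS [x0 Sx0 x00]] [SQ minS]] := minimal_subspace Phis PhiQ Qs.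
have [M' [f [lf injf fpart fS fco]]] := subsmod_supermodule hS.
have simple : simple_supermodule M'.
  have [y0 y0E] := (fS x0).1 Sx0.
  split; first by exists y0 => y00; apply: x00; rewrite -y0E y00 (lin0 lf).
  move=> W [W0 WD Wp Wc].
  have [nW|W0'] := pselect (exists2 y, W y & y <> 0); last first.
    by left=> y Wy; apply: contrapT => y1; apply: W0'; exists y.
  right=> y; pose fW x := exists2 z, W z & f z = x.
  have PhifW : Phi fW.
    split; last first.
      have [z Wz z0] := nW; exists (f z); first by exists z.
      by move=> fz0; apply: z0; apply: injf; rewrite fz0 (lin0 lf).
    split=> [|c _ _ [u Wu <-] [u' Wu' <-]|k _ [u Wu <-]|_ [u Wu <-]].
    - by exists 0; rewrite ?(lin0 lf).
    - by exists (c *: u + u'); [exact: WD|rewrite lf].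
    - by exists (spart k u); [exact: Wp|rewrite fpart].
    have [r hr rE] := Wc u Wu; rewrite -fco rE.
    rewrite (lin_sum (tmap_linear lf (@linear_id' K B))) big_seq.
    apply: tens_span_sum => p /hr hp; rewrite tmap_tens //.
    by apply: tens_span_tens; exists p.1.
  have fWS x : fW x -> S x by move=> [z _ <-]; apply/fS; exists z.
  have [z Wz /injf <- //] := minS fW PhifW fWS (f y) ((fS (f y)).2 (ex_intro _ y erefl)).
have [_ triv] := uniG M' simple.
have [y0 y0E] := (fS x0).1 Sx0.
exists x0; split=> //; first exact/QP/SQ.
by rewrite -y0E -fco triv tmap_tens.
Qed.
End Invariants.

(** * Triviality of the even part of a unipotent even-diagonalizable supergroup *)

Section UnipotentEvenPart.
Variables (K : fieldType) (GG : supergroup K).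
Local Notation B := (coordAlg GG).
Local Notation H := (coordAlg (evenSub GG)).
Local Notation bar := (@evenRes K GG).

Definition regular_supermodule : supermodule GG :=
  @Supermodule K GG B comul (@comul_linear K B) (@comul_part K B) (@comulA K B)
    (@comul_counitr K B).

Definition left_restriction (b : B) : tensor H B := tmap bar id (comul b).

Lemma left_restriction_comodule : left_comodule left_restriction.
Proof.
have lb := @bar_linear K GG; have lc := @comul_linear K B; have lid (V : lmodType K) := @linear_id' K V.
have lH := @comul_linear K H.
have ll : linear left_restriction by exact: (linear_comp lc (tmap_linear lb (lid _))).
split=> // m.
  rewrite /left_restriction !tmap_comp //.
  have -> : tmap (fun u => comul (bar u)) id (comul m) =
      tmap (tmap bar bar) id (tmap comul id (comul m)).
    rewrite tmap_comp //; last exact: tmap_linear.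
    by apply: eq_bigr => p _; rewrite bar_comul.
  rewrite -tmap_tassoc // comulA tmap_comp //; last exact: tmap_linear.
rewrite /left_restriction tlift_tmap //; last first.
  by apply: (bilin_scale B); exact: counit_linear.
rewrite -[RHS](comul_counitl m); apply: eq_bigr => p _.
by rewrite bar_counit.
Qed.

Definition left_weight (g : H) (b : B) : Prop := left_restriction b = tens g b.

(** By coassociativity left restriction commutes with the right regular coaction. *)
Lemma left_weight_supermodule g :
  @sub_supermodule K GG regular_supermodule (left_weight g).
Proof.
have lb := @bar_linear K GG; have lc := @comul_linear K B; have lid (V : lmodType K) := @linear_id' K V.
have [ll _ _] := left_restriction_comodule; have [t1 t2] := bilin_tens H B.
have sW : subspace (left_weight g).
  split; first by rewrite /left_weight (lin0 ll) (lin0 (t1 _)).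
  by move=> c x y hx hy; rewrite /left_weight ll hx hy (t1 g).
case: (sW) => W0 WD; split=> // [i x hx|x hx].
  rewrite /left_weight /left_restriction -[spart i x]/(spart i (x : B)) comul_part.
  have lspart := @spart_linear K B.
  have -> : tmap bar id (tpart i (comul x)) = tmap id (spart i) (left_restriction x).
    rewrite /left_restriction tmap_comp // /tpart (lin_sum (tmap_linear lb (lid _))) big_bool.
    rewrite !tmap_comp //= addrC -[RHS]addr0; congr (_ + _).
      apply: eq_bigr => p _; congr tens; rewrite -[in RHS](spartD p.1) (linD lb).
      by rewrite bar_odd addr0.
    by apply: big1 => p _; rewrite bar_odd (lin0 (t2 _)).
  by rewrite hx tmap_tens.
apply: tens_span_slice => // b lbb; rewrite /left_weight /left_restriction.
have E (t : tensor B B) : tmap bar id (comul (slice b t)) =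
    tmap bar (slice b) (tassoc (tmap comul id t)).
  have lsb := @slice_linear K B B b lbb; have lta := @tassoc_linear K B B B.
  move: t; apply: tensor_ext.
  - exact: (linear_comp lsb (linear_comp lc (tmap_linear lb (lid B)))).
  - exact: (linear_comp (tmap_linear lc (lid B)) (linear_comp lta (tmap_linear lb lsb))).
  move=> u v; rewrite slice_tens // (linZ lc) (linZ (tmap_linear lb (lid B))) tmap_tens //.
  move: (comul u); apply: tensor_ext.
  - by move=> c s t; rewrite (tmap_linear lb (lid B)) scalerDr !scalerA mulrC.
  - exact: (linear_comp ((bilin_tens (tensor B B) B).2 v) (linear_comp lta (tmap_linear lb lsb))).
  by move=> y z; rewrite tassoc_tens !tmap_tens // slice_tens // (linZ (t1 _)).
have lsb := @slice_linear K B B b lbb.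
rewrite E comulA tmap_comp //.
have -> : tmap bar (fun v => slice b (comul v)) (comul x) =
    tmap id (fun v => slice b (comul v)) (left_restriction x).
  by rewrite tmap_comp //; exact: (linear_comp lc lsb).
rewrite hx tmap_tens //; exact: (linear_comp lc lsb).
Qed.

Hypotheses (uniG : unipotent GG) (diagG : even_diagonalizable GG).

Lemma bar_weight g (b : B) : left_weight g b -> bar b = (counit b : K) *: g.
Proof.
move=> /(congr1 (slice (@counit K B))).
have lb := @bar_linear K GG; have le := @counit_linear K B.
rewrite slice_tens // /left_restriction slice_tmap // => <-.
by rewrite -[in LHS](comul_counitr b).
Qed.

(** The component of left weight g in a lift of g is nonzero because grouplikes are independent.
    Invariants of the right regular coaction are constants, and a nonzero constant of left weight g
    forces g = 1. *)
Lemma unipotent_grouplike_eq1 (g : H) : grouplike g -> g = 1.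
Proof.
move=> gg; have [b gE] := bar_surj g; have lb := @bar_linear K GG.
have [gs [w [ugs ggs ww bE]]] := weight_decomposition b diagG left_restriction_comodule.
have gsum : g = \sum_(k <- gs) (counit (w k) : K) *: k.
  rewrite gE bE (lin_sum lb) big_seq [RHS]big_seq; apply: eq_bigr => k hk.
  exact: bar_weight (ww k hk).
have gin : g \in gs.
  apply: contrapT => /negP gout; apply: (grouplike_independent ugs ggs gg gout).
  rewrite gsum big_seq; apply: (subspace_sum (lspan_subspace _)) => k hk.
  by apply: (subspaceZ (lspan_subspace _)); exact: lspan_mem.
have wg0 : w g <> 0.
  move=> wg0; have [f lf fE] := grouplike_functional ugs ggs gin.
  have := fE g gin; rewrite eqxx [in f g]gsum (lin_sum lf) big_seq big1 => [|k hk].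
    by move/eqP; rewrite eq_sym oner_eq0.
  rewrite (linZ lf) fE //; case: eqP => [<-|_]; last by rewrite scaler0.
  by rewrite wg0 (lin0 (@counit_linear K B)) scale0r.
have [s [sg s0 sinv]] := unipotent_invariant_vector uniG (left_weight_supermodule g) (ww g gin) wg0.
have {}sinv : comul s = tens (s : B) 1 by exact: sinv.
have sE : s = (counit s : K) *: (1 : B).
  rewrite -[LHS]comul_counitl sinv tlift_tens //.
  by apply: (bilin_scale B); exact: counit_linear.
have es : counit s != 0 :> K^o.
  by apply/eqP => es; apply: s0; rewrite sE es scale0r.
have := bar_weight sg; rewrite [in bar s]sE (linZ lb) => /eqP.
rewrite -subr_eq0 -scalerBr scaler_eq0 (negPf es) /= subr_eq0 => /eqP <-.
by [].
Qed.

Lemma unipotent_even_part (b : B) : odd_ideal (b - (counit b : K) *: 1).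
Proof.
have lb := @bar_linear K GG; have le := @counit_linear K H.
have b1 : bar 1 = 1 by exact: hpi1.
apply/(@bar_eq0 K GG); rewrite (linB lb) (linZ lb) b1 -bar_counit.
have [s hs ->] := diagG (bar b); rewrite (lin_sum le) scaler_suml -sumrB big_seq big1 // => p /hs gp.
by rewrite (linZ le) (unipotent_grouplike_eq1 gp) counit1 /GRing.scale /= mulr1 subrr.
Qed.
End UnipotentEvenPart.

(** * Points with odd parameters and the bracket as a conjugation *)

Section Grassmann.
Variable K : fieldType.

(* The exterior algebra on two odd generators: [gr a b c d] stands for [a + b x + c y + d x y]. *)
Record grassmann := gr { gr_one : K; gr_x : K; gr_y : K; gr_xy : K }.
Definition gr_encode (z : grassmann) : K * K * K * K :=
  (gr_one z, gr_x z, gr_y z, gr_xy z).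
Definition gr_decode (z : K * K * K * K) : grassmann :=
  let: (a, b, c, d) := z in gr a b c d.
Fact gr_encodeK : cancel gr_encode gr_decode. Proof. by case. Qed.
HB.instance Definition _ := Choice.copy grassmann (can_type gr_encodeK).

Definition gr_add (z w : grassmann) : grassmann :=
  let: gr a b c d := z in let: gr a' b' c' d' := w in gr (a + a') (b + b') (c + c') (d + d').
Definition gr_scale (k : K) (z : grassmann) : grassmann :=
  let: gr a b c d := z in gr (k * a) (k * b) (k * c) (k * d).
Fact gr_addA : associative gr_add.
Proof. by move=> [????] [????] [????] /=; rewrite !addrA. Qed.
Fact gr_addC : commutative gr_add.
Proof. by move=> [a b c d] [????] /=; congr gr; rewrite addrC. Qed.
Fact gr_add0 : left_id (gr 0 0 0 0) gr_add.
Proof. by move=> [????] /=; rewrite !add0r. Qed.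
Fact gr_addN : left_inverse (gr 0 0 0 0) (gr_scale (-1)) gr_add.
Proof. by move=> [????] /=; rewrite !mulN1r !addNr. Qed.
HB.instance Definition _ := GRing.isZmodule.Build grassmann gr_addA gr_addC gr_add0 gr_addN.
Fact gr_scaleA a b z : gr_scale a (gr_scale b z) = gr_scale (a * b) z.
Proof. by case: z => * /=; rewrite !mulrA. Qed.
Fact gr_scale1 : left_id 1 gr_scale.
Proof. by case=> * /=; rewrite !mul1r. Qed.
Fact gr_scaleDr : right_distributive gr_scale +%R.
Proof. by move=> k [????] [????]; rewrite /GRing.add /= !mulrDr. Qed.
Fact gr_scaleDl z : {morph gr_scale^~ z : a b / a + b >-> a + b}.
Proof. by case: z => * a b; rewrite /GRing.add /= !mulrDl. Qed.
HB.instance Definition _ :=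
  GRing.Zmodule_isLmodule.Build K grassmann gr_scaleA gr_scale1 gr_scaleDr gr_scaleDl.

Lemma grD a b c d a' b' c' d' :
  gr a b c d + gr a' b' c' d' = gr (a + a') (b + b') (c + c') (d + d').
Proof. by []. Qed.
Lemma grZ k a b c d : k *: gr a b c d = gr (k * a) (k * b) (k * c) (k * d).
Proof. by []. Qed.
Lemma gr_ind (P : grassmann -> Prop) : (forall a b c d, P (gr a b c d)) -> forall x, P x.
Proof. by move=> h [a b c d]; exact: h. Qed.

Definition gr_mul (x y : grassmann) : grassmann :=
  let: gr a b c d := x in let: gr a' b' c' d' := y in
  gr (a * a') (a * b' + b * a') (a * c' + c * a') (a * d' + d * a' + (b * c' - c * b')).

Fact gr_mulA : associative gr_mul.
Proof.
elim/gr_ind => a b c d; elim/gr_ind => a' b' c' d'; elim/gr_ind => a'' b'' c'' d''.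
by rewrite /=; congr gr; ring.
Qed.
Fact gr_mul1l : left_id (gr 1 0 0 0) gr_mul.
Proof. by elim/gr_ind => a b c d; rewrite /=; congr gr; ring. Qed.
Fact gr_mul1r : right_id (gr 1 0 0 0) gr_mul.
Proof. by elim/gr_ind => a b c d; rewrite /=; congr gr; ring. Qed.
Fact gr_mulDl : left_distributive gr_mul +%R.
Proof.
elim/gr_ind => a b c d; elim/gr_ind => a' b' c' d'; elim/gr_ind => a'' b'' c'' d''.
by rewrite grD /= grD; congr gr; ring.
Qed.
Fact gr_mulDr : right_distributive gr_mul +%R.
Proof.
elim/gr_ind => a b c d; elim/gr_ind => a' b' c' d'; elim/gr_ind => a'' b'' c'' d''.
by rewrite grD /= grD; congr gr; ring.
Qed.
Fact gr_one_neq0 : gr 1 0 0 0 != 0.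
Proof. by apply/eqP => -[/eqP]; rewrite oner_eq0. Qed.
HB.instance Definition _ := GRing.Zmodule_isNzRing.Build grassmann
  gr_mulA gr_mul1l gr_mul1r gr_mulDl gr_mulDr gr_one_neq0.

Lemma grM a b c d a' b' c' d' : gr a b c d * gr a' b' c' d' =
  gr (a * a') (a * b' + b * a') (a * c' + c * a') (a * d' + d * a' + (b * c' - c * b')).
Proof. by []. Qed.

Fact gr_scalerAl (k : K) (x y : grassmann) : k *: (x * y) = (k *: x) * y.
Proof.
elim/gr_ind: x => a b c d; elim/gr_ind: y => a' b' c' d'.
by rewrite grM !grZ grM; congr gr; ring.
Qed.
HB.instance Definition _ := GRing.Lmodule_isLalgebra.Build K grassmann gr_scalerAl.
Fact gr_scalerAr (k : K) (x y : grassmann) : k *: (x * y) = x * (k *: y).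
Proof.
elim/gr_ind: x => a b c d; elim/gr_ind: y => a' b' c' d'.
by rewrite grM !grZ grM; congr gr; ring.
Qed.
HB.instance Definition _ := GRing.Lalgebra_isAlgebra.Build K grassmann gr_scalerAr.

Definition gr_spart (i : bool) (x : grassmann) : grassmann :=
  let: gr a b c d := x in if i then gr 0 b c 0 else gr a 0 0 d.
Fact gr_spart_linear i : linear (gr_spart i).
Proof.
move=> k; elim/gr_ind => a b c d; elim/gr_ind => a' b' c' d'.
by case: i; rewrite grZ grD /= grZ grD; congr gr; ring.
Qed.
Fact gr_spartD x : gr_spart false x + gr_spart true x = x.
Proof.
by elim/gr_ind: x => a b c d; rewrite /= grD; congr gr; ring.
Qed.
Fact gr_spartK i j x : gr_spart i (gr_spart j x) = if i == j then gr_spart j x else 0.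
Proof. by elim/gr_ind: x => a b c d; case: i; case: j. Qed.
HB.instance Definition _ := isSuperModule.Build K grassmann
  gr_spart_linear gr_spartD gr_spartK.

Lemma gr_even a b c d : spart false (gr a b c d) = gr a 0 0 d. Proof. by []. Qed.
Lemma gr_odd a b c d : spart true (gr a b c d) = gr 0 b c 0. Proof. by []. Qed.

Fact gr_spartM i j (x y : grassmann) : spart i x = x -> spart j y = y ->
  spart (i (+) j) (x * y) = x * y.
Proof.
move=> <- <-; elim/gr_ind: x => a b c d; elim/gr_ind: y => a' b' c' d'.
by case: i; case: j; rewrite ?(gr_even, gr_odd) grM ?(gr_even, gr_odd); congr gr; ring.
Qed.
HB.instance Definition _ := isSuperAlgebra.Build K grassmann gr_spartM.
Fact gr_superC i j (x y : grassmann) : spart i x = x -> spart j y = y ->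
  x * y = (-1) ^+ (i && j) *: (y * x).
Proof.
move=> <- <-; elim/gr_ind: x => a b c d; elim/gr_ind: y => a' b' c' d'.
by case: i; case: j; rewrite ?(gr_even, gr_odd) !grM grZ ?expr0 ?expr1; congr gr; ring.
Qed.
HB.instance Definition _ := isSuperCommutative.Build K grassmann gr_superC.

Definition top_coef (x : grassmann) : K^o := gr_xy x.
Lemma top_coef_linear : linear top_coef. Proof. by move=> k [????] [????]. Qed.
End Grassmann.

Section TangentPoints.
Variables (K : fieldType) (GG : supergroup K) (R : scomAlgType K).
Local Notation A := (coordAlg GG).
Variables (u : A -> K^o) (t : R).
Hypotheses (du : point_derivation true u) (ot : spart true t = t) (t2 : t * t = 0).
Let lu : linear u. Proof. by case: du. Qed.

(** The exponential of u t, which ends at first order because t t = 0. *)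
Definition tangent_fun (a : A) : R := (counit a : K) *: 1 + (u a : K) *: t.

Fact tangent_linear : linear tangent_fun.
Proof.
move=> c x y; rewrite /tangent_fun (@counit_linear K A) lu !scalerDl scalerDr !scalerA.
exact: addrACA.
Qed.
Fact tangent_multiplicative : monoid_morphism tangent_fun.
Proof.
split=> [|x y]; rewrite /tangent_fun.
  by rewrite counit1 (derivation1 du) scale0r addr0 scale1r.
case: du => _ mu _; rewrite counitM mu mulrDl !mulrDr -!scalerAl -!scalerAr.
rewrite !mulr1 !mul1r t2 !scaler0 addr0 !scalerA scalerDl.
by rewrite -addrA; congr (_ + _); rewrite addrC.
Qed.
Definition tangent_morphism : {lrmorphism A -> R} :=
  HB.pack_for {lrmorphism A -> R} tangent_fun
    (GRing.isLinear.Build _ _ _ _ tangent_fun tangent_linear)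
    (GRing.isMonoidMorphism.Build _ _ tangent_fun tangent_multiplicative).

Fact tangent_part i a : tangent_morphism (spart i a) = spart i (tangent_morphism a).
Proof.
rewrite /= /tangent_fun spartDr !spartZ spart_one.
have oi : spart i t = if i then t else 0 by rewrite -ot; case: i; rewrite spartK.
rewrite oi; case: i {oi}; first by rewrite counit_odd (odd_der_odd du) scale0r scaler0.
by rewrite counit_even (odd_der_even du) scale0r scaler0.
Qed.
Definition tangent_point : points GG R := SuperHom tangent_part.
Lemma tangent_pointE a : tangent_point a = (counit a : K) *: 1 + (u a : K) *: t.
Proof. by []. Qed.
End TangentPoints.

Section TangentConjugation.
Variables (K : fieldType) (GG : supergroup K).
Local Notation A := (coordAlg GG).
Variables (v w : A -> K^o).
Hypotheses (dv : point_derivation true v) (dw : point_derivation true w).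

Local Notation G2 := (grassmann K).
Local Notation mk := (@gr K).
Let x1 : G2 := mk 0 1 0 0.
Let x2 : G2 := mk 0 0 1 0.
Let ox1 : spart true x1 = x1. Proof. by []. Qed.
Let ox2 : spart true x2 = x2. Proof. by []. Qed.
Let x11 : x1 * x1 = 0. Proof. by rewrite grM !(mul0r, mulr0, addr0, subrr). Qed.
Let x22 : x2 * x2 = 0. Proof. by rewrite grM !(mul0r, mulr0, addr0, subrr). Qed.
Let g := tangent_point dw ox1 x11.
Let n := tangent_point dv ox2 x22.

(** Here g = 1 + x w and n = 1 + y v. The sign of w*v comes from the inverse of g and that of v*w
    from y x = - x y, so the two products add up to the superbracket. *)
Lemma top_coef_conjugation a :
  top_coef (point_mul (point_mul (point_inv g) n) g a) =
  - (convol v w a + convol w v a).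
Proof.
have [lv _ _] := dv; have [lw _ _] := dw; have le := @counit_linear K A.
have gE b : g b = mk (counit b) (w b) 0 0.
  rewrite tangent_pointE /x1 -[1]/(mk 1 0 0 0) !grZ grD !mulr0 !mulr1.
  by rewrite !addr0 add0r.
have nE b : n b = mk (counit b) 0 (v b) 0.
  rewrite tangent_pointE /x2 -[1]/(mk 1 0 0 0) !grZ grD !mulr0 !mulr1.
  by rewrite !addr0 add0r.
have giE b : point_inv g b = mk (counit b) (- w b) 0 0.
  by rewrite /point_inv gE counit_antipode (derivation_antipode _ dw).
have mk_sum (I : Type) (r : seq I) (a1 a2 a3 a4 : I -> K) :
    \sum_(i <- r) mk (a1 i) (a2 i) (a3 i) (a4 i) =
    mk (\sum_(i <- r) a1 i) (\sum_(i <- r) a2 i) (\sum_(i <- r) a3 i) (\sum_(i <- r) a4 i).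
  by elim: r => [|i r IH]; rewrite ?big_nil // !big_cons IH grD.
have PE b : point_mul (point_inv g) n b =
    mk (counit b) (- w b) (v b) (- convol w v b).
  transitivity (\sum_(p <- repr (comul b)) mk (counit p.1 * counit p.2)
      (- (w p.1 * counit p.2)) (counit p.1 * v p.2) (- (w p.1 * v p.2))).
    apply: eq_bigr => p _; rewrite giE nE grM.
    by congr gr; ring.
  rewrite mk_sum !sumrN; congr gr.
  - by rewrite -[LHS]/(convol _ _ b) convol_counitl.
  - by congr (- _); rewrite -[LHS]/(convol w counit b) convol_counitr.
  - by rewrite -[LHS]/(convol counit v b) convol_counitl.
transitivity (\sum_(p <- repr (comul a)) (- (convol w v p.1 * counit p.2) - (v p.1 * w p.2)) : K^o).
  rewrite -[point_mul _ g a]/(\sum_(p <- repr (comul a)) point_mul (point_inv g) n p.1 * g p.2).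
  rewrite (lin_sum (@top_coef_linear K)).
  by apply: eq_bigr => p _; rewrite PE gE grM /top_coef /=; ring.
have lwv : linear (convol w v).
  exact: (linear_comp (@comul_linear K A) (tlift_linear (bilin_mulK lw lv))).
rewrite big_split /= !sumrN -[\sum_(p <- _) _ * counit _]/(convol (convol w v) counit a).
rewrite convol_counitr // -[\sum_(p <- _) _]/(convol v w a).
by rewrite opprD addrC.
Qed.

Lemma normal_bracket_vanishes (N : hopfIdeal A) a :
  normal_supersub N -> (forall b, N b -> v b = 0) -> N a -> convol v w a + convol w v a = 0.
Proof.
move=> nN vN Na; apply/eqP; rewrite -oppr_eq0 -top_coef_conjugation; apply/eqP.
have hn b : N b -> n b = 0.
  by move=> Nb; rewrite tangent_pointE (hopfIdeal_counit Nb) vN // !scale0r addr0.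
by rewrite (nN _ g n hn a Na).
Qed.
End TangentConjugation.

(** * From a nondegenerate bracket to a trivial unipotent radical *)

Section UnipotentRadical.
Variables (K : fieldType) (char2 : 2%N \notin [pchar K]) (GG : supergroup K).
Local Notation A := (coordAlg GG).

Lemma derivation_quotient i (N : hopfIdeal A) (D : A -> K^o) :
  point_derivation i D -> (forall a, N a -> D a = 0) ->
  exists2 D' : coordAlg (closedSub N) -> K^o, point_derivation i D' &
    forall a, D' (hpi N a) = D a.
Proof.
move=> [lD mD pD] DN.
have E a : D (repr (hpi N a)) = D a.
  by apply/eqP; rewrite -subr_eq0 -(linB lD) DN //; exact: repr_hpi.
exists (fun x => D (repr x)) => //; split=> [c|x y|x].
- elim/hopfQuot_ind => x; elim/hopfQuot_ind => y.
  by rewrite -(hpi_linear N) !E lD.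
- elim/hopfQuot_ind: x => x; elim/hopfQuot_ind: y => y.
  by rewrite -hpiM !E mD; congr (_ * _ + _ * _); exact: (esym (qcounitE N _)).
elim/hopfQuot_ind: x => x.
by rewrite -[spart _ _](hpi_part N) E.
Qed.

Lemma derivation_restriction i (N : hopfIdeal A) (u : coordAlg (closedSub N) -> K^o) :
  point_derivation i u -> point_derivation i (fun a => u (hpi N a)).
Proof.
move=> [lu mu pu]; split=> [c x y|x y|x].
- by rewrite hpi_linear lu.
- by rewrite hpiM mu; congr (_ * _ + _ * _); exact: (qcounitE N).
by rewrite hpi_part pu.
Qed.

(** The induced map [k] from K[GG_ev] to K[N_ev] is a surjection of Hopf algebras, so it carries
    spanning grouplikes to spanning grouplikes. *)
Lemma closedSub_diagonalizable (N : hopfIdeal A) :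
  even_diagonalizable GG -> even_diagonalizable (closedSub N).
Proof.
move=> diagG; pose C := coordAlg (evenSub (closedSub N)).
pose q (a : A) : C := @evenRes K (closedSub N) (hpi N a).
have lh := hpi_linear N; have lb := @bar_linear K (closedSub N).
have lq : linear q by exact: linear_comp lh lb.
have q0 x : odd_ideal x -> q x = 0.
  move=> hx; apply: (hx (fun x => q x = 0)) => [|y <-].
    split=> [|y z hy hz|y z hz]; first exact: (lin0 lq).
      by rewrite (linD lq) hy hz addr0.
    by rewrite /q !hpiM !barM -!/(q _) hz mulr0 mul0r.
  by rewrite /q hpi_part bar_odd.
pose k (x : coordAlg (evenSub GG)) : C := q (repr x).
have kE a : k (@evenRes K GG a) = q a.
  by apply/eqP; rewrite -subr_eq0 -(linB lq) q0 //; exact: (@repr_hpi K A (oddIdeal A) a).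
have lb' := @bar_linear K GG.
have lk : linear k.
  move=> c x y; have [x' ->] := bar_surj x; have [y' ->] := bar_surj y.
  by rewrite -lb' !kE lq.
have kgrp g : grouplike g -> grouplike (k g).
  move=> [dg eg]; have [a gE] := bar_surj g; split.
    rewrite -[RHS](tmap_tens g g lk lk) -dg gE kE bar_comul tmap_comp // bar_comul.
    have -> : comul (hpi N a : coordAlg (closedSub N)) = tmap (hpi N) (hpi N) (comul a).
      exact: qcomulE.
    by rewrite tmap_comp //; apply: eq_bigr => p _; rewrite !kE.
  rewrite gE kE bar_counit.
  have -> : counit (hpi N a : coordAlg (closedSub N)) = counit a by exact: qcounitE.
  by rewrite -[LHS](bar_counit a) -gE.
move=> y; have [b ->] := bar_surj y.
have [a ->] : exists a, b = hpi N a by exists (repr b); rewrite hpi_repr.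
have [s hs E] := diagG (@evenRes K GG a).
exists [seq (p.1, k p.2) | p <- s] => [p /mapP[r hr ->]|].
  by apply: kgrp; exact: hs.
rewrite big_map /= -[evenRes _]/(q a) -kE E (lin_sum lk); apply: eq_bigr => p _.
exact: (linZ lk).
Qed.

Lemma trivial_radical : even_diagonalizable GG ->
  nondegenerate_pairing (@odd_bracket K GG) ->
  forall N : hopfIdeal A, normal_supersub N -> unipotent (closedSub N) ->
    forall a, counit a = 0 -> N a.
Proof.
move=> diagG [nd _] N nN uN a ea; apply: contrapT => Na.
pose B := coordAlg (closedSub N); pose q : A -> B := hpi N.
have lq : linear q by exact: hpi_linear.
have qe b : counit (q b) = counit b by exact: qcounitE.
have evenB := unipotent_even_part uN (@closedSub_diagonalizable N diagG).
have Jqa : odd_ideal (q a) by have := evenB (q a); rewrite qe ea scale0r subr0.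
have [u du [x ux]] : exists2 u : B -> K^o, point_derivation true u & exists x, u x <> 0.
  apply: contrapT => nu; apply: Na.
  have qa0 : q a = 0.
    apply: (lder_injective char2 (coord_fg (closedSub N))) => // u du.
    apply: big1 => p _; rewrite /scal (_ : u p.1 = 0) ?scale0r ?mul0r //.
    by apply: contrapT => up; apply: nu; exists u => //; exists p.1.
  by have /hpiP := etrans qa0 (esym (lin0 lq)); rewrite subr0.
have dv := derivation_restriction du; set v := (fun a => _) in dv.
have vN b : N b -> v b = 0.
  move=> Nb; rewrite /v (_ : hpi N b = 0) ?(lin0 (let: And3 l _ _ := du in l)) //.
  by rewrite -(lin0 lq); apply/hpiP; rewrite subr0.
have [v' v'E] := oddLie_of dv.
suff v'0 : v' = 0.
  apply: ux; have [b ->] : exists b, x = q b by exists (repr x); rewrite /q hpi_repr.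
  by rewrite -[LHS]/(v b) -v'E v'0.
apply: nd => // w _; apply/val_inj/funext => b.
rewrite -[LHS]/(pairing (odd_bracket v' w) b).
set d := pairing _; have dd : point_derivation false d by exact: lieP.
(* Normality makes d vanish on the ideal of N, so it descends to an even derivation of K[N]; this is
   zero because N has trivial even part. *)
have dN c : N c -> d c = 0.
  move=> Nc; rewrite /d odd_bracketE v'E.
  exact: (normal_bracket_vanishes dv (lieP w) nN vN Nc).
have [d' dd' d'E] := derivation_quotient dd dN.
have [ld' _ _] := dd'.
have d'J := even_derivation_odd_ideal dd' (evenB (q b)).
move: d'J; rewrite (linB ld') (linZ ld') (derivation1 dd') scaler0 subr0.
by rewrite -d'E.
Qed.

Lemma zero_derivation : point_derivation true (fun _ : A => (0 : K^o)).
Proof.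
split=> [c x y|x y|x] //; first by rewrite scaler0 addr0.
by rewrite mul0r mulr0 addr0.
Qed.

Lemma nondegenerate_super_diagonalizable : even_diagonalizable GG ->
  nondegenerate_pairing (@odd_bracket K GG) -> super_diagonalizable GG.
Proof.
move=> diagG nd; split=> //.
have zz (a : A) : convol (fun=> 0) (fun=> 0) a = 0 by apply: big1 => p _; rewrite mul0r.
have o0 : spart true (0 : A) = 0 by exact: spart0.
have z0 (a : A) : 0 * 0 = 0 :> K by rewrite mul0r.
(* The trivial super-subgroup is the degenerate line with v = 0 and t = 0. *)
pose U := lineIdeal zero_derivation zz o0 z0.
exists U; split; last by move=> a; split=> [[]|].
split; last by move=> N nN uN a [ea _]; exact: trivial_radical.
  apply: line_normal => a _; rewrite /adj.
  apply: big1 => p _; rewrite [X in _ * X]big1 ?mulr0 // => r _.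
  by rewrite /scal scale0r mul0r.
exact: line_unipotent.
Qed.
End UnipotentRadical.

Theorem proposition3p8 (K : fieldType) (charK : 2%N \notin [pchar K])
    (GG : supergroup K) (diagG : even_diagonalizable GG)
    (lam : oddLie GG -> tensor (coordAlg (evenSub GG)) (oddLie GG))
    (lamE : is_odd_coaction lam) :
  (super_diagonalizable GG <-> nondegenerate_pairing (@odd_bracket K GG)) /\
  (nondegenerate_pairing (@odd_bracket K GG) <->
   forall g : coordAlg (evenSub GG), grouplike g ->
     (exists2 v, weight_space lam g v & v <> 0) ->
     nondegenerate_pairing_on (weight_space lam g) (weight_space lam (antipode g))
       (@odd_bracket K GG)).
Proof.
split; split.
- exact: (super_diagonalizable_nondegenerate charK lamE diagG).
- exact: nondegenerate_super_diagonalizable.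
- by move=> nd g gg _; exact: (nondegenerate_weights lamE diagG nd).
exact: (weights_nondegenerate lamE diagG).
Qed.
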